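(* Let two parameter values $\xi_1\ge\xi_2\ge 0$ be given, and let $(u_1,\tau_1)$ and $(u_2,\tau_2)$ be the two solutions of the damped wave system $$\partial_t u_i-\partial_y\tau_i=f,\qquad \partial_t\tau_i-G\,\partial_y u_i=-\xi_i\,\tau_i\qquad (i=1,2)$$ with the same conditions (same initial conditions, same source term $f$ and, when $\Omega$ is bounded, same boundary conditions). With $w_i^\pm=\tau_i\pm\sqrt G\,u_i$, $z_{i,l}^+=c_l^u u_i-c_l^\tau\tau_i$ and $z_{i,r}^-=c_r^u u_i-c_r^\tau\tau_i$, they satisfy $$\frac{d}{dt}\int_\Omega\frac12\Big(|w_1^+-w_2^+|^2+|w_1^--w_2^-|^2\Big)+\frac{\sqrt G}{2c_l^uc_l^\tau}\,\big|z_{1,l}^+-z_{2,l}^+\big|^2_{y_{\min}}+\frac{\sqrt G}{2c_r^uc_r^\tau}\,\big|z_{1,r}^--z_{2,r}^-\big|^2_{y_{\max}}+\frac{\xi_1+\xi_2}{2}\int_\Omega(\tau_2-\tau_1)^2\ \le\ \frac{\xi_1-\xi_2}{2}\int_\Omega\tau_2^2,$$ i.e. there is continuous dependence on the relaxation parameter: $(u_1,\tau_1)\to(u_2,\tau_2)$ as $\xi_1\to\xi_2$, in $L^2(\Omega)$ for all times $t\ge0$, as well as in $L^2(0,T)$ on the boundary $\partial\Omega$.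
   Context: $G>0$ is a fixed constant (elastic modulus) and $\Omega=(y_{\min},y_{\max})\subset\mathbb R$ is an open interval, either $\Omega=\mathbb R$ (no boundary condition, hence no boundary terms in the inequality) or with $y_{\min},y_{\max}$ finite. For $i=1,2$, $u_i(t,y)$ and $\tau_i(t,y)$ are the time-continuous solutions on $t\ge0$, with values in $L^2(\Omega)$, with initial conditions $u_i(0,y)=u^0(y)$ and $\tau_i(0,y)=\tau^0(y)$, where $u^0,\tau^0\in L^2(\Omega)$ and $f\in L^2((0,T)\times\Omega)$. When $y_{\min},y_{\max}$ are finite, the solutions satisfy in addition the maximally dissipative boundary conditions $$c_l^u u_i+c_l^\tau\tau_i=g_l\ \text{ at } y_{\min},\qquad c_r^u u_i+c_r^\tau\tau_i=g_r\ \text{ at } y_{\max},$$ with given boundary data $g_l,g_r\in L^2(0,T)$ and real coefficients such that $c_l^uc_l^\tau<0$, $c_l^\tau\ne-\sqrt G\,c_l^u$, $c_r^uc_r^\tau>0$, $c_r^\tau\ne\sqrt G\,c_r^u$. The system models one-dimensional shear waves of a Maxwell fluid with velocity $u$, shear stress $\tau$ and relaxation time $\lambda=1/\xi$; the case $\xi=0$ is the standard wave system of 1D elastodynamics.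
   Formalization: The printed inequality is false; proved here with damping factor ξ1+ξ2, right-hand factor ξ1−ξ2, and boundary coefficients −G/(2c_l^u c_l^τ) at y_min and G/(2c_r^u c_r^τ) at y_max, in place of (ξ1+ξ2)/2, (ξ1−ξ2)/2 and the two coefficients with √G. *)

(* Defs.v *)
From HB Require Import structures.
From mathcomp Require Import all_boot all_order all_algebra.
From mathcomp Require Import all_classical all_reals all_analysis.
Set Implicit Arguments.
Unset Strict Implicit.
Unset Printing Implicit Defensive.
Import Order.TTheory GRing.Theory Num.Theory.
Import numFieldNormedType.Exports.
Local Open Scope classical_set_scope.
Local Open Scope ring_scope.

Section L2.
Variable R : realType.
Notation mu := (@lebesgue_measure R).

Definition L2 (D : set R) (h : R -> R) : Prop := h \_ D \in Lfun mu 2%:E.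

(* Source terms are functions of (time, space). *)
Definition L2_spacetime (T : R) (D : set R) (h : R -> R -> R) : Prop :=
  (fun p : R * R => h p.1 p.2) \_ (`]0, T[ `*` D) \in Lfun (mu \x mu)%E 2%:E.

Definition L2norm (D : set R) (h : R -> R) : \bar R :=
  'N[mu]_2%:E[EFin \o (h \_ D)]%E.

Definition L2_continuous (D : set R) (h : R -> R -> R) : Prop :=
  (forall t, 0 <= t -> L2 D (h t)) /\
  (forall t, 0 <= t ->
    L2norm D (h s \- h t) @[s --> within [set s | 0 <= s] (nbhs t)] --> 0%E).

(* A function on [0, +oo[ that is differentiable a.e. and absolutely continuous
   on every [0, T], i.e. an indefinite integral (the density g is then equal to
   the derivative a.e.); this is what gives a meaning to d/dt for the energy of
   a merely square-integrable solution. *)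
Definition locally_absolutely_continuous (e : R -> R) : Prop :=
  {ae mu, forall t, 0 < t -> derivable e t 1} /\
  exists g : R -> R,
    (forall T, 0 < T -> mu.-integrable `[0, T] (EFin \o g)) /\
    (forall t, 0 <= t -> e t = e 0 + \int[mu]_(s in `[0, t]) g s).

Definition test_function (phi : R -> R) : Prop :=
  [/\ forall y, derivable phi y 1, continuous (phi^`())%classic &
      compact (closure [set y | phi y != 0])].

End L2.

Record interval_problem (R : realType) := IntervalProblem {
  ymin : R; ymax : R;
  cul : R; ctaul : R;
  cur : R; ctaur : R;
  gl : R -> R; gr : R -> R }.

Variant domain (R : realType) :=
  | WholeLine
  | BoundedInterval of interval_problem R.
Arguments WholeLine {R}.

Definition Omega (R : realType) (D : domain R) : set R :=
  match D with
  | WholeLine => setT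
  | BoundedInterval b => `]ymin b, ymax b[
  end.

Definition admissible (R : realType) (G : R) (D : domain R) : Prop :=
  match D with
  | WholeLine => True
  | BoundedInterval b =>
      [/\ ymin b < ymax b,
          cul b * ctaul b < 0 /\ ctaul b != - Num.sqrt G * cul b,
          0 < cur b * ctaur b /\ ctaur b != Num.sqrt G * cur b &
          forall T, 0 < T -> L2 `]0, T[ (gl b) /\ L2 `]0, T[ (gr b)]
  end.

(* The values of an L^2 function at the end points of the interval are
   meaningless, so the boundary traces (functions of time) are part of a
   solution; they are determined by the Green formula in [weak_balance].
   They play no role on the whole line. *)
Record wave (R : realType) := Wave {
  vel : R -> R -> R; str : R -> R -> R;
  vel_l : R -> R; str_l : R -> R;
  vel_r : R -> R; str_r : R -> R }.

(* The balance law d_t q - d_y p = r on Omega, integrated over [0, t] and tested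
   in space against restrictions to the closure of Omega of C^1 functions with
   compact support in R; p has traces pl at ymin and pr at ymax. *)
Definition weak_balance (R : realType) (D : domain R)
    (q p : R -> R -> R) (pl pr : R -> R) (r : R -> R -> R) : Prop :=
  let mu := @lebesgue_measure R in
  forall phi, test_function phi -> forall t, 0 <= t ->
    \int[mu]_(y in Omega D) (q t y * phi y)
    - \int[mu]_(y in Omega D) (q 0 y * phi y) =
    \int[mu]_(s in `[0, t])
      (match D with
       | WholeLine => 0
       | BoundedInterval b => pr s * phi (ymax b) - pl s * phi (ymin b)
       end
       - \int[mu]_(y in Omega D) (p s y * (phi^`())%classic y)
       + \int[mu]_(y in Omega D) (r s y * phi y)).

Definition boundary_conditions (R : realType) (D : domain R) (w : wave R) :
    Prop :=
  let mu := @lebesgue_measure R in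
  match D with
  | WholeLine => True
  | BoundedInterval b =>
    (forall T, 0 < T ->
      [/\ L2 `]0, T[ (vel_l w), L2 `]0, T[ (str_l w),
          L2 `]0, T[ (vel_r w) & L2 `]0, T[ (str_r w)]) /\
    {ae mu, forall t, 0 < t ->
      cul b * vel_l w t + ctaul b * str_l w t = gl b t /\
      cur b * vel_r w t + ctaur b * str_r w t = gr b t}
  end.

Definition damped_wave_solution (R : realType) (G xi : R) (D : domain R)
    (u0 tau0 : R -> R) (f : R -> R -> R) (w : wave R) : Prop :=
  let mu := @lebesgue_measure R in
  [/\ L2_continuous (Omega D) (vel w) /\ L2_continuous (Omega D) (str w),
      {ae mu, forall y, Omega D y -> vel w 0 y = u0 y /\ str w 0 y = tau0 y},
      weak_balance D (vel w) (str w) (str_l w) (str_r w) f,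
      weak_balance D (str w) (fun t y => G * vel w t y)
        (fun t => G * vel_l w t) (fun t => G * vel_r w t)
        (fun t y => - xi * str w t y) &
      boundary_conditions D w].

Definition wplus (R : realType) (G : R) (w : wave R) (t y : R) : R :=
  str w t y + Num.sqrt G * vel w t y.

Definition wminus (R : realType) (G : R) (w : wave R) (t y : R) : R :=
  str w t y - Num.sqrt G * vel w t y.

Definition zplus_l (R : realType) (b : interval_problem R) (w : wave R)
    (t : R) : R :=
  cul b * vel_l w t - ctaul b * str_l w t.

Definition zminus_r (R : realType) (b : interval_problem R) (w : wave R)
    (t : R) : R :=
  cur b * vel_r w t - ctaur b * str_r w t.

(* Both coefficients are positive since cul * ctaul < 0 < cur * ctaur. For the
   difference of two solutions the boundary conditions are homogeneous, so the
   energy flux -2 G (u * tau) at ymax equals G z^2 / (2 cur ctaur), and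
   2 G (u * tau) at ymin equals - G z^2 / (2 cul ctaul). *)
Definition boundary_dissipation (R : realType) (G : R) (D : domain R)
    (w1 w2 : wave R) (t : R) : R :=
  match D with
  | WholeLine => 0
  | BoundedInterval b =>
      - (G / (2 * cul b * ctaul b)) * `|zplus_l b w1 t - zplus_l b w2 t| ^+ 2
      + G / (2 * cur b * ctaur b) * `|zminus_r b w1 t - zminus_r b w2 t| ^+ 2
  end.

(* Main.v *)
Require Import Defs.
From mathcomp Require Import all_boot all_order all_algebra.
From mathcomp Require Import all_classical all_reals all_analysis.
From mathcomp Require Import measurable_realfun ring lra.
Import Order.TTheory GRing.Theory Num.Theory.
Import numFieldNormedType.Exports.
Set Implicit Arguments.
Unset Strict Implicit.
Unset Printing Implicit Defensive.
Local Open Scope classical_set_scope.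
Local Open Scope ring_scope.

(** For the difference of two solutions, [tau + a u] with [a = +/- sqrt G] is a
    weak solution of the transport equation [w_t - a w_y = r], where [r] is the
    difference of the relaxation terms. Pulled back along the characteristics
    and completed by its inflow data (before they enter) and outflow data (after
    they have left), it becomes a curve [V] in L2 of the whole line without any
    boundary term, such that [V t - V 0] is the weak integral of the pulled-back
    source. Since C^1 test functions are dense, the squared norm of [V] has
    derivative [2 <r, w>]; this gives the balance of the energy of [w] with its
    squared traces, although [w] has no derivative. Adding the balances for the
    two values of [a] gives the energy identity in integrated form; the
    inequality follows from the algebra of the boundary conditions and of the
    relaxation terms, and the convergences from the integrated inequality. *)

(** * Square-integrable functions on the line *)

(** Neither solution is differentiable in time or space, so the equation cannot be multiplied by
    [w]; and the traces are known only through the Green formula, so smoothing [w] would disturb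
    them at the boundary. The curve [V] avoids both difficulties: its three pieces live on disjoint
    parts of the line, so their squared norms add, and the squared norms of the data stored at times
    [0] and [T] are, up to the speed [|c|], the integrals of the squared traces. No vector-valued
    integral is used: the source is paired with test functions, and real functions of time are
    compared through their increments. The traces being merely integrable, these increments are not
    bounded by a multiple of the elapsed time; they are measured by the integral of the absolute
    values of the traces. The source [f] disappears in the difference of two solutions, but the
    integrand of each balance must first be known to be integrable, which takes Fubini's theorem. *)

Section square_integrable.
Variable R : realType.
Notation mu := (@lebesgue_measure R).
Implicit Types f g h : R -> R.

(** Measurability of [f] is required separately, since that of its square does not imply it. *)
Definition sqint f :=
  measurable_fun setT f /\ mu.-integrable setT (EFin \o (fun x => f x ^+ 2)).

Definition ip f g : R := \int[mu]_x (f x * g x).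

Definition nrm f : R := Num.sqrt (ip f f).

Lemma integrable_le f g : measurable_fun setT f -> (forall x, `|f x| <= g x) ->
  mu.-integrable setT (EFin \o g) -> mu.-integrable setT (EFin \o f).
Proof.
move=> mf fg; apply: le_integrable => //; first exact/measurable_EFinP.
by move=> x _ /=; rewrite lee_fin; apply: (le_trans (fg x)); exact: ler_norm.
Qed.

Lemma sqint_integrableM f g : sqint f -> sqint g ->
  mu.-integrable setT (EFin \o (fun x => f x * g x)).
Proof.
move=> [mf f2] [mg g2].
apply: (@integrable_le _ (fun x => f x ^+ 2 + g x ^+ 2)).
- exact: measurable_funM.
- move=> x; have := sqr_ge0 (f x + g x); have := sqr_ge0 (f x - g x).
  rewrite sqrrB sqrrD ler_norml => ? ?; apply/andP; split;
  have := sqr_ge0 (f x); have := sqr_ge0 (g x); lra.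
- exact: (integrableD measurableT f2 g2).
Qed.

Lemma sqintD f g : sqint f -> sqint g -> sqint (f \+ g).
Proof.
move=> [mf f2] [mg g2]; split; first exact: measurable_funD.
apply: (@integrable_le _ (fun x => 2 * (f x ^+ 2 + g x ^+ 2))).
- by apply: measurable_funX; exact: measurable_funD.
- by move=> x; rewrite ger0_norm ?sqr_ge0//=; have := sqr_ge0 (f x - g x);
    rewrite sqrrB sqrrD; lra.
- exact: (integrableZl measurableT 2 (integrableD measurableT f2 g2)).
Qed.

Lemma sqintZ f a : sqint f -> sqint (fun x => a * f x).
Proof.
move=> [mf f2]; split; first by apply: measurable_funM.
apply: eq_integrable (integrableZl measurableT (a ^+ 2) f2) => // x _ /=.
by rewrite exprMn.
Qed.

Lemma sqint0 : sqint (fun=> 0).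
Proof.
split => //; apply: eq_integrable (integrable0 mu setT) => // x _ /=.
by rewrite expr0n.
Qed.

Lemma sqintB f g : sqint f -> sqint g -> sqint (f \- g).
Proof.
move=> sf sg; rewrite (_ : _ \- _ = f \+ (fun x => -1 * g x)).
  by apply: sqintD => //; exact: sqintZ.
by apply/funext => x /=; rewrite mulN1r.
Qed.

Lemma ipC f g : ip f g = ip g f.
Proof. by apply: eq_Rintegral => x _; rewrite mulrC. Qed.

Lemma ipDl f g h : sqint f -> sqint g -> sqint h ->
  ip (f \+ g) h = ip f h + ip g h.
Proof.
move=> sf sg sh; rewrite /ip -RintegralD//; try exact: sqint_integrableM.
by apply: eq_Rintegral => x _; rewrite /= mulrDl.
Qed.

Lemma ipZl f g a : sqint f -> sqint g -> ip (fun x => a * f x) g = a * ip f g.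
Proof.
move=> sf sg; rewrite /ip -RintegralZl//; try exact: sqint_integrableM.
by apply: eq_Rintegral => x _; rewrite /= mulrA.
Qed.

Lemma ipBl f g h : sqint f -> sqint g -> sqint h ->
  ip (f \- g) h = ip f h - ip g h.
Proof.
move=> sf sg sh; rewrite /ip -RintegralB//; try exact: sqint_integrableM.
by apply: eq_Rintegral => x _; rewrite /= mulrBl.
Qed.

Lemma ipDr f g h : sqint f -> sqint g -> sqint h ->
  ip h (f \+ g) = ip h f + ip h g.
Proof. by move=> *; rewrite ipC ipDl// ipC (ipC g). Qed.

Lemma ipZr f g a : sqint f -> sqint g -> ip g (fun x => a * f x) = a * ip g f.
Proof. by move=> *; rewrite ipC ipZl// ipC. Qed.

Lemma ipBr f g h : sqint f -> sqint g -> sqint h ->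
  ip h (f \- g) = ip h f - ip h g.
Proof. by move=> *; rewrite ipC ipBl// ipC (ipC g). Qed.

Lemma ip_ge0 f : 0 <= ip f f.
Proof. by apply: Rintegral_ge0 => x _; rewrite -expr2 sqr_ge0. Qed.

Lemma nrm_ge0 f : 0 <= nrm f. Proof. exact: sqrtr_ge0. Qed.

Lemma nrm_sqr f : nrm f ^+ 2 = ip f f.
Proof. by rewrite sqr_sqrtr// ip_ge0. Qed.

Lemma cauchy_schwarz f g : sqint f -> sqint g -> `|ip f g| <= nrm f * nrm g.
Proof.
move=> sf sg.
have key a : 0 <= ip f f - 2 * a * ip f g + a ^+ 2 * ip g g.
  have sag := sqintZ a sg.
  have := ip_ge0 (f \- (fun x => a * g x)).
  rewrite ipBl ?ipBr//; [|exact: sqintB..].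
  by rewrite !(ipZl,ipZr)// (ipC g f); lra.
rewrite -sqrtrM ?ip_ge0// -sqrtr_sqr ler_wsqrtr//.
have [g0|g0] := eqVneq (ip g g) 0.
  suff -> : ip f g = 0 by rewrite expr0n mulr_ge0 ?ip_ge0.
  apply/eqP; apply: contraT => fg0.
  (* When [ip g g = 0] the quadratic is affine in [a]; at this value of [a] it equals [-1]. *)
  have := key ((ip f f + 1) / (2 * ip f g)).
  rewrite g0 mulr0 addr0 mulrAC.
  have -> : 2 * ip f g * ((ip f f + 1) / (2 * ip f g)) = ip f f + 1 by field.
  by rewrite opprD addrA subrr add0r oppr_ge0 ler10.
have gp : 0 < ip g g by rewrite lt_neqAle eq_sym g0 ip_ge0.
(* The minimiser of the quadratic. *)
have := key (ip f g / ip g g).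
rewrite (_ : _ + _ = (ip f f * ip g g - ip f g ^+ 2) / ip g g); last by field.
by rewrite pmulr_lge0 ?invr_gt0// subr_ge0.
Qed.

Lemma nrmD f g : sqint f -> sqint g -> nrm (f \+ g) <= nrm f + nrm g.
Proof.
move=> sf sg; rewrite -(@ler_pXn2r _ 2)// ?nnegrE ?addr_ge0 ?nrm_ge0//.
rewrite sqrrD !nrm_sqr ipDl ?ipDr//; last exact: sqintD.
have := cauchy_schwarz sf sg; rewrite ler_norml => /andP[_].
by rewrite (ipC g f); lra.
Qed.

Lemma nrmZ f a : sqint f -> nrm (fun x => a * f x) = `|a| * nrm f.
Proof.
move=> sf; rewrite /nrm ipZl ?ipZr//; last exact: sqintZ.
by rewrite mulrA -expr2 sqrtrM ?sqr_ge0// sqrtr_sqr.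
Qed.

Lemma nrmBC f g : nrm (f \- g) = nrm (g \- f).
Proof.
congr Num.sqrt; apply: eq_Rintegral => x _ /=; ring.
Qed.

Lemma nrmB f g : sqint f -> sqint g -> nrm (f \- g) <= nrm f + nrm g.
Proof.
move=> sf sg; rewrite (_ : _ \- _ = f \+ (fun x => -1 * g x)).
  apply: (le_trans (nrmD sf (sqintZ _ sg))).
  by rewrite nrmZ// normrN1 mul1r.
by apply/funext => x /=; rewrite mulN1r.
Qed.

Lemma nrm_triangle f g h : sqint f -> sqint g -> sqint h ->
  nrm (f \- h) <= nrm (f \- g) + nrm (g \- h).
Proof.
move=> sf sg sh; rewrite (_ : f \- h = (f \- g) \+ (g \- h)).
  by apply: nrmD; exact: sqintB.
by apply/funext => x /=; ring.
Qed.

Lemma le_nrm f g : measurable_fun setT f -> sqint g ->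
  (forall x, `|f x| <= `|g x|) -> sqint f /\ nrm f <= nrm g.
Proof.
move=> mf [mg g2] fg.
have fg2 x : f x ^+ 2 <= g x ^+ 2.
  by rewrite -(real_normK (num_real (f x))) -(real_normK (num_real (g x))) lerXn2r// nnegrE.
have sf : sqint f.
  split => //; apply: (integrable_le _ _ g2); first exact: measurable_funX.
  by move=> x; rewrite ger0_norm ?sqr_ge0.
split => //; rewrite ler_wsqrtr// /ip.
have sg : sqint g by [].
apply: (le_Rintegral measurableT (sqint_integrableM sf sf) (sqint_integrableM sg sg)).
by move=> x _; rewrite -!expr2.
Qed.

Lemma sqint_indic_itv a b : sqint (\1_`[a, b]).
Proof.
split; first exact: measurable_indic.
rewrite (_ : _ \o _ = EFin \o \1_`[a, b]).
  exact: integrable_indic_itv.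
by apply/funext => x /=; rewrite indicE -natrX; case: (_ \in _).
Qed.

Lemma nrm_indic_itv a b : a <= b -> nrm (\1_`[a, b]) = Num.sqrt (b - a).
Proof.
move=> ab; congr Num.sqrt; rewrite /ip.
transitivity (\int[mu]_x (\1_`[a, b] x : R)).
  by apply: eq_Rintegral => x _; rewrite indicE -natrM; case: (_ \in _).
rewrite /Rintegral integral_indic// setIT /= lebesgue_measure_itv/= lte_fin.
by case: ltgtP ab => // ->; rewrite subrr.
Qed.

(** Comparison with [M] times the indicator of the segment. Uniform estimates on averages and
    translates become L2 estimates through this bound. *)
Lemma bounded_support_nrm f a b M : a <= b -> measurable_fun setT f ->
  (forall x, `|f x| <= M) -> (forall x, ~ `[a, b]%classic x -> f x = 0) ->
  sqint f /\ nrm f <= M * Num.sqrt (b - a).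
Proof.
move=> ab mf fM f0.
have M0 : 0 <= M by exact: le_trans (normr_ge0 _) (fM 0).
have /le_nrm := mf => /(_ _ (sqintZ M (sqint_indic_itv a b))).
rewrite nrmZ; last exact: sqint_indic_itv.
rewrite nrm_indic_itv// (ger0_norm M0); apply => x.
rewrite indicE; case: (boolP (x \in _)) => [_|]; first by rewrite mulr1 (ger0_norm M0).
by rewrite notin_setE => /f0 ->; rewrite normr0.
Qed.

Lemma Lfun2P f : f \in Lfun mu 2%:E <-> sqint f.
Proof.
split.
  move=> l2f; split; last exact: Lfun2_integrable_sqr.
  by move: l2f; rewrite inE => /andP[]; rewrite inE.
move=> [mf /integrableP[_ f2]]; rewrite inE; apply/andP; split; first by rewrite inE.
rewrite inE/= /finite_norm unlock /=; apply: poweR_lty; apply: le_lt_trans f2.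
rewrite le_eqVlt; apply/orP; left; apply/eqP.
apply: eq_integral => x _ /=.
by rewrite powR_mulrn// normrX.
Qed.

Lemma LnormE f : sqint f -> ('N[mu]_2%:E[EFin \o f] = (nrm f)%:E)%E.
Proof.
move=> sf; rewrite unlock /=.
rewrite (_ : (\int[mu]_x _)%E = (ip f f)%:E).
  by rewrite /nrm poweR_EFin -powR12_sqrt ?ip_ge0.
rewrite /ip /Rintegral fineK.
  apply: eq_integral => x _ /=.
  by rewrite powR_mulrn// real_normK ?num_real// expr2.
apply: integrable_fin_num => //.
exact: sqint_integrableM.
Qed.

End square_integrable.

(** * Test functions and their density in L2 *)

Section bounded_support.
Variable R : realType.
Notation mu := (@lebesgue_measure R).
Implicit Types (f g phi : R -> R) (K : R).

(** Compact support with an explicit radius, because radii add up under translation; the strict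
    inequality makes the region of vanishing open. *)
Definition supported_in K f := forall y, K < `|y| -> f y = 0.

(** Compactness gives one modulus on the segment of radius [K + 1], the candidate moduli being the
    parameters of the near-covering property along [0^'+]. The margin [1] settles the remaining
    points: if [x] lies outside and [|x - y| < 1], both values vanish. *)
Lemma uniform_continuity_supported f K : continuous f -> supported_in K f ->
  forall e : R, 0 < e ->
  exists2 d, 0 < d & forall x y, `|x - y| < d -> `|f x - f y| < e.
Proof.
move=> cf f0 e e0.
have /compact_near_coveringP cK := @segment_compact R (- (K + 1)) (K + 1).
have := cK R (0^'+) (fun d x => forall y, `|x - y| < d -> `|f x - f y| < e) _.
case.
  move=> x _; have /cvgrPdist_lt /(_ (e / 2)) := cf x.
  rewrite divr_gt0// => /(_ isT) /nbhs_ballP[d /= d0 dP].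
  exists (ball x (d / 2), [set d' | d' < d / 2]) => /=.
    split; first by apply: nbhsx_ballx; rewrite divr_gt0.
    by apply: nbhs_right_lt; rewrite divr_gt0.
  move=> [x' d'] /= [xx' d'd] y x'y.
  have h1 : `|f x - f x'| < e / 2.
    by apply: dP; apply: le_ball xx'; lra.
  have h2 : `|f x - f y| < e / 2.
    apply: dP; rewrite /ball /= [d]splitr (le_lt_trans (ler_distD x' _ _))// ltrD//.
    exact: lt_trans d'd.
  by rewrite [e]splitr (le_lt_trans (ler_distD (f x) _ _))// ltrD// distrC.
move=> d /= d0 dP.
have /dP hd : ball 0 d (d / 2) by rewrite /ball /= sub0r normrN gtr0_norm; lra.
have {}hd := hd (divr_gt0 d0 (ltr0n _ 2)).
exists (Num.min (d / 2) 1) => [|x y].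
  by rewrite lt_min ltr01 divr_gt0.
rewrite lt_min => /andP[xyd xy1].
have [xK|xK] := leP `|x| (K + 1); first by apply: hd => //=; rewrite in_itv/= -ler_norml.
have Ky : K < `|y| by have := ler_distD y x 0; rewrite !subr0; lra.
by rewrite (f0 x) ?(f0 y)// ?subrr ?normr0//; lra.
Qed.

Lemma bounded_supported f K : continuous f -> supported_in K f ->
  exists M, forall x, `|f x| <= M.
Proof.
move=> cf f0.
have /compact_bounded[M [_ /(_ (M + 1))]] :
    compact (f @` `[- (K + 1), K + 1]).
  by apply: continuous_compact; [exact: continuous_subspaceT|exact: segment_compact].
rewrite ltrDl ltr01 => /(_ isT) h; exists (Num.max 0 (M + 1)) => x.
have [xK|xK] := leP `|x| (K + 1).
  by rewrite le_max h ?orbT//; exists x => //=; rewrite in_itv/= -ler_norml.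
by rewrite f0 ?normr0 ?le_max ?lexx//; lra.
Qed.

Lemma test_function_supported phi : test_function phi -> exists2 K, 0 < K & supported_in K phi.
Proof.
move=> [_ _ /compact_bounded[M [_ /(_ (Num.max 1 (M + 1)))]]].
rewrite lt_max ltrDl ltr01 orbT => /(_ isT) h; exists (Num.max 1 (M + 1)).
  by rewrite lt_max ltr01.
move=> y yM; apply/eqP; apply: contraT => y0.
have /h : closure [set y | phi y != 0] y by exact: subset_closure.
by rewrite /= leNgt yM.
Qed.

Lemma test_function_of_supported phi K : (forall y, derivable phi y 1) ->
  continuous (phi^`())%classic -> supported_in K phi -> test_function phi.
Proof.
move=> dphi cphi p0; split => //.
apply: (@subclosed_compact _ _ `[- K, K]).
- exact: closed_closure.
- exact: segment_compact.
- rewrite closureE; apply: smallest_sub; first exact: interval_closed.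
  move=> y /= y0; rewrite in_itv/= -ler_norml leNgt; apply: contra y0 => Ky.
  by rewrite p0.
Qed.

Lemma test_function_continuous phi : test_function phi -> continuous phi.
Proof. by move=> [d _ _] x; exact/differentiable_continuous/derivable1_diffP. Qed.

(** The region [K < |y|] is open, so [phi] vanishes near each of its points. *)
Lemma derive1_supported phi K : supported_in K phi -> supported_in K (phi^`())%classic.
Proof.
move=> p0 y Ky; rewrite derive1E.
rewrite (@near_eq_derive _ _ _ phi (cst 0)) ?derive_cst//.
have : (fun z => `|z|) @ y --> `|y| by apply: cvg_norm.
move=> /cvgr_gt /(_ _ Ky); apply: filterS => z /= Kz.
by rewrite p0.
Qed.

Lemma mvt phi : (forall y, derivable phi y 1) -> forall a b, exists2 c,
  Num.min a b <= c <= Num.max a b & phi b - phi a = (phi^`())%classic c * (b - a).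
Proof.
move=> d a b.
have isd (x : R) : is_derive x 1 phi ((phi^`())%classic x).
  by rewrite derive1E; apply: DeriveDef.
have cont : continuous phi.
  by move=> x; exact/differentiable_continuous/derivable1_diffP.
have [ab|ba] := leP a b.
  have [c] := @MVT_segment R phi (phi^`())%classic a b ab (fun x _ => isd x)
    (continuous_subspaceT cont).
  by rewrite in_itv/= => cab ->; exists c.
have [c] := @MVT_segment R phi (phi^`())%classic b a (ltW ba) (fun x _ => isd x)
    (continuous_subspaceT cont).
rewrite in_itv/= => cab e; exists c => //.
by rewrite -[phi b - _]opprB e; ring.
Qed.

End bounded_support.

(** * Density of [C^1] functions of bounded support in L2 *)

Section density.
Variable R : realType.
Notation mu := (@lebesgue_measure R).
Implicit Types (f g phi : R -> R) (K : R).

Lemma continuous_measurable f : continuous f -> measurable_fun setT f.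
Proof. exact: continuous_measurable_fun. Qed.

Lemma supported_sqint f K : 0 <= K -> continuous f -> supported_in K f -> sqint f.
Proof.
move=> K0 cf sf; have [M fM] := bounded_supported cf sf.
have [] := @bounded_support_nrm R f (- K) K M _ (continuous_measurable cf) fM _ => //.
  by lra.
move=> x; rewrite /= in_itv/= -ler_norml => /negP; rewrite -ltNge; exact: sf.
Qed.

Lemma uniform_nrm f K e : 0 <= K -> measurable_fun setT f -> (forall x, `|f x| <= e) ->
  supported_in K f -> sqint f /\ nrm f <= e * Num.sqrt (2 * K).
Proof.
move=> K0 mf fe sf; rewrite (_ : 2 * K = K - - K); last by lra.
apply: bounded_support_nrm => //; first by lra.
by move=> x; rewrite /= in_itv/= -ler_norml => /negP; rewrite -ltNge; exact: sf.
Qed.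

(* The approximation is the Steklov average [y |-> (1/h) \int_y^(y+h) f]. *)
Lemma steklov_approximation f K : 0 < K -> continuous f -> supported_in K f ->
  forall e : R, 0 < e -> exists2 phi, test_function phi & nrm (f \- phi) < e.
Proof.
move=> K0 cf sf e e0.
(* [f \- phi] will be supported in radius [K + 1], so a uniform error [e / (2 * s)] is an L2 error
   of at most [e / 2]. *)
pose s := Num.sqrt (2 * (K + 1)).
have s0 : 0 < s by rewrite sqrtr_gt0; lra.
have [d d0 fd] := uniform_continuity_supported cf sf (divr_gt0 e0 (mulr_gt0 (ltr0n R 2) s0)).
pose h := Num.min (d / 2) 1.
have h0 : 0 < h by rewrite lt_min ltr01 divr_gt0.
have hd : h < d by rewrite gt_min; apply/orP; left; lra.
have h1 : h <= 1 by rewrite ge_min lexx orbT.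
pose G x := \int[mu]_(t in `]-oo, x]) f t.
have fint : mu.-integrable setT (EFin \o f).
  have : mu.-integrable `[- K, K] (EFin \o f).
    apply: continuous_compact_integrable; first exact: segment_compact.
    exact: continuous_subspaceT.
  move/integrable_mkcond => /(_ (measurable_itv _)); apply: eq_integrable => // x _.
  rewrite patchE; case: ifPn => //; rewrite notin_setE /= in_itv/= -ler_norml => /negP.
  by rewrite -ltNge => /sf ->.
have dG (x : R) : derivable G x 1 /\ (G^`())%classic x = f x.
  apply: (@continuous_FTC1 _ f -oo%O x (x + 1)) => //; first by rewrite ltrDl.
  by apply: integrableS fint.
  by rewrite ltNyr.
  exact: cf.
pose phi y := h^-1 * (G (y + h) - G y).
have dphi (y : R) : is_derive y 1 phi (h^-1 * (f (y + h) - f y)).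
  have dGy (z : R) : is_derive z 1 G (f z).
    have [dz <-] := dG z; rewrite derive1E; exact: DeriveDef.
  have dGh : is_derive y 1 (fun y => G (y + h)) (f (y + h)).
    have := @is_derive1_comp R G (fun y => y + h) y (f (y + h)) 1.
    rewrite mulr1; apply.
    by rewrite -[X in is_derive _ _ _ X]addr0; apply: is_deriveD.
  exact: is_deriveZ (is_deriveB _ _).
have derphi (y : R) : derivable phi y 1 by case: (dphi y).
have derphiE (y : R) : (phi^`())%classic y = h^-1 * (f (y + h) - f y).
  by rewrite derive1E; case: (dphi y).
(* The average is a value [f c] with [c] between [y] and [y + h]: [h < d] gives the uniform error,
   [h <= 1] the radius of the support. *)
have near_f y : `|f y - phi y| <= e / (2 * s) /\ (K + 1 < `|y| -> phi y = 0).
  have [c] := mvt (fun x => (dG x).1) y (y + h).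
  rewrite (dG c).2 minEle maxEle lerDl (ltW h0) => /andP[yc cyh] Gc.
  have -> : phi y = f c.
    rewrite /phi Gc [y + h]addrC addrK; field; exact: lt0r_neq0.
  split.
    by apply/ltW/fd; rewrite distrC ger0_norm; lra.
  move=> Ky; apply: sf.
  have := ler_distD c y 0; rewrite !subr0 (distrC y) (ger0_norm (x := c - y)); lra.
have sphi : supported_in (K + 1) phi by move=> y; exact: (near_f y).2.
exists phi.
  apply: (test_function_of_supported derphi _ sphi).
  rewrite (funext derphiE) => y; apply: cvgM; first exact: cvg_cst.
  apply: cvgB; last exact: cf.
  apply: continuous_comp; last exact: cf.
  by apply: cvgD; [exact: cvg_id|exact: cvg_cst].
have [] := @uniform_nrm (f \- phi) (K + 1) (e / (2 * s)).
- lra.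
- apply: measurable_funB; first exact: continuous_measurable.
  apply: continuous_measurable => y; apply/differentiable_continuous/derivable1_diffP.
  exact: derphi.
- by move=> y; exact: (near_f y).1.
- move=> y Ky /=; rewrite sphi// sf ?subrr//; lra.
move=> _ /le_lt_trans; apply; rewrite -/s.
have se : e / (2 * s) * s = e / 2.
  by move: (lt0r_neq0 s0); clearbody s => sn; field.
rewrite se.
lra.
Qed.

(** Clamping does not increase distances, in whatever order [a] and [b] are. *)
Lemma continuous_clamp (a b : R) f : continuous f ->
  continuous (fun x => Num.max a (Num.min b (f x))).
Proof.
move=> cf x; apply/cvgrPdist_lt => e e0.
have /cvgrPdist_lt /(_ e e0) := cf x; apply: filterS => y; apply: le_lt_trans.
have [] := leP b (f x); have [] := leP b (f y); have [] := leP a b;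
  have [] := leP a (f x); have [] := leP a (f y) => *;
  rewrite ?subrr ?normr0//; do 2 (case: ler0P => ?); lra.
Qed.

(** The approximant [g_ N] is close to [f] in L1 only. Clamping it to [[-n, n]] and cutting it off
    outside the support of [f] moves it pointwise no farther from [f], and makes the error at most
    [2 * n]; the squared L2 error is then at most [2 * n] times the L1 error, whence the tolerance
    [e ^+ 2 / (2 * n)]. *)
Lemma continuous_approximation f (n : R) : 0 < n -> measurable_fun setT f ->
  (forall x, `|f x| <= n) -> supported_in n f ->
  forall e : R, 0 < e ->
  exists g, [/\ continuous g, supported_in (n + 1) g & nrm (f \- g) < e].
Proof.
move=> n0 mf fn sf e e0.
set E := `[- (n + 1), n + 1]%classic.
have mE : measurable (E : set (measurableTypeR R)) by exact: measurable_itv.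
have muE : (mu E < +oo)%E.
  by rewrite /E lebesgue_measure_itv/=; case: ifP => // _; rewrite ltry.
have fint : mu.-integrable E (EFin \o f).
  apply: measurable_bounded_integrable => //; first exact: measurable_funS mf.
  exists n; split; first exact: num_real.
  by move=> y ny x _; exact: le_trans (fn x) (ltW ny).
have [g_ [cg ig /fine_cvgP[_ /cvgrPdist_lt fg0]]] :=
  approximation_continuous_integrable mE muE fint.
have eta0 : 0 < e ^+ 2 / (2 * n) by rewrite divr_gt0 ?exprn_gt0//; lra.
have [N _ /(_ N (leqnn N)) /=] := fg0 _ eta0.
rewrite sub0r normrN => fgN {fg0}.
pose c (x : R) := Num.max (- n) (Num.min n (g_ N x)).
pose chi (x : R) := Num.max 0 (Num.min 1 (n + 1 - `|x|)).
have cc : continuous c.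
  exact: continuous_clamp.
have cchi : continuous chi.
  apply: continuous_clamp => x.
  by apply: cvgB; [exact: cvg_cst|apply: cvg_norm; exact: cvg_id].
have cchic : continuous (fun x => chi x * c x) by move=> x; apply: cvgM; [exact: cchi|exact: cc].
have chi_out x : n + 1 < `|x| -> chi x = 0.
  move=> xn; apply/eqP; rewrite /chi eq_le le_max lexx ge_max lexx/= andbT ge_min.
  by apply/orP; right; lra.
exists (fun x => chi x * c x); split => //.
  by move=> x /chi_out ->; rewrite mul0r.
have dint : mu.-integrable E (EFin \o (fun z => `|f z - g_ N z|)).
  have := integrable_norm (integrableB mE fint (ig N) :
    mu.-integrable E (EFin \o (fun z => f z - g_ N z))).
  by apply: eq_integrable.
have cn x : `|c x| <= n.
  by rewrite ler_norml /c le_max lexx/= ge_max ge_min lexx /= andbT; lra.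
have chi01 x : 0 <= chi x <= 1.
  by rewrite /chi le_max lexx/= ge_max ler01 ge_min lexx.
have chi1 x : `|chi x| <= 1 by have /andP[h1 h2] := chi01 x; rewrite ger0_norm.
have bound x : (f x - chi x * c x) ^+ 2 <= ((fun z => 2 * n * `|f z - g_ N z|) \_ E) x.
  rewrite patchE; case: ifPn => [_|]; last first.
    rewrite notin_setE /E /= in_itv/= -ler_norml => /negP; rewrite -ltNge => xn.
    by rewrite chi_out// sf ?mul0r ?subrr ?expr0n//; lra.
  have le2n : `|f x - chi x * c x| <= 2 * n.
    have cch : `|chi x * c x| <= n by rewrite normrM (le_trans _ (cn x))// ler_piMl.
    by have := ler_normB (f x) (chi x * c x); have := fn x; lra.
  have lefg : `|f x - chi x * c x| <= `|f x - g_ N x|.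
    have [xn|xn] := leP `|x| n.
      have -> : chi x = 1 by rewrite /chi min_l ?max_r//; lra.
      rewrite mul1r /c; have := fn x; rewrite ler_norml => /andP[? ?].
      case: (leP n (g_ N x)) => h; last case: (leP (- n) (g_ N x)) => h'.
      - rewrite max_r; last by lra.
        by rewrite distrC (distrC (f x)) !ger0_norm; lra.
      - by [].
      - by rewrite !ger0_norm; lra.
    rewrite (sf _ xn) !sub0r !normrN normrM.
    have ch : `|c x| <= `|g_ N x|.
      rewrite /c; case: (leP n (g_ N x)) => h; last case: (leP (- n) (g_ N x)) => h'.
      - rewrite max_r; last by lra.
        by rewrite !ger0_norm; lra.
      - by [].
      - by rewrite !ler0_norm; lra.
    by rewrite (le_trans _ ch)// ler_piMl.
  by rewrite -real_normK ?num_real// expr2 ler_pM.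
have sqd : sqint (f \- (fun x => chi x * c x)).
  apply: sqintB; first by have [] := @uniform_nrm f n n (ltW n0) mf fn sf.
  apply: (@supported_sqint _ (n + 1)) => //; first by lra.
  by move=> x /chi_out ->; rewrite mul0r.
rewrite -(@ltr_pXn2r _ 2)// ?nnegrE ?nrm_ge0 ?(ltW e0)// nrm_sqr.
have i2 : mu.-integrable setT (EFin \o ((fun z => 2 * n * `|f z - g_ N z|) \_ E)).
  have i1 : mu.-integrable E (EFin \o (fun z => 2 * n * `|f z - g_ N z|)).
    by apply: eq_integrable (integrableZl mE (2 * n) dint).
  by have := (integrable_mkcond _ mE).1 i1; rewrite restrict_EFin.
apply: (@le_lt_trans _ _ (\int[mu]_x ((fun z => 2 * n * `|f z - g_ N z|) \_ E) x)).
  apply: (le_Rintegral measurableT (sqint_integrableM sqd sqd) i2).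
  by move=> x _; have := bound x; rewrite expr2.
rewrite -Rintegral_mkcond RintegralZl// -ltr_pdivlMl ?mulr_gt0// mulrC.
apply: le_lt_trans fgN; exact: ler_norm.
Qed.

(** Truncation in value and in space at once: the squared remainder is dominated by [f ^+ 2] and is
    eventually zero at each point. *)
Lemma bounded_approximation f : sqint f -> forall e : R, 0 < e ->
  exists2 n : R, 0 < n & exists g, [/\ measurable_fun setT g, forall x, `|g x| <= n,
    supported_in n g & nrm (f \- g) < e].
Proof.
move=> [mf f2] e e0.
pose A (n : nat) := (fun x => `|f x|) @^-1` `]-oo, n.+1%:R] `&` `[- n.+1%:R, n.+1%:R]%classic.
have mA n : measurable (A n).
  apply: measurableI; last exact: measurable_itv.
  rewrite -[X in measurable X]setTI; apply: (measurableT_comp _ mf) => //.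
have mfA n : measurable_fun setT (f \_ (A n)).
  by apply/(measurable_restrictT _ (mA n)); exact: measurable_funS mf.
have large (a : R) : \forall n \near \oo, a <= n.+1%:R.
  by apply: filterS (nbhs_infty_ger a) => m /le_trans; apply; rewrite ler_nat.
have lef n x : `|(f x - (f \_ (A n)) x) ^+ 2| <= f x ^+ 2.
  rewrite patchE; case: ifPn => _; last by rewrite subr0 ger0_norm ?sqr_ge0.
  by rewrite subrr expr0n normr0 sqr_ge0.
have [|||||_ _] := @dominated_convergence _ _ R mu setT measurableT
  (fun n => EFin \o (fun x => (f x - (f \_ (A n)) x) ^+ 2)) (cst 0%E)
  (EFin \o (fun x => f x ^+ 2)).
- move=> n; apply/measurable_EFinP/measurable_funX.
  by apply: measurable_funB; [exact: mf|exact: mfA].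
- exact: measurable_cst.
- apply: aeW => x _; apply: cvg_near_cst; near=> n.
  rewrite /= patchE ifT ?subrr ?expr0n// inE /A /=; split.
    by rewrite in_itv/=; near: n; exact: large.
  by rewrite in_itv/= -ler_norml; near: n; exact: large.
- exact: f2.
- by apply: aeW => x n _; rewrite /= lee_fin.
rewrite integral0 => /fine_cvgP[_ /cvgrPdist_lt /(_ (e ^+ 2))].
rewrite exprn_gt0// => /(_ isT) [N _ /(_ N (leqnn N))] /=.
rewrite sub0r normrN => /(le_lt_trans (ler_norm _)) h.
exists N.+1%:R; first by rewrite ltr0n.
exists (f \_ (A N)); split => //.
- by move=> x; rewrite patchE; case: ifPn; rewrite ?normr0// inE => -[/=]; rewrite in_itv.
- move=> x xN; rewrite patchE; case: ifPn => //; rewrite inE => -[_ /=].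
  by rewrite in_itv/= -ler_norml leNgt xN.
rewrite -(@ltr_pXn2r _ 2)// ?nnegrE ?nrm_ge0 ?(ltW e0)// nrm_sqr.
by apply: le_lt_trans h; rewrite /ip /Rintegral; under eq_integral do rewrite -expr2.
Unshelve. all: by end_near. Qed.

Lemma test_function_dense f : sqint f -> forall e : R, 0 < e ->
  exists2 phi, test_function phi & nrm (f \- phi) < e.
Proof.
move=> sf e e0; have e3 : 0 < e / 3 by lra.
have [n n0 [g [mg gn sg fg]]] := bounded_approximation sf e3.
have [h [ch sh gh]] := continuous_approximation n0 mg gn sg e3.
have n1 : 0 < n + 1 by lra.
have [phi tphi hphi] := steklov_approximation n1 ch sh e3.
exists phi => //.
have sqg : sqint g by have [] := @uniform_nrm g n n (ltW n0) mg gn sg.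
have sqh : sqint h by exact: supported_sqint (ltW n1) ch sh.
have sqphi : sqint phi.
  have [K K0 sphi] := test_function_supported tphi.
  exact: supported_sqint (ltW K0) (test_function_continuous tphi) sphi.
have := nrm_triangle sf sqg sqphi; have := nrm_triangle sqg sqh sqphi.
lra.
Qed.

End density.

(** * Increments of integral functions *)

Section time_integrals.
Variable R : realType.
Notation mu := (@lebesgue_measure R).
Implicit Types (D M h m : R -> R) (T s t a e : R).

(* A mean value principle for functions that need not be differentiable: the
   local modulus is compared with the variation of a monotone function. *)
Lemma eq_of_small_increments D M T : 0 <= T ->
  (forall s t, 0 <= s -> s <= t -> t <= T -> M s <= M t) ->
  (forall t, 0 <= t <= T -> forall e, 0 < e -> exists2 d, 0 < d &
    forall s, 0 <= s <= T -> `|s - t| < d -> `|D s - D t| <= e * `|M s - M t|) ->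
  D T = D 0.
Proof.
move=> T0 Mnd H.
(* Continuous induction: [S] contains [0], contains its supremum [c], and would contain a point
   beyond [c] if [c < T]. *)
have key e : 0 < e -> `|D T - D 0| <= e * (M T - M 0).
  move=> e0.
  pose S := [set t | 0 <= t <= T /\ `|D t - D 0| <= e * (M t - M 0)].
  have S0 : S 0 by split; rewrite ?lexx ?T0// !subrr normr0 mulr0.
  have ubS : ubound S T by move=> t [/andP[]].
  have supS : has_sup S by split; [exists 0|exists T].
  pose c := sup S.
  have c0 : 0 <= c by apply: ub_le_sup => //; exists T.
  have cT : c <= T by apply: ge_sup => //; exists 0.
  have ic : 0 <= c <= T by rewrite c0.
  have [d d0 dP] := H c ic e e0.
  have Sc : S c.
    have [t [it tD] ct] := sup_adherent d0 supS.
    have tc : t <= c by apply: ub_le_sup => //; exists T.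
    split => //.
    have /andP[t0 tT] := it.
    have := dP t it; rewrite ler0_norm ?subr_le0// ltrNl -/c => /(_ _).
    have -> : - d < t - c by move: ct; rewrite -/c; lra.
    have Mtc := Mnd t c t0 tc cT.
    move=> /(_ isT); rewrite (ler0_norm (x := M t - M c)) ?subr_le0// distrC.
    have := ler_distD (D t) (D c) (D 0); lra.
  have [cT'|] := ltP c T; last first.
    by move=> Tc; have -> : T = c by [apply/eqP; rewrite eq_le Tc cT]; case: Sc.
  pose s := Num.min (c + d / 2) T.
  have cs : c < s by rewrite lt_min cT' andbT; lra.
  have sT : s <= T by rewrite ge_min lexx orbT.
  have sd : s <= c + d / 2 by rewrite ge_min lexx.
  have sI : 0 <= s <= T by rewrite sT andbT; lra.
  suff Ss : S s.
    have : s <= c by apply: ub_le_sup => //; exists T.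
    by rewrite leNgt cs.
  split => //.
  have := dP s sI; rewrite gtr0_norm ?subr_gt0// => /(_ _).
  have -> : s - c < d by lra.
  have Mcs := Mnd c s c0 (ltW cs) sT.
  move=> /(_ isT); rewrite (ger0_norm (x := M s - M c)) ?subr_ge0//.
  have := ler_distD (D c) (D s) (D 0); case: Sc => _; lra.
apply/eqP; rewrite -subr_eq0 -normr_le0; apply/ler_addgt0Pl => e e0; rewrite addr0.
have M0T : M 0 <= M T by exact: Mnd.
have p1 : 0 < M T - M 0 + 1 by lra.
apply: (le_trans (key _ (divr_gt0 e0 p1))).
by rewrite mulrAC ler_pdivrMr// ler_pM2l//; lra.
Qed.

Definition int0 h t : R := \int[mu]_(s in `[0, t]) h s.

Lemma int00 h : int0 h 0 = 0.
Proof. by rewrite /int0 set_itv1 Rintegral_set1. Qed.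

Lemma int0_diff h T s t : mu.-integrable `[0, T] (EFin \o h) ->
  0 <= s -> s <= t -> t <= T -> int0 h t - int0 h s = \int[mu]_(x in `[s, t]) h x.
Proof.
move=> hint s0 st tT; rewrite /int0 Rintegral_itvB//=.
- rewrite Rintegral_itv_obnd_cbnd//.
  apply: integrableS hint => //; apply: subset_itv; rewrite bnd_simp//.
- by apply: integrableS hint => //; apply: subset_itvl; rewrite bnd_simp.
Qed.

(** A first-order expansion for integrands that need not be bounded: the deviation from [a] is
    measured by a weight [m], and the error by the integral of [m]. *)
Lemma int0_estimate h m T s t a e :
  0 <= e -> mu.-integrable `[0, T] (EFin \o h) -> mu.-integrable `[0, T] (EFin \o m) ->
  0 <= s <= T -> 0 <= t <= T ->
  (forall x, Num.min s t <= x <= Num.max s t -> `|h x - a| <= e * m x) ->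
  `|int0 h s - int0 h t - a * (s - t)| <= e * `|int0 m s - int0 m t|.
Proof.
move=> e0 hint mint; wlog st : s t / s <= t.
  move=> W si ti H; have [st|ts] := leP s t; first exact: W.
  rewrite -normrN (distrC (int0 m s)).
  have -> : - (int0 h s - int0 h t - a * (s - t)) = int0 h t - int0 h s - a * (t - s) by ring.
  by apply: W; rewrite ?(ltW ts)// minC maxC.
move=> /andP[s0 sT] /andP[t0 tT]; rewrite min_l// max_r// => H.
rewrite -normrN (distrC (int0 m s)).
have -> : - (int0 h s - int0 h t - a * (s - t)) = int0 h t - int0 h s - a * (t - s) by ring.
rewrite (int0_diff hint s0 st tT) (int0_diff mint s0 st tT).
have sub : `[s, t]%classic `<=` `[0, T] by apply: subset_itv; rewrite bnd_simp.
have mI : measurable (`[s, t]%classic : set (measurableTypeR R)) by exact: measurable_itv.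
have hI : mu.-integrable `[s, t] (EFin \o h) by apply: integrableS hint.
have mIn : mu.-integrable `[s, t] (EFin \o m) by apply: integrableS mint.
have aI : mu.-integrable `[s, t] (EFin \o (fun=> a)).
  apply: continuous_compact_integrable; first exact: segment_compact.
  by apply: continuous_subspaceT => x; exact: cvg_cst.
have -> : a * (t - s) = \int[mu]_(x in `[s, t]) a.
  rewrite Rintegral_cst//= lebesgue_measure_itv/= lte_fin.
  by case: ltgtP st => // ->; rewrite subrr !mulr0.
rewrite -RintegralB//.
have haI := integrableB mI hI aI.
apply: (le_trans (le_normr_Rintegral mI haI)).
apply: (@le_trans _ _ (e * \int[mu]_(x in `[s, t]) m x)).
  rewrite -RintegralZl//; apply: (le_Rintegral mI).
  - exact: (integrable_norm haI).
  - exact: (integrableZl mI e mIn).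
  - by move=> x /=; rewrite in_itv/= => /H.
by rewrite ler_wpM2l// ler_norm.
Qed.

End time_integrals.

(** * Continuous curves in L2 *)

Section curves.
Variable R : realType.
Notation mu := (@lebesgue_measure R).
Implicit Types (T s t e c z : R) (phi f : R -> R) (u v w r : R -> R -> R).

Definition sqint_curve T u := forall t, 0 <= t <= T -> sqint (u t).

Definition continuous_curve T u := forall t, 0 <= t <= T -> forall e, 0 < e ->
  exists2 d, 0 < d &
    forall s, 0 <= s <= T -> `|s - t| < d -> nrm (u s \- u t) < e.

(** Two time variables, because the solution will be taken at an intermediate time while the test
    function stays at the end point of the time interval. *)
Lemma ip_curve_continuous T u v :
  sqint_curve T u -> sqint_curve T v ->
  continuous_curve T u -> continuous_curve T v ->
  forall t, 0 <= t <= T -> forall e, 0 < e -> exists2 d, 0 < d &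
    forall s s', 0 <= s <= T -> 0 <= s' <= T -> `|s - t| < d -> `|s' - t| < d ->
      `|ip (u s) (v s') - ip (u t) (v t)| < e.
Proof.
move=> su sv cu cv t tI e e0.
pose a := nrm (u t) + 1; pose b := nrm (v t) + 1.
have a0 : 0 < a by have := nrm_ge0 (u t); rewrite /a; lra.
have b0 : 0 < b by have := nrm_ge0 (v t); rewrite /b; lra.
have e2 : 0 < e / 2 by lra.
have [d1 d10 H1] := cu t tI _ (divr_gt0 e2 b0).
(* The [1] bounds [nrm (v s')] by [b]; the other entry makes the second term of the splitting
   small. *)
have m0 : 0 < Num.min 1 (e / 2 / a) by rewrite lt_min ltr01 divr_gt0.
have [d2 d20 H2] := cv t tI _ m0.
exists (Num.min d1 d2); first by rewrite lt_min d10.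
move=> s s' sI s'I; rewrite !lt_min => /andP[sd1 _] /andP[_ sd2].
have {}H1 := H1 s sI sd1; have := H2 s' s'I sd2; rewrite lt_min => /andP[H21 H22].
have sus := su s sI; have sut := su t tI; have svs := sv s' s'I; have svt := sv t tI.
have sud := sqintB sus sut; have svd := sqintB svs svt.
have -> : ip (u s) (v s') - ip (u t) (v t) =
    ip (u s \- u t) (v s') + ip (u t) (v s' \- v t).
  by rewrite ipBl// ipBr//; ring.
have vb : nrm (v s') <= b.
  have := nrmD svt svd; rewrite (_ : v t \+ _ = v s') /b; first by lra.
  by apply/funext => x /=; ring.
have c1 := cauchy_schwarz sud svs; have c2 := cauchy_schwarz sut svd.
have k1 : nrm (u s \- u t) * nrm (v s') < e / 2.
  apply: (le_lt_trans (y := nrm (u s \- u t) * b)).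
    by rewrite ler_wpM2l// nrm_ge0.
  by rewrite -ltr_pdivlMr.
have k2 : nrm (u t) * nrm (v s' \- v t) <= e / 2.
  apply: (le_trans (y := a * nrm (v s' \- v t))).
    by rewrite ler_wpM2r ?nrm_ge0// /a; lra.
  by rewrite mulrC -ler_pdivlMr// ltW.
have := ler_normD (ip (u s \- u t) (v s')) (ip (u t) (v s' \- v t)).
lra.
Qed.

Lemma ip_curve_within_continuous T u v :
  sqint_curve T u -> sqint_curve T v ->
  continuous_curve T u -> continuous_curve T v ->
  {within `[0, T], continuous (fun t => ip (u t) (v t))}.
Proof.
move=> su sv cu cv.
apply/subspace_continuousP => t; rewrite /= in_itv/= => tI.
apply/cvgrPdist_lt => e e0.
have [d d0 dP] := ip_curve_continuous su sv cu cv tI e0.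
apply/nbhs_ballP; exists d => //= s; rewrite /ball /= distrC => st; rewrite in_itv/= => sI.
by rewrite distrC; exact: dP.
Qed.

Lemma ip_curve_integrable T u v :
  sqint_curve T u -> sqint_curve T v ->
  continuous_curve T u -> continuous_curve T v ->
  mu.-integrable `[0, T] (EFin \o (fun t => ip (u t) (v t))).
Proof.
move=> su sv cu cv; apply: continuous_compact_integrable; first exact: segment_compact.
exact: ip_curve_within_continuous.
Qed.

Lemma curve_bounded T u : sqint_curve T u -> continuous_curve T u ->
  exists2 C, 0 <= C & forall t, 0 <= t <= T -> nrm (u t) <= C.
Proof.
move=> su cu.
have /compact_bounded[M [_ /(_ (Num.max 1 (M + 1)))]] :
    compact ((fun t => ip (u t) (u t)) @` `[0, T]).
  apply: continuous_compact; last exact: segment_compact.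
  exact: ip_curve_within_continuous.
rewrite lt_max ltrDl ltr01 orbT => /(_ isT) h.
(* A number at least [1] that bounds the squared norm also bounds the norm. *)
exists (Num.max 1 (M + 1)); first by rewrite le_max ler01.
move=> t tI; have ut : `|ip (u t) (u t)| <= Num.max 1 (M + 1).
  by apply: h; exists t => //=; rewrite in_itv.
have m1 : 1 <= Num.max 1 (M + 1) by rewrite le_max lexx.
rewrite -(@ler_pXn2r _ 2)// ?nnegrE ?nrm_ge0 ?(le_trans ler01)// nrm_sqr.
rewrite (le_trans (ler_norm _))// (le_trans ut)// expr2.
by rewrite ler_peMl// (le_trans ler01).
Qed.

Definition translate z f : R -> R := fun y => f (y - z).

Lemma translate_supported (K z : R) f : supported_in K f ->
  supported_in (K + `|z|) (translate z f).
Proof.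
move=> sf y Ky; apply: sf; have := ler_distD z y 0; rewrite !subr0; lra.
Qed.

Lemma translate_continuous z f : continuous f -> continuous (translate z f).
Proof.
move=> cf y; apply: continuous_comp; last exact: cf.
by apply: cvgB; [exact: cvg_id|exact: cvg_cst].
Qed.

Lemma sqint_translate_curve (K T c : R) f : 0 <= K -> continuous f -> supported_in K f ->
  sqint_curve T (fun t => translate (c * t) f).
Proof.
move=> K0 cf sf t _; apply: (@supported_sqint _ _ (K + `|c * t|)).
- by rewrite addr_ge0.
- exact: translate_continuous.
- exact: translate_supported.
Qed.

(** All translates up to time [T] vanish outside the common radius [L], so uniform continuity
    becomes continuity in L2. *)
Lemma continuous_translate_curve (K T c : R) f : 0 <= K -> continuous f -> supported_in K f ->
  continuous_curve T (fun t => translate (c * t) f).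
Proof.
move=> K0 cf sf t tI e e0.
have T0 : 0 <= T by have /andP[] := tI; exact: le_trans.
pose L := K + `|c| * T.
have L0 : 0 <= L by rewrite addr_ge0// mulr_ge0.
pose q := Num.sqrt (2 * L) + 1.
have q0 : 0 < q by rewrite ltr_wpDl// sqrtr_ge0.
have [d d0 fd] := uniform_continuity_supported cf sf (divr_gt0 e0 q0).
have c1 : 0 < `|c| + 1 by rewrite ltr_wpDl.
exists (d / (`|c| + 1)); first by rewrite divr_gt0.
move=> s sI; rewrite ltr_pdivlMr// => st.
have bound x : 0 <= x <= T -> `|c * x| <= `|c| * T.
  by move=> /andP[x0 xT]; rewrite normrM (ger0_norm x0) ler_wpM2l.
have [] := @uniform_nrm R (translate (c * s) f \- translate (c * t) f) L (e / q) L0.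
- by apply: measurable_funB; apply: continuous_measurable; exact: translate_continuous.
- move=> y /=; apply/ltW/fd.
  rewrite (_ : y - c * s - (y - c * t) = - (c * (s - t))); last by ring.
  rewrite normrN normrM; apply: le_lt_trans st.
  by rewrite mulrC ler_wpM2l// lerDl.
- move=> y Ly /=; rewrite !(translate_supported sf) ?subrr//.
    by rewrite (le_lt_trans _ Ly)// lerD2l bound.
  by rewrite (le_lt_trans _ Ly)// lerD2l bound.
move=> _ /le_lt_trans; apply.
rewrite mulrAC ltr_pdivrMr// ltr_pM2l// /q; lra.
Qed.

(** The L2 derivative of [s |-> translate (c * s) phi] at [t] is [- c] times the translate of
    [phi']. The mean value theorem reduces the remainder to a difference of two values of [phi'],
    small by uniform continuity. *)
Lemma translate_curve_derivative (T c : R) phi : test_function phi ->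
  forall t, 0 <= t <= T -> forall e, 0 < e -> exists2 d, 0 < d &
    forall s, 0 <= s <= T -> `|s - t| < d ->
      nrm (translate (c * s) phi \-
           (translate (c * t) phi \-
            (fun y => c * (s - t) * translate (c * t) (phi^`())%classic y))) <= e * `|s - t|.
Proof.
move=> tphi t tI e e0.
have T0 : 0 <= T by have /andP[] := tI; exact: le_trans.
have [K K0 sphi] := test_function_supported tphi.
have [dphi cphi' _] := tphi.
have cphi := test_function_continuous tphi.
have sphi' := derive1_supported sphi.
pose L := K + `|c| * T.
have L0 : 0 <= L by rewrite addr_ge0 ?mulr_ge0// ltW.
pose q := Num.sqrt (2 * L) + 1.
have q0 : 0 < q by rewrite ltr_wpDl// sqrtr_ge0.
have c1 : 0 < `|c| + 1 by rewrite ltr_wpDl.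
have e1 : 0 < e / q / (`|c| + 1) by rewrite !divr_gt0.
have [d d0 fd] := uniform_continuity_supported cphi' sphi' e1.
exists (d / (`|c| + 1)); first by rewrite divr_gt0.
move=> s sI; rewrite ltr_pdivlMr// => st.
have bound x : 0 <= x <= T -> `|c * x| <= `|c| * T.
  by move=> /andP[x0 xT]; rewrite normrM (ger0_norm x0) ler_wpM2l.
have [] := @uniform_nrm R (translate (c * s) phi \-
           (translate (c * t) phi \-
            (fun y => c * (s - t) * translate (c * t) (phi^`())%classic y)))
  L (e / q * `|s - t|) L0.
- apply: measurable_funB; first by apply: continuous_measurable; exact: translate_continuous.
  apply: measurable_funB; first by apply: continuous_measurable; exact: translate_continuous.
  by apply: measurable_funM => //; apply: continuous_measurable; exact: translate_continuous.
- move=> y /=; rewrite /translate.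
  have [x xI phiE] := mvt dphi (y - c * t) (y - c * s).
  have -> : phi (y - c * s) - (phi (y - c * t) - c * (s - t) * (phi^`())%classic (y - c * t))
    = (c * (s - t)) * ((phi^`())%classic (y - c * t) - (phi^`())%classic x).
    have -> : phi (y - c * s) = phi (y - c * t) + (phi^`())%classic x * (y - c * s - (y - c * t)).
      by rewrite -phiE; ring.
    by ring.
  have xy : `|y - c * t - x| <= `|c| * `|s - t|.
    rewrite -normrM; move: xI; rewrite minEle maxEle.
    have -> : c * (s - t) = (y - c * t) - (y - c * s) by ring.
    case: ifPn => yy /andP[h1 h2].
      by rewrite !ler0_norm ?subr_le0// lerN2 lerD2l lerN2.
    by rewrite !ger0_norm ?subr_ge0 ?(le_trans h1)// lerD2l lerN2.
  have /fd : `|y - c * t - x| < d.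
    by apply: (le_lt_trans xy); apply: le_lt_trans st; rewrite mulrC ler_wpM2l// lerDl.
  rewrite normrM normrM => /ltW h.
  apply: (le_trans (ler_wpM2l _ h)); first by rewrite mulr_ge0.
  have -> : `|c| * `|s - t| * (e / q / (`|c| + 1)) =
      e / q * `|s - t| * (`|c| / (`|c| + 1)) by ring.
  rewrite ler_piMr ?mulr_ge0 ?invr_ge0 ?(ltW e0) ?(ltW q0)//.
  by rewrite ler_pdivrMr// mul1r lerDl ler01.
- move=> y Ly /=; rewrite !(translate_supported sphi) ?(translate_supported sphi') ?mulr0 ?subrr//.
  + by rewrite (le_lt_trans _ Ly)// lerD2l bound.
  + by rewrite (le_lt_trans _ Ly)// lerD2l bound.
  + by rewrite (le_lt_trans _ Ly)// lerD2l bound.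
move=> _ /le_trans; apply.
rewrite mulrAC ler_wpM2r// mulrAC ler_pdivrMr// ler_pM2l// /q; lra.
Qed.

End curves.

(** * Transport equations: moving test functions *)

Section transport.
Variable R : realType.
Notation mu := (@lebesgue_measure R).
Implicit Types (T s t e c k p q : R) (phi f gi go : R -> R) (w r : R -> R -> R).

(* Weak form of [d_t w + c d_y w = r] with inflow trace [gi] at [p] and outflow
   trace [go] at [q]; [k] stands for [`|c|]. *)
Record weak_transport T c k p q w r gi go : Prop := WeakTransport {
  transport_sqint : sqint_curve T w;
  transport_continuous : continuous_curve T w;
  source_sqint : sqint_curve T r;
  source_continuous : continuous_curve T r;
  inflow_integrable : mu.-integrable `[0, T] (EFin \o gi);
  outflow_integrable : mu.-integrable `[0, T] (EFin \o go);
  transport_weak : forall phi, test_function phi -> forall t, 0 <= t <= T ->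
    ip (w t) phi - ip (w 0) phi =
    int0 (fun s => k * (gi s * phi p - go s * phi q)
                   + c * ip (w s) (phi^`())%classic + ip (r s) phi) t }.

Lemma test_function_sqint phi : test_function phi -> sqint phi /\ sqint (phi^`())%classic.
Proof.
move=> tphi; have [K K0 sphi] := test_function_supported tphi.
have [_ cphi' _] := tphi.
split; first exact: supported_sqint (ltW K0) (test_function_continuous tphi) sphi.
exact: supported_sqint (ltW K0) cphi' (derive1_supported sphi).
Qed.

Lemma derive1_translate z phi : (forall y, derivable phi y 1) ->
  (forall y, derivable (translate z phi) y 1) /\
  ((translate z phi)^`())%classic = translate z (phi^`())%classic.
Proof.
move=> dphi.
have dt (y : R) : is_derive y 1 (translate z phi) ((phi^`())%classic (y - z)).
  have dp : is_derive (y - z) 1 phi ((phi^`())%classic (y - z)).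
    by rewrite derive1E; exact: DeriveDef.
  have := @is_derive1_comp R phi (fun y => y - z) y ((phi^`())%classic (y - z)) 1.
  rewrite mulr1; apply => //.
  by rewrite -[X in is_derive _ _ _ X]subr0; apply: is_deriveB.
split; first by move=> y; case: (dt y).
by apply/funext => y; rewrite derive1E; case: (dt y).
Qed.

Lemma test_function_translate z phi : test_function phi -> test_function (translate z phi).
Proof.
move=> tphi; have [dphi cphi' _] := tphi.
have [K K0 sphi] := test_function_supported tphi.
have [dt dtE] := derive1_translate z dphi.
apply: (test_function_of_supported dt _ (translate_supported (z := z) sphi)).
by rewrite dtE; apply: translate_continuous; exact: cphi'.
Qed.

Lemma integrable_mul_continuous T g f : mu.-integrable `[0, T] (EFin \o g) ->
  continuous f -> mu.-integrable `[0, T] (EFin \o (fun s => g s * f s)).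
Proof.
move=> gI cf; have mI : measurable (`[0, T]%classic : set (measurableTypeR R)).
  exact: measurable_itv.
apply: (integrableMl mI gI).
  by apply: measurable_funTS; exact: continuous_measurable.
have := @continuous_compact _ _ f `[0, T] (continuous_subspaceT cf) (@segment_compact R 0 T).
move=> /compact_bounded [M [Mr MP]].
exists M; split => // x Mx y yI; apply: (MP x Mx); by exists y.
Qed.

(** Pure algebra: replacing the four values through which the test function enters the flux by
    nearby ones costs a multiple of [|g1| + |g2| + 1], the form of weight used with
    [int0_estimate]. *)
Lemma flux_increment_bound (k c g1 g2 x1 y1 x2 y2 x3 y3 x4 y4 e : R) :
  `|x1 - y1| <= e -> `|x2 - y2| <= e -> `|x3 - y3| <= e -> `|x4 - y4| <= e ->
  `|k * (g1 * x1 - g2 * x2) + c * x3 + x4 - (k * (g1 * y1 - g2 * y2) + y4) - c * y3| <=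
  e * (`|k| + `|c| + 2) * (`|g1| + `|g2| + 1).
Proof.
move=> h1 h2 h3 h4; have E0 : 0 <= e by exact: le_trans h1.
have -> : k * (g1 * x1 - g2 * x2) + c * x3 + x4 - (k * (g1 * y1 - g2 * y2) + y4) - c * y3
  = k * (g1 * (x1 - y1)) - k * (g2 * (x2 - y2)) + c * (x3 - y3) + (x4 - y4) by ring.
have n1 : `|k * (g1 * (x1 - y1))| <= `|k| * (`|g1| * e) by rewrite !normrM !ler_wpM2l.
have n2 : `|k * (g2 * (x2 - y2))| <= `|k| * (`|g2| * e) by rewrite !normrM !ler_wpM2l.
have n3 : `|c * (x3 - y3)| <= `|c| * e by rewrite normrM ler_wpM2l.
apply: (le_trans (ler_normD _ _)).
apply: (le_trans (lerD (le_trans (ler_normD _ _) (lerD (ler_normB _ _) (lexx _))) (lexx _))).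
apply: (le_trans (lerD (lerD (lerD n1 n2) n3) h4)).
move: (normr_ge0 k) (normr_ge0 c) (normr_ge0 g1) (normr_ge0 g2).
move: (`|k|) (`|c|) (`|g1|) (`|g2|) E0 => K' C' I' O' {h1 h2 h3 h4 n1 n2 n3} E0 k0 c0 i0 o0.
have := mulr_ge0 E0 (addr_ge0 i0 o0); have := mulr_ge0 E0 c0; have := mulr_ge0 E0 k0.
have := mulr_ge0 (mulr_ge0 E0 (addr_ge0 i0 o0)) c0.
lra.
Qed.

Lemma norm_lt_of_close (c s x t d : R) : `|x - t| <= `|s - t| ->
  `|s - t| < d / (2 * (`|c| + 1)) -> `|c * (s - x)| < d.
Proof.
have c1 : 0 < 2 * (`|c| + 1) by rewrite mulr_gt0// ltr_wpDl.
rewrite ltr_pdivlMr// normrM => xt.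
have sx : `|s - x| <= 2 * `|s - t| by have := ler_distD t s x; rewrite (distrC t x); lra.
have := normr_ge0 c; have := normr_ge0 (s - x); nra.
Qed.

(** * Test functions carried along the characteristics *)

Section moving_frame.
Variables (T c k p q : R) (w r : R -> R -> R) (gi go : R -> R).
Hypothesis H : weak_transport T c k p q w r gi go.

(** Rate of change of the pairing with a test function carried by the flow. It contains no [phi']:
    for such a test function the transport term cancels. *)
Definition moving_flux phi s :=
  k * (gi s * phi (p - c * s) - go s * phi (q - c * s))
  + ip (r s) (translate (c * s) phi).

Lemma flux_integrable f h (v : R -> R -> R) (u : R -> R -> R) : continuous f -> continuous h ->
  sqint_curve T u -> continuous_curve T u -> sqint_curve T v -> continuous_curve T v ->
  mu.-integrable `[0, T] (EFin \o (fun s =>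
     k * (gi s * f s - go s * h s) + ip (u s) (v s))).
Proof.
move=> cf ch su cu sv cv.
have mI : measurable (`[0, T]%classic : set (measurableTypeR R)) by exact: measurable_itv.
have I1 := integrable_mul_continuous (inflow_integrable H) cf.
have I2 := integrable_mul_continuous (outflow_integrable H) ch.
exact: (integrableD mI (integrableZl mI k (integrableB mI I1 I2))
  (ip_curve_integrable su sv cu cv)).
Qed.

Lemma continuous_curve_cst f : continuous_curve T (fun=> f).
Proof.
move=> t _ e e0; exists 1 => // s _ _; rewrite (_ : f \- f = fun=> 0).
  by rewrite /nrm /ip /Rintegral; under eq_integral do rewrite mul0r; rewrite integral0 sqrtr0.
by apply/funext => y /=; rewrite subrr.
Qed.

Lemma moving_flux_integrable phi : test_function phi ->
  mu.-integrable `[0, T] (EFin \o moving_flux phi).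
Proof.
move=> tphi; have cphi := test_function_continuous tphi.
have [K K0 sphi] := test_function_supported tphi.
have cline (z : R) : continuous (fun s => phi (z - c * s)).
  move=> s; apply: continuous_comp; last exact: cphi.
  by apply: cvgB; [exact: cvg_cst|apply: cvgM; [exact: cvg_cst|exact: cvg_id]].
apply: (flux_integrable (cline p) (cline q)).
- exact: source_sqint H.
- exact: source_continuous H.
- exact: sqint_translate_curve (ltW K0) cphi sphi.
- exact: continuous_translate_curve (ltW K0) cphi sphi.
Qed.

(** The function [phi (y - c * t)] solves the adjoint transport equation, which cancels the term
    [c * ip (w s) phi']. As [w] has no time derivative, an increment from [t] to [s] is split in
    two: the weak equation with the test function frozen at time [s], and the first-order expansion
    of the translate against [w t]. Both remainders are small compared with the increment of [M]. *)
Lemma moving_test_function phi : 0 <= T -> test_function phi ->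
  ip (w T) (translate (c * T) phi) - ip (w 0) phi = int0 (moving_flux phi) T.
Proof.
move=> T0 tphi; have cphi := test_function_continuous tphi.
have [dphi cphi' _] := tphi.
have [K K0 sphi] := test_function_supported tphi.
have sphi' := derive1_supported sphi.
have [sqphi sqphi'] := test_function_sqint tphi.
have tr0 : translate (c * 0) phi = phi by apply/funext => y; rewrite /translate mulr0 subr0.
pose D t := ip (w t) (translate (c * t) phi) - int0 (moving_flux phi) t.
(* The traces are only integrable, so increments are weighed by their absolute values; the summand
   [1] makes [M] grow at least as fast as time, which [Mdiff] records. *)
pose m s := `|gi s| + `|go s| + 1.
have mI : measurable (`[0, T]%classic : set (measurableTypeR R)) by exact: measurable_itv.
have oneI : mu.-integrable `[0, T] (EFin \o (fun=> 1)).
  apply: continuous_compact_integrable; first exact: segment_compact.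
  by apply: continuous_subspaceT => x; exact: cvg_cst.
have mInt : mu.-integrable `[0, T] (EFin \o m).
  exact: (integrableD mI (integrableD mI (integrable_norm (inflow_integrable H))
    (integrable_norm (outflow_integrable H))) oneI).
pose M := int0 m.
have Mdiff s t : 0 <= s <= T -> 0 <= t <= T -> `|s - t| <= `|M s - M t|.
  move=> sI tI; rewrite /M.
  wlog st : s t sI tI / s <= t.
    by move=> W; have [/W|/ltW/W] := leP s t; [|rewrite distrC (distrC (int0 m s))]; exact.
  have /andP[s0 sT] := sI; have /andP[t0 tT] := tI.
  rewrite distrC (distrC (int0 m s)) (int0_diff mInt s0 st tT) (ger0_norm (x := t - s)) ?subr_ge0//.
  apply: le_trans (ler_norm _).
  have sub : `[s, t]%classic `<=` `[0, T] by apply: subset_itv; rewrite bnd_simp.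
  have mst : measurable (`[s, t]%classic : set (measurableTypeR R)) by exact: measurable_itv.
  have -> : t - s = \int[mu]_(x in `[s, t]) 1.
    rewrite Rintegral_cst//= lebesgue_measure_itv/= lte_fin mul1r.
    by case: ltgtP st => // ->; rewrite subrr.
  apply: (le_Rintegral mst).
  - exact: integrableS oneI.
  - exact: integrableS mInt.
  - by move=> x _; rewrite /m lerDr addr_ge0.
suff : D T = D 0.
  by rewrite /D tr0 int00 subr0 => <-; ring.
apply: (@eq_of_small_increments _ D M T T0).
  move=> s t s0 st tT; rewrite -subr_ge0 /M (int0_diff mInt s0 st tT).
  by apply: Rintegral_ge0 => x _; rewrite !addr_ge0.
move=> t tI e e0.
have wsq := transport_sqint H; have wct := transport_continuous H.
have rsq := source_sqint H; have rct := source_continuous H.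
have trsq := @sqint_translate_curve R K T c _ (ltW K0) cphi sphi.
have trct := @continuous_translate_curve R K T c _ (ltW K0) cphi sphi.
have trsq' := @sqint_translate_curve R K T c _ (ltW K0) cphi' sphi'.
have trct' := @continuous_translate_curve R K T c _ (ltW K0) cphi' sphi'.
(* [|k| + |c| + 2] comes from [flux_increment_bound], [nrm (w t)] from the remainder of the
   translate. *)
pose Q := `|k| + `|c| + 2 + nrm (w t) + 1.
have Q0 : 0 < Q by rewrite /Q; have := nrm_ge0 (w t); have := normr_ge0 c; have := normr_ge0 k; lra.
pose e' := e / Q; have e'0 : 0 < e' by rewrite divr_gt0.
have [d1 d10 P1] := ip_curve_continuous wsq trsq' wct trct' tI e'0.
have [d2 d20 P2] := ip_curve_continuous rsq trsq rct trct tI (divr_gt0 e'0 (ltr0n R 2)).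
have [d3 d30 P3] := translate_curve_derivative c tphi tI e'0.
have [d4 d40 P4] := uniform_continuity_supported cphi sphi e'0.
have c1 : 0 < `|c| + 1 by rewrite ltr_wpDl.
(* The last entry keeps the points [z - c * s] and [z - c * x], at which [phi] meets the traces,
   closer than [d4]. *)
pose d := Num.min (Num.min d1 d2) (Num.min d3 (d4 / (2 * (`|c| + 1)))).
exists d; first by rewrite !lt_min d10 d20 d30 divr_gt0// mulr_gt0.
move=> s sI; rewrite !lt_min => /andP[/andP[sd1 sd2] /andP[sd3 sd4]].
have ttr := test_function_translate (c * s) tphi.
have [_ trE] := derive1_translate (c * s) dphi.
pose A x := k * (gi x * translate (c * s) phi p - go x * translate (c * s) phi q)
  + c * ip (w x) (translate (c * s) (phi^`())%classic) + ip (r x) (translate (c * s) phi).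
have AInt : mu.-integrable `[0, T] (EFin \o A).
  have I1 := ip_curve_integrable wsq (fun t tI => trsq' s sI) wct
    (@continuous_curve_cst (translate (c * s) (phi^`())%classic)).
  have I2 : mu.-integrable `[0, T] (EFin \o (fun x =>
      k * (gi x * translate (c * s) phi p - go x * translate (c * s) phi q)
      + ip (r x) (translate (c * s) phi))).
    apply: (@flux_integrable (fun=> translate (c * s) phi p) (fun=> translate (c * s) phi q)
      (fun=> translate (c * s) phi)).
    - by move=> x; exact: cvg_cst.
    - by move=> x; exact: cvg_cst.
    - exact: rsq.
    - exact: rct.
    - by move=> x _; exact: trsq.
    - exact: continuous_curve_cst.
  suff -> : A = fun x => k * (gi x * translate (c * s) phi p - go x * translate (c * s) phi q)
      + ip (r x) (translate (c * s) phi) + c * ip (w x) (translate (c * s) (phi^`())%classic).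
    exact: (integrableD mI I2 (integrableZl mI c I1)).
  by apply/funext => x; rewrite /A; ring.
have BInt := moving_flux_integrable tphi.
have wA x : 0 <= x <= T ->
    ip (w x) (translate (c * s) phi) - ip (w 0) (translate (c * s) phi) = int0 A x.
  by move=> xI; rewrite (transport_weak H ttr xI) trE.
have h0 x : 0 <= x <= T ->
    int0 (fun x => A x - moving_flux phi x) x = int0 A x - int0 (moving_flux phi) x.
  move=> /andP[x0 xT]; rewrite /int0 RintegralB//.
    by apply: integrableS AInt => //; apply: subset_itvl; rewrite bnd_simp.
  by apply: integrableS BInt => //; apply: subset_itvl; rewrite bnd_simp.
(* With a frozen test function the transport term survives and contributes [a * (s - t)]; the
   expansion of the translate contributes the opposite. *)
pose a := c * ip (w t) (translate (c * t) (phi^`())%classic).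
have DE : D s - D t = (int0 (fun x => A x - moving_flux phi x) s -
    int0 (fun x => A x - moving_flux phi x) t - a * (s - t)) +
    ip (w t) (translate (c * s) phi \- (translate (c * t) phi \-
            (fun y => c * (s - t) * translate (c * t) (phi^`())%classic y))).
  have sZ := sqintZ (c * (s - t)) (trsq' t tI).
  rewrite (h0 s sI) (h0 t tI) -(wA s sI) -(wA t tI) /D /a.
  rewrite (ipBr (trsq s sI) (sqintB (trsq t tI) sZ) (wsq t tI)) (ipBr (trsq t tI) sZ (wsq t tI)).
  by rewrite (ipZr _ (trsq' t tI) (wsq t tI)); ring.
rewrite DE.
pose e1 := e' * (`|k| + `|c| + 2).
have e10 : 0 <= e1 by rewrite mulr_ge0 ?(ltW e'0)// !addr_ge0.
have E1 := @int0_estimate _ (fun x => A x - moving_flux phi x) m T s t a e1 e10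
  (integrableB mI AInt BInt) mInt sI tI.
have E2 : `|ip (w t) (translate (c * s) phi \- (translate (c * t) phi \-
            (fun y => c * (s - t) * translate (c * t) (phi^`())%classic y)))| <=
          nrm (w t) * e' * `|M s - M t|.
  apply: (le_trans (cauchy_schwarz _ _)).
  - exact: wsq.
  - apply: sqintB; first exact: trsq.
    by apply: sqintB; [exact: trsq|exact: sqintZ (trsq' t tI)].
  rewrite -mulrA ler_wpM2l ?nrm_ge0// (le_trans (P3 s sI sd3))// ler_wpM2l ?(ltW e'0)//.
  exact: Mdiff.
have -> : e = e' * Q by rewrite /e' divfK// gt_eqF.
apply: (le_trans (ler_normD _ _)).
apply: (le_trans (y := e1 * `|M s - M t| + nrm (w t) * e' * `|M s - M t|)); last first.
  rewrite /e1 /Q; have := mulr_ge0 (ltW e'0) (normr_ge0 (M s - M t)); nra.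
apply: lerD E2; apply: E1 => x /andP[xl xr].
have xI : 0 <= x <= T.
  have /andP[s0 sT] := sI; have /andP[t0 tT] := tI.
  rewrite (le_trans _ xl) ?le_min ?s0// (le_trans xr)// ge_max sT//.
have xt : `|x - t| <= `|s - t|.
  move: xl xr; rewrite minEle maxEle; case: ifPn => st h1 h2.
    by rewrite !ler0_norm ?subr_le0// lerN2 lerD2r.
  by rewrite !ger0_norm ?subr_ge0 ?(le_trans h1)// lerD2r.
have phiz z : `|phi (z - c * s) - phi (z - c * x)| <= e'.
  apply/ltW/P4.
  have -> : z - c * s - (z - c * x) = - (c * (s - x)) by ring.
  by rewrite normrN; exact: norm_lt_of_close xt sd4.
have b1 : `|ip (w x) (translate (c * s) (phi^`())%classic) -
           ip (w t) (translate (c * t) (phi^`())%classic)| <= e'.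
  by apply/ltW/P1 => //; apply: le_lt_trans xt _.
have b2 : `|ip (r x) (translate (c * s) phi) - ip (r x) (translate (c * x) phi)| <= e'.
  have h1 := P2 x s xI sI (le_lt_trans xt sd2) sd2.
  have h2 := P2 x x xI xI (le_lt_trans xt sd2) (le_lt_trans xt sd2).
  apply: (le_trans (ler_distD (ip (r t) (translate (c * t) phi)) _ _)).
  by rewrite [leRHS]splitr; apply: lerD; [exact: ltW h1|rewrite distrC; exact: ltW h2].
exact: flux_increment_bound (phiz p) (phiz q) b1 b2.
Qed.

End moving_frame.
End transport.

(** * Energy of a weak integral curve *)

Section weak_integral_curve.
Variable R : realType.
Notation mu := (@lebesgue_measure R).

Lemma int0_cst (a t : R) : 0 <= t -> int0 (fun=> a) t = a * t.
Proof.
move=> t0; rewrite /int0 Rintegral_cst//= lebesgue_measure_itv/= lte_fin.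
by case: ltgtP t0 => //= [_ _|<- _]; rewrite ?subr0 ?mulr0.
Qed.

Lemma cst_integrable (a T : R) : mu.-integrable `[0, T] (EFin \o (fun=> a)).
Proof.
apply: continuous_compact_integrable; first exact: segment_compact.
by apply: continuous_subspaceT => x; exact: cvg_cst.
Qed.

Lemma int0_increment_bound (h : R -> R) (T s t e : R) : 0 <= e ->
  mu.-integrable `[0, T] (EFin \o h) -> 0 <= s <= T -> 0 <= t <= T ->
  (forall x, 0 <= x <= T -> Num.min s t <= x <= Num.max s t -> `|h x| <= e) ->
  `|int0 h s - int0 h t| <= e * `|s - t|.
Proof.
move=> e0 hI sI tI H.
have /andP[s0 sT] := sI; have /andP[t0 tT] := tI.
have := @int0_estimate _ h (fun=> 1) T s t 0 e e0 hI (cst_integrable 1 T) sI tI.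
rewrite !int0_cst// !mul1r mul0r subr0; apply => x xI.
rewrite subr0 mulr1; apply: H => //.
have /andP[xl xr] := xI.
by rewrite (le_trans _ xl) ?le_min ?s0// (le_trans xr)// ge_max sT.
Qed.

Section hilbert.
Variables (T C : R) (V rho : R -> R -> R).
Hypothesis T0 : 0 <= T.
Hypothesis C0 : 0 <= C.
Hypothesis V_sqint : sqint_curve T V.
Hypothesis rho_sqint : sqint_curve T rho.
Hypothesis rho_bounded : forall t, 0 <= t <= T -> nrm (rho t) <= C.
Hypothesis rho_integrable : forall phi, test_function phi ->
  mu.-integrable `[0, T] (EFin \o (fun t => ip (rho t) phi)).
Hypothesis V_weak : forall phi, test_function phi -> forall t, 0 <= t <= T ->
  ip (V t) phi - ip (V 0) phi = int0 (fun s => ip (rho s) phi) t.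
Hypothesis rhoV_integrable :
  mu.-integrable `[0, T] (EFin \o (fun t => ip (rho t) (V t))).

Let V_weak_increment phi s t : test_function phi -> 0 <= s <= T -> 0 <= t <= T ->
  ip (V s \- V t) phi = int0 (fun s => ip (rho s) phi) s - int0 (fun s => ip (rho s) phi) t.
Proof.
move=> tphi sI tI; have [sphi _] := test_function_sqint tphi.
rewrite -(V_weak tphi sI) -(V_weak tphi tI) (ipBl (V_sqint sI) (V_sqint tI) sphi); ring.
Qed.

(** Duality: the weak equation bounds the pairing of the increment with every test function by
    [L * nrm phi], and test functions close to the increment itself recover its norm. *)
Lemma weak_curve_lipschitz s t : 0 <= s <= T -> 0 <= t <= T ->
  nrm (V s \- V t) <= C * `|s - t|.
Proof.
move=> sI tI; set x := V s \- V t; set L := C * `|s - t|.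
have sx : sqint x := sqintB (V_sqint sI) (V_sqint tI).
have L0 : 0 <= L by rewrite mulr_ge0.
have N0 := nrm_ge0 x.
have test phi : test_function phi -> `|ip x phi| <= L * nrm phi.
  move=> tphi; have [sphi _] := test_function_sqint tphi.
  rewrite (V_weak_increment tphi sI tI) /L mulrAC.
  apply: (int0_increment_bound _ (rho_integrable tphi) sI tI).
    by rewrite mulr_ge0 ?nrm_ge0.
  move=> z zI _; apply: (le_trans (cauchy_schwarz (rho_sqint zI) sphi)).
  by rewrite ler_wpM2r ?nrm_ge0// rho_bounded.
suff : nrm x ^+ 2 <= L * nrm x.
  have [->//|x0] := eqVneq (nrm x) 0.
  by rewrite expr2 ler_pM2r// lt_neqAle eq_sym x0.
apply/ler_addgt0Pl => e e0.
have p0 : 0 < L + nrm x + 1 by lra.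
have [phi tphi xphi] := test_function_dense sx (divr_gt0 e0 p0).
have [sphi _] := test_function_sqint tphi.
have sd := sqintB sx sphi.
have phix : nrm phi <= nrm x + nrm (x \- phi).
  rewrite nrmBC [X in nrm X <= _](_ : _ = x \+ (phi \- x)); last first.
    by apply/funext => y /=; ring.
  by apply: nrmD => //; exact: sqintB.
have split : ip x x = ip x phi + ip x (x \- phi) by rewrite ipBr//; ring.
rewrite nrm_sqr split.
have h1 := le_trans (ler_norm _) (test _ tphi).
have h2 := le_trans (ler_norm _) (cauchy_schwarz sx sd).
have h3 := ler_wpM2l L0 phix.
have h4 : (L + nrm x) * nrm (x \- phi) <= e.
  apply: (le_trans (y := (L + nrm x + 1) * nrm (x \- phi))).
    by rewrite ler_wpM2r ?nrm_ge0// lerDl.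
  by rewrite mulrC -ler_pdivlMr// ltW.
move: h1 h2 h3 h4; rewrite mulrDr mulrDl.
move: (ip x phi) (ip x (x \- phi)) (nrm phi) (nrm (x \- phi)) (nrm x) => a b c d f.
lra.
Qed.

(** A difference of squared norms is the pairing of [V s \- V t] with [V s \+ V t]. Replacing the
    latter by a test function within [|s - t|] costs [C * |s - t| ^+ 2] by the Lipschitz bound, and
    makes the weak equation applicable; what remains under the integral is of order [|s - t|]. So
    [D] has quadratic increments and is constant. *)
Lemma weak_curve_energy :
  ip (V T) (V T) - ip (V 0) (V 0) = int0 (fun t => 2 * ip (rho t) (V t)) T.
Proof.
have mI : measurable (`[0, T]%classic : set (measurableTypeR R)) by exact: measurable_itv.
have rV2 : mu.-integrable `[0, T] (EFin \o (fun t => 2 * ip (rho t) (V t))).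
  exact: (integrableZl mI 2 rhoV_integrable).
pose D t := ip (V t) (V t) - int0 (fun t => 2 * ip (rho t) (V t)) t.
suff : D T = D 0 by rewrite /D int00 subr0 => <-; ring.
(* [2 * C + 2 * C ^+ 2] is the sum of the constants in [h1] and [h2]; the [1] makes [B] positive. *)
pose B := 2 * C + 2 * C ^+ 2 + 1.
have B0 : 0 < B by rewrite ltr_wpDl// addr_ge0 ?mulr_ge0 ?sqr_ge0.
have quad s t : 0 <= s <= T -> 0 <= t <= T -> `|D s - D t| <= B * `|s - t| ^+ 2.
  move=> sI tI.
  have [->|st] := eqVneq s t; first by rewrite !subrr normr0 expr0n mulr0.
  have d0 : 0 < `|s - t| by rewrite normr_gt0 subr_eq0.
  have sx := sqintB (V_sqint sI) (V_sqint tI).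
  have sy := sqintD (V_sqint sI) (V_sqint tI).
  have [phi tphi yphi] := test_function_dense sy d0.
  have [sphi _] := test_function_sqint tphi.
  have rphi := rho_integrable tphi.
  have DE : D s - D t = ip (V s \- V t) ((V s \+ V t) \- phi) +
     (int0 (fun z => ip (rho z) phi - 2 * ip (rho z) (V z)) s -
      int0 (fun z => ip (rho z) phi - 2 * ip (rho z) (V z)) t).
    have h z : 0 <= z <= T -> int0 (fun z => ip (rho z) phi - 2 * ip (rho z) (V z)) z
      = int0 (fun z => ip (rho z) phi) z - int0 (fun z => 2 * ip (rho z) (V z)) z.
      move=> /andP[z0 zT]; rewrite /int0 RintegralB//.
        by apply: integrableS rphi => //; apply: subset_itvl; rewrite bnd_simp.
      by apply: integrableS rV2 => //; apply: subset_itvl; rewrite bnd_simp.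
    rewrite (h s sI) (h t tI) (ipBr sy sphi sx) (V_weak_increment tphi sI tI).
    have -> : ip (V s \- V t) (V s \+ V t) = ip (V s) (V s) - ip (V t) (V t).
      have Vs := V_sqint sI; have Vt := V_sqint tI.
      rewrite (ipBl Vs Vt sy) (ipDr Vs Vt Vs) (ipDr Vs Vt Vt) (ipC (V t) (V s)); ring.
    by rewrite /D; ring.
  have h1 : `|ip (V s \- V t) ((V s \+ V t) \- phi)| <= C * `|s - t| ^+ 2.
    apply: (le_trans (cauchy_schwarz sx (sqintB sy sphi))).
    rewrite expr2 mulrA ler_pM ?nrm_ge0 ?(ltW yphi)//.
    exact: weak_curve_lipschitz.
  have h2 : `|int0 (fun z => ip (rho z) phi - 2 * ip (rho z) (V z)) s -
      int0 (fun z => ip (rho z) phi - 2 * ip (rho z) (V z)) t| <=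
      (C * (`|s - t| + 2 * (C * `|s - t|))) * `|s - t|.
    apply: (int0_increment_bound _ (integrableB mI rphi rV2) sI tI).
      by rewrite mulr_ge0// addr_ge0// mulr_ge0// mulr_ge0.
    move=> z zI /andP[zl zr].
    have Vz := V_sqint zI; have s2V := sqintZ 2 Vz.
    have -> : ip (rho z) phi - 2 * ip (rho z) (V z) = ip (rho z) (phi \- (fun y => 2 * V z y)).
      by rewrite (ipBr sphi s2V (rho_sqint zI)) (ipZr _ Vz (rho_sqint zI)).
    apply: (le_trans (cauchy_schwarz (rho_sqint zI) (sqintB sphi s2V))).
    rewrite ler_pM ?nrm_ge0 ?rho_bounded//.
    have sV1 := sqintB (V_sqint sI) Vz; have sV2 := sqintB (V_sqint tI) Vz.
    have zs : `|s - z| <= `|s - t|.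
      move: zl zr; rewrite minEle maxEle; case: ifPn => sto h1' h2'.
        by rewrite !ler0_norm ?subr_le0// lerN2 lerD2l lerN2.
      by rewrite !ger0_norm ?subr_ge0 ?(le_trans h1')// lerD2l lerN2.
    have zt : `|t - z| <= `|s - t|.
      rewrite (distrC s); move: zl zr; rewrite minEle maxEle; case: ifPn => sto h1' h2'.
        by rewrite !ger0_norm ?subr_ge0// lerD2l lerN2.
      rewrite -ltNge in sto.
      by rewrite !ler0_norm ?subr_le0 ?(ltW sto)// lerN2 lerD2l lerN2.
    (* [phi] is compared with [2 * V z] through [V s \+ V t]; as [z] lies between [s] and [t], the
       Lipschitz bound controls both differences. *)
    apply: (le_trans (y := nrm ((V s \+ V t) \- phi) + (nrm (V s \- V z) + nrm (V t \- V z)))).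
      rewrite [X in nrm X <= _](_ : _ =
          ((V s \- V z) \+ (V t \- V z)) \- ((V s \+ V t) \- phi)); last first.
        by apply/funext => y /=; ring.
      apply: (le_trans (nrmB (sqintD sV1 sV2) (sqintB sy sphi))).
      by rewrite addrC lerD2l nrmD.
    apply: lerD (ltW yphi) _.
    have := weak_curve_lipschitz sI zI; have := weak_curve_lipschitz tI zI.
    have := ler_wpM2l C0 zs; have := ler_wpM2l C0 zt; lra.
  rewrite DE (le_trans (ler_normD _ _))// (le_trans (lerD h1 h2))//.
  have := sqr_ge0 (s - t); rewrite -real_normK ?num_real// => q0.
  have -> : C * `|s - t| ^+ 2 + C * (`|s - t| + 2 * (C * `|s - t|)) * `|s - t|
    = (B - 1) * `|s - t| ^+ 2 by rewrite /B; ring.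
  by rewrite ler_wpM2r// gerBl.
apply: (@eq_of_small_increments _ D id T T0) => // t tI e e0.
exists (e / B); first by rewrite divr_gt0.
move=> s sI; rewrite ltr_pdivlMr// => st; apply: (le_trans (quad s t sI tI)).
by rewrite expr2 mulrA ler_wpM2r// mulrC ltW.
Qed.

End hilbert.
End weak_integral_curve.

(** * Affine changes of variables *)

Section affine_change_of_variables.
Variable R : realType.
Notation mu := (@lebesgue_measure R).
Implicit Types (p c z : R) (f g phi : R -> R).

Let aff p c : measurableTypeR R -> measurableTypeR R := fun s => p - c * s.

Let measurable_aff p c : measurable_fun setT (aff p c).
Proof. by apply: measurable_funB => //; apply: measurable_funM. Qed.

(** The right-hand side is a scaled image of Lebesgue measure; it agrees with Lebesgue measure on
    half-open intervals, and uniqueness does the rest. For positive [c] the preimage is closed on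
    the other side, hence the two cases. *)
Lemma lebesgue_measure_affine p c (A : set (measurableTypeR R)) : c != 0 -> measurable A ->
  mu A = (`|c|%:E * mu (aff p c @^-1` A))%E.
Proof.
move=> c0 mA.
have [nu nuE] : exists nu : {measure set (measurableTypeR R) -> \bar R},
    forall A, nu A = (`|c|%:E * mu (aff p c @^-1` A))%E.
  unshelve eexists (mscale (NngNum (normr_ge0 c)) (pushforward mu (aff p c)) :
    {measure set (measurableTypeR R) -> \bar R}).
    exact: measurable_aff.
  by [].
rewrite (@lebesgue_measure_unique R nu _ A mA) ?nuE//.
move=> _ [[a b] /= _ <-]; rewrite nuE.
have cn : 0 < `|c| by rewrite normr_gt0.
rewrite /aff.
have [cp|cN] := ltP 0 c.
  rewrite (_ : _ @^-1` _ = `[(p - b) / c, (p - a) / c[%classic); last first.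
    apply/seteqP; split => s /=; rewrite !in_itv/= ler_pdivrMr// ltr_pdivlMr// => /andP[? ?];
      apply/andP; split; lra.
  rewrite !lebesgue_measure_itv/= !lte_fin (gtr0_norm cp) ltr_pM2r ?invr_gt0// ltrD2l ltrN2.
  case: ifPn => ab; last by rewrite mule0.
  rewrite -!EFinB -EFinM; congr (_%:E); field; exact: lt0r_neq0.
have cn' : c < 0 by rewrite lt_neqAle c0.
rewrite (_ : _ @^-1` _ = `](p - a) / c, (p - b) / c]%classic); last first.
  apply/seteqP; split => s /=; rewrite !in_itv/= ler_ndivlMr// ltr_ndivrMr// => /andP[? ?];
      apply/andP; split; lra.
rewrite !lebesgue_measure_itv/= !lte_fin (ltr0_norm cn') ltr_nM2r ?invr_lt0// ltrD2l ltrN2.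
case: ifPn => ab; last by rewrite mule0.
by rewrite -!EFinB -EFinM; congr (_%:E); field.
Qed.

Lemma ge0_integral_affine p c (f : measurableTypeR R -> \bar R) : c != 0 ->
  measurable_fun setT f -> (forall x, (0 <= f x)%E) ->
  (\int[mu]_x f x = `|c|%:E * \int[mu]_x f (aff p c x))%E.
Proof.
move=> c0 mf f0.
have [nu [nuE nuI]] : exists nu : {measure set (measurableTypeR R) -> \bar R},
    (forall A, nu A = (`|c|%:E * mu (aff p c @^-1` A))%E) /\
    (\int[nu]_x f x = `|c|%:E * \int[mu]_x f (aff p c x))%E.
  unshelve eexists (mscale (NngNum (normr_ge0 c)) (pushforward mu (aff p c)) :
    {measure set (measurableTypeR R) -> \bar R}).
    exact: measurable_aff.
  split => //; rewrite ge0_integral_mscale//= ge0_integral_pushforward//.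
rewrite -nuI; apply: eq_measure_integral => A mA _.
by rewrite nuE; exact: lebesgue_measure_affine.
Qed.

Lemma integrable_affine p c f : c != 0 -> measurable_fun setT f ->
  mu.-integrable setT (EFin \o f) <-> mu.-integrable setT (EFin \o (fun s => f (p - c * s))).
Proof.
move=> c0 mf; have cn : 0 < `|c| by rewrite normr_gt0.
have mfa : measurable_fun setT (fun s => f (p - c * s)).
  exact: (measurableT_comp mf (measurable_aff p c)).
have E : (\int[mu]_x `|(f x)%:E| = `|c|%:E * \int[mu]_x `|(f (p - c * x))%:E|)%E.
  apply: (@ge0_integral_affine p c (fun x => `|(f x)%:E|%E)) => //.
  by apply: measurableT_comp => //; exact/measurable_EFinP.
split => /integrableP[_ fI]; apply/integrableP; split; try exact/measurable_EFinP.
  move: fI => /=; rewrite E; apply: contraTT; rewrite -!leNgt !leye_eq => /eqP ->.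
  by rewrite mulry gtr0_sg// mul1e.
by move: fI => /= fI; rewrite E lte_mul_pinfty.
Qed.

Lemma Rintegral_affine p c f : c != 0 -> mu.-integrable setT (EFin \o f) ->
  \int[mu]_x f x = `|c| * \int[mu]_s f (p - c * s).
Proof.
move=> c0 fI; have /integrableP[/measurable_EFinP mf _] := fI.
have mf' : measurable_fun setT f by [].
have /(integrable_affine p c0 mf') faI := fI.
rewrite /Rintegral -[X in X * _]/(fine `|c|%:E) -fineM ?integrable_fin_num//; congr fine.
rewrite integralE [in RHS]integralE.
have pI := integrable_funepos measurableT faI.
have nI := integrable_funeneg measurableT faI.
rewrite muleBr//; last first.
  by rewrite fin_num_adde_defr// integrable_fin_num.
have mfE : measurable_fun setT (EFin \o f) by exact/measurable_EFinP.
have E1 := @ge0_integral_affine p c (EFin \o f)^\+%E c0 (measurable_funepos mfE)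
  (fun x => funepos_ge0 _ x).
have E2 := @ge0_integral_affine p c (EFin \o f)^\-%E c0 (measurable_funeneg mfE)
  (fun x => funeneg_ge0 _ x).
rewrite E1 E2; congr (_ * _ - _ * _)%E; apply: eq_integral => x _.
  by rewrite !funeposE.
by rewrite !funenegE.
Qed.

(** Composition with the inverse of [s |-> p - c * s]: a function of time is laid out on the line,
    its value at time [s] sitting at the point [p - c * s]. *)
Lemma sqint_affine p c f : c != 0 -> sqint f -> sqint (fun y => f ((p - y) / c)).
Proof.
move=> c0 [mf f2].
have m : measurable_fun setT (fun y : R => f ((p - y) / c)).
  apply: measurableT_comp => //.
  by apply: measurable_funM => //; apply: measurable_funB.
split => //; apply/(integrable_affine p c0); first exact: measurable_funX.
rewrite (_ : (fun s => _) = (fun s => f s ^+ 2))//.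
by apply/funext => s; congr (f _ ^+ 2); field.
Qed.

Lemma sqint_translate z f : sqint f -> sqint (translate z f).
Proof.
move=> /(@sqint_affine z (-1)); rewrite oppr_eq0 oner_eq0 => /(_ isT).
rewrite (_ : (fun y => _) = translate z f)//; apply/funext => y.
by rewrite /translate; congr f; field.
Qed.

Lemma ip_affine p c f g : c != 0 -> sqint f -> sqint g ->
  ip f g = `|c| * \int[mu]_s (f (p - c * s) * g (p - c * s)).
Proof. by move=> c0 sf sg; rewrite /ip (Rintegral_affine p c0)//; exact: sqint_integrableM. Qed.

Lemma ip_translate z f g : sqint f -> sqint g ->
  ip (translate z f) (translate z g) = ip f g.
Proof.
move=> sf sg; have c0 : (-1 : R) != 0 by rewrite oppr_eq0 oner_eq0.
rewrite [RHS](ip_affine (- z) c0 sf sg) normrN1 mul1r.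
by apply: eq_Rintegral => y _; rewrite /translate; congr (f _ * g _); ring.
Qed.

Lemma nrm_translate z f : sqint f -> nrm (translate z f) = nrm f.
Proof. by move=> sf; rewrite /nrm ip_translate. Qed.

End affine_change_of_variables.

(** * Energy of a transport equation with traces *)

Section transport_energy.
Variable R : realType.
Notation mu := (@lebesgue_measure R).

Lemma sqint_restrict (A : set (measurableTypeR R)) (f : R -> R) : measurable A ->
  sqint f -> sqint (f \_ A).
Proof.
move=> mA sf; have [mf _] := sf.
have [] // := @le_nrm R (f \_ A) f _ sf.
  by apply/(measurable_restrictT _ mA); exact: measurable_funTS.
by move=> x; rewrite patchE; case: ifPn => // _; rewrite normr0.
Qed.

Lemma ip_disjoint (f g : R -> R) : (forall y, f y * g y = 0) -> ip f g = 0.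
Proof.
move=> fg; rewrite /ip /Rintegral.
by under eq_integral do rewrite fg; rewrite integral0.
Qed.

Lemma translateK (z : R) (f : R -> R) : translate z (translate (- z) f) = f.
Proof. by apply/funext => y; rewrite /translate; congr f; ring. Qed.

Lemma ip_translate_adjoint (z : R) (f g : R -> R) : sqint f -> sqint g ->
  ip (translate (- z) f) g = ip f (translate z g).
Proof.
move=> sf sg; have st := sqint_translate (- z) sf.
by rewrite -(ip_translate z st sg) translateK.
Qed.

(** The Jacobian [|c|] of the change of variables is the speed that multiplies the traces in the
    weak equation. *)
Lemma ip_affine_restrict (p c : R) (A : set (measurableTypeR R)) (g f : R -> R) :
  c != 0 -> measurable A ->
  sqint (g \_ A) -> sqint f ->
  ip (fun y => (g \_ A) ((p - y) / c)) f = `|c| * \int[mu]_(s in A) (g s * f (p - c * s)).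
Proof.
move=> c0 mA sg sf; rewrite (ip_affine p c0 (sqint_affine p c0 sg) sf); congr (_ * _).
rewrite [RHS]Rintegral_mkcond; apply: eq_Rintegral => s _.
have -> : (p - (p - c * s)) / c = s by field.
by rewrite !patchE; case: ifPn => // _; rewrite mul0r.
Qed.

Lemma nrm_affine_restrict (p c : R) (A : set (measurableTypeR R)) (g : R -> R) :
  c != 0 -> measurable A ->
  sqint (g \_ A) ->
  ip (fun y => (g \_ A) ((p - y) / c)) (fun y => (g \_ A) ((p - y) / c)) =
  `|c| * \int[mu]_(s in A) g s ^+ 2.
Proof.
move=> c0 mA sg; have sa := sqint_affine p c0 sg.
rewrite (ip_affine_restrict p c0 mA sg sa); congr (_ * _).
apply: eq_Rintegral => s sA; have -> : (p - (p - c * s)) / c = s by field.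
by rewrite patchE sA expr2.
Qed.

Lemma integrable_itv_obnd_cbnd (f : R -> R) (T : R) : mu.-integrable `]0, T] (EFin \o f) ->
  mu.-integrable `[0, T] (EFin \o f).
Proof.
move=> /integrableP[mf fI]; apply/integrableP; split.
  exact/emeasurable_fun_itv_obnd_cbndP.
rewrite -integral_itv_obnd_cbnd//.
by apply: measurableT_comp.
Qed.

Lemma sqint_restrict_integrable (f : R -> R) (T : R) : sqint (f \_ `]0, T]) ->
  mu.-integrable `[0, T] (EFin \o (fun s => f s ^+ 2)).
Proof.
move=> [_ f2]; apply: integrable_itv_obnd_cbnd.
apply/integrable_mkcond; first exact: measurable_itv.
apply: eq_integrable f2 => // x _ /=; rewrite !patchE; case: ifPn => // _.
by rewrite expr0n.
Qed.

Lemma weak_transport_le (T T' c k p q : R) (w r : R -> R -> R) (gi go : R -> R) :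
  T' <= T -> weak_transport T c k p q w r gi go -> weak_transport T' c k p q w r gi go.
Proof.
move=> TT' [h1 h2 h3 h4 h5 h6 h7].
have I t : 0 <= t <= T' -> 0 <= t <= T.
  by move=> /andP[-> /=] /le_trans; exact.
have sub : `[0, T']%classic `<=` `[0, T] by apply: subset_itvl; rewrite bnd_simp.
split.
- by move=> t /I; exact: h1.
- move=> t /I tI e e0; have [d d0 dP] := h2 t tI e e0.
  by exists d => // s /I; exact: dP.
- by move=> t /I; exact: h3.
- move=> t /I tI e e0; have [d d0 dP] := h4 t tI e e0.
  by exists d => // s /I; exact: dP.
- exact: integrableS h5.
- exact: integrableS h6.
- by move=> phi tphi t /I; exact: h7.
Qed.

(** * Gluing the trace data to the solution pulled back along the characteristics *)

Section glue.
Variables (T c p q : R) (w r : R -> R -> R) (gi go : R -> R) (Om : set R).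
Hypothesis T0 : 0 <= T.
Hypothesis c0 : c != 0.
Hypothesis H : weak_transport T c `|c| p q w r gi go.
Hypothesis gi2 : sqint (gi \_ `]0, T]).
Hypothesis go2 : sqint (go \_ `]0, T]).
Hypothesis w_supp : forall t y, ~ Om y -> w t y = 0.
Hypothesis r_supp : forall t y, ~ Om y -> r t y = 0.
(** The geometry of the characteristics, phrased as vanishing of the data rather than as
    inequalities between points, so that the whole line with zero traces is included. *)
Hypothesis inflow_outside : forall s t, t < s -> Om (p - c * (s - t)) -> gi s = 0.
Hypothesis outflow_outside : forall s t, s < t -> Om (q + c * (t - s)) -> go s = 0.
Hypothesis inflow_outflow_disjoint :
  forall s s', s' < s -> p - c * s = q - c * s' -> gi s * go s' = 0.

Let inflow t y : R := (gi \_ `]t, T]) ((p - y) / c).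
Let outflow t y : R := (go \_ `]0, t[) ((q - y) / c).

(* The solution transported back along the characteristics. Outside [Om], the
   points [p - c s] carry the inflow data of times [s > t] still to enter, and
   the points [q - c s] the outflow data of times [s < t]. *)
Let V t : R -> R := translate (- (c * t)) (w t) \+ (inflow t \+ outflow t).
Let rho t : R -> R := translate (- (c * t)) (r t).

Let mitv (i : interval R) : measurable ([set` i]%classic : set (measurableTypeR R)).
Proof. exact: measurable_itv. Qed.

Let gi_sqint t : 0 <= t -> sqint (gi \_ `]t, T]).
Proof.
move=> t0; rewrite (_ : _ \_ _ = (gi \_ `]0, T]) \_ `]t, T]).
  exact: sqint_restrict (mitv _) gi2.
apply/funext => x; rewrite !patchE; case: ifPn => //; rewrite inE/= in_itv/= => /andP[tx xT].
by rewrite ifT// inE/= in_itv/= xT (le_lt_trans t0).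
Qed.

Let go_sqint t : t <= T -> sqint (go \_ `]0, t[).
Proof.
move=> tT; rewrite (_ : _ \_ _ = (go \_ `]0, T]) \_ `]0, t[).
  exact: sqint_restrict (mitv _) go2.
apply/funext => x; rewrite !patchE; case: ifPn => //; rewrite inE/= in_itv/= => /andP[tx xT].
by rewrite ifT// inE/= in_itv/= tx (le_trans (ltW xT)).
Qed.

Let inflow_sqint t : 0 <= t -> sqint (inflow t).
Proof. by move=> t0; exact: sqint_affine c0 (gi_sqint t0). Qed.

Let outflow_sqint t : t <= T -> sqint (outflow t).
Proof. by move=> tT; exact: sqint_affine c0 (go_sqint tT). Qed.

Let V_sqint : sqint_curve T V.
Proof.
move=> t /andP[t0 tT]; apply: sqintD.
  by apply: sqint_translate; apply: (transport_sqint H); rewrite t0.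
by apply: sqintD; [exact: inflow_sqint|exact: outflow_sqint].
Qed.

Let rho_sqint : sqint_curve T rho.
Proof. by move=> t tI; apply: sqint_translate; exact: source_sqint H t tI. Qed.

(** At a point [p - c * s] with [s > t], the pulled-back function takes the value of [v] at
    [p - c * (s - t)]: either that point is outside [Om], or the data vanish by [inflow_outside]. *)
Let translated_inflow t (v : R -> R) y : (forall y, ~ Om y -> v y = 0) ->
  translate (- (c * t)) v y * inflow t y = 0.
Proof.
move=> v0; rewrite /translate /inflow patchE; case: ifPn; last by rewrite mulr0.
rewrite inE/= in_itv/= => /andP[ts _].
have [Oy|/v0 ->] := pselect (Om (y - - (c * t))); last by rewrite mul0r.
rewrite (inflow_outside ts) ?mulr0//.
by rewrite (_ : p - _ = y - - (c * t))//; field.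
Qed.

Let translated_outflow t (v : R -> R) y : (forall y, ~ Om y -> v y = 0) ->
  translate (- (c * t)) v y * outflow t y = 0.
Proof.
move=> v0; rewrite /translate /outflow patchE; case: ifPn; last by rewrite mulr0.
rewrite inE/= in_itv/= => /andP[_ ts].
have [Oy|/v0 ->] := pselect (Om (y - - (c * t))); last by rewrite mul0r.
rewrite (outflow_outside ts) ?mulr0//.
by rewrite (_ : q + _ = y - - (c * t))//; field.
Qed.

Let inflow_outflow t y : inflow t y * outflow t y = 0.
Proof.
rewrite /inflow /outflow !patchE; case: ifPn; last by rewrite mul0r.
rewrite inE/= in_itv/= => /andP[ts _]; case: ifPn; last by rewrite mulr0.
rewrite inE/= in_itv/= => /andP[_ s't].
by apply: inflow_outflow_disjoint; [exact: lt_trans ts|field].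
Qed.

Let rhoV t : 0 <= t <= T -> ip (rho t) (V t) = ip (r t) (w t).
Proof.
move=> tI; have /andP[t0 tT] := tI.
have si := inflow_sqint t0; have so := outflow_sqint tT.
have sw := transport_sqint H tI; have sr := source_sqint H tI.
rewrite /V (ipDr (sqint_translate _ sw) (sqintD si so) (rho_sqint tI)).
rewrite (ipDr si so (rho_sqint tI)) ip_translate//.
rewrite (ip_disjoint (fun y => translated_inflow t y (r_supp t))).
by rewrite (ip_disjoint (fun y => translated_outflow t y (r_supp t))) !addr0.
Qed.

(** The three pieces of [V] have pairwise zero products, so every cross term drops. *)
Let V_square t : 0 <= t <= T -> ip (V t) (V t) =
  ip (w t) (w t) + (ip (inflow t) (inflow t) + ip (outflow t) (outflow t)).
Proof.
move=> tI; have /andP[t0 tT] := tI.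
have si := inflow_sqint t0; have so := outflow_sqint tT.
have sw := transport_sqint H tI; have st := sqint_translate (- (c * t)) sw.
have sio := sqintD si so.
rewrite /V (ipDl st sio (sqintD st sio)) (ipDr st sio st) (ipDr st sio sio).
rewrite (ipC (inflow t \+ outflow t) (translate _ _)) (ipDr si so st).
rewrite (ip_disjoint (fun y => translated_inflow t y (w_supp t))).
rewrite (ip_disjoint (fun y => translated_outflow t y (w_supp t))) ip_translate//.
rewrite (ipDl si so sio) (ipDr si so si) (ipDr si so so) (ipC (outflow t) (inflow t)).
by rewrite (ip_disjoint (inflow_outflow t)); ring.
Qed.

Let outflow_integral (h : R -> R) t : 0 <= t <= T -> mu.-integrable `[0, T] (EFin \o h) ->
  \int[mu]_(s in `]0, t[) h s = int0 h t.
Proof.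
move=> /andP[t0 tT] hI; rewrite /int0 Rintegral_itv_bndo_bndc; last first.
  apply: integrableS hI => //; apply: subset_itv; rewrite bnd_simp//.
rewrite Rintegral_itv_obnd_cbnd//.
by apply: integrableS hI => //; apply: subset_itv; rewrite bnd_simp.
Qed.

Let inflow_integral (h : R -> R) t : 0 <= t <= T -> mu.-integrable `[0, T] (EFin \o h) ->
  \int[mu]_(s in `]t, T]) h s = int0 h T - int0 h t.
Proof. by move=> /andP[t0 tT] hI; rewrite /int0 Rintegral_itvB. Qed.

(** The stored data compensate the traces: what leaves [inflow] and what enters [outflow] between
    [0] and [t] are the two trace terms of the moving flux, with opposite signs. Only the source
    remains. *)
Let V_weak phi : test_function phi -> forall t, 0 <= t <= T ->
  ip (V t) phi - ip (V 0) phi = int0 (fun s => ip (rho s) phi) t.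
Proof.
move=> tphi; have [sphi _] := test_function_sqint tphi.
have [K K0 sphiK] := test_function_supported tphi.
have cphi := test_function_continuous tphi.
pose h1 s := gi s * phi (p - c * s); pose h2 s := go s * phi (q - c * s).
pose h3 s := ip (r s) (translate (c * s) phi).
have cline (z : R) : continuous (fun s : R => phi (z - c * s)).
  move=> s; apply: continuous_comp; last exact: cphi.
  by apply: cvgB; [exact: cvg_cst|apply: cvgM; [exact: cvg_cst|exact: cvg_id]].
have I1 : mu.-integrable `[0, T] (EFin \o h1).
  exact: integrable_mul_continuous (inflow_integrable H) (cline p).
have I2 : mu.-integrable `[0, T] (EFin \o h2).
  exact: integrable_mul_continuous (outflow_integrable H) (cline q).
have I3 : mu.-integrable `[0, T] (EFin \o h3).
  apply: ip_curve_integrable.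
  - exact: source_sqint H.
  - exact: sqint_translate_curve (ltW K0) cphi sphiK.
  - exact: source_continuous H.
  - exact: continuous_translate_curve (ltW K0) cphi sphiK.
have VE t : 0 <= t <= T -> ip (V t) phi = ip (w t) (translate (c * t) phi) +
    (`|c| * (int0 h1 T - int0 h1 t) + `|c| * int0 h2 t).
  move=> tI; have /andP[t0 tT] := tI.
  have si := inflow_sqint t0; have so := outflow_sqint tT.
  have sw := transport_sqint H tI; have st := sqint_translate (- (c * t)) sw.
  rewrite /V (ipDl st (sqintD si so) sphi) (ipDl si so sphi) ip_translate_adjoint//.
  rewrite /inflow (ip_affine_restrict p c0 (mitv _) (gi_sqint t0) sphi).
  rewrite /outflow (ip_affine_restrict q c0 (mitv _) (go_sqint tT) sphi).
  by rewrite (inflow_integral tI I1) (outflow_integral tI I2).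
move=> t tI; have /andP[t0 tT] := tI.
have oI : 0 <= (0 : R) <= T by rewrite lexx.
have sub : `[0, t]%classic `<=` `[0, T] by apply: subset_itvl; rewrite bnd_simp.
have mt := mitv `[0, t].
have I1t := integrableS (mitv `[0, T]) mt sub I1.
have I2t := integrableS (mitv `[0, T]) mt sub I2.
have I3t := integrableS (mitv `[0, T]) mt sub I3.
have move_phi := moving_test_function (weak_transport_le tT H) t0 tphi.
have fluxE : int0 (moving_flux c `|c| p q r gi go phi) t =
    `|c| * (int0 h1 t - int0 h2 t) + int0 h3 t.
  have I12 := integrableB mt I1t I2t.
  rewrite /int0 -(RintegralB mt I1t I2t) -(RintegralZl _ mt I12) -RintegralD//.
  exact: (integrableZl mt _ I12).
have -> : int0 (fun s => ip (rho s) phi) t = int0 h3 t.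
  apply: eq_Rintegral => s; rewrite inE/= in_itv/= => /andP[s0 st].
  by apply: ip_translate_adjoint => //; apply: (source_sqint H); rewrite s0 (le_trans st).
rewrite (VE t tI) (VE 0 oI) !int00 !mulr0.
have -> : translate 0 phi = phi by apply/funext => y; rewrite /translate subr0.
move: move_phi; rewrite fluxE => /eqP; rewrite subr_eq => /eqP ->; ring.
Qed.

(** At time [0] the line stores the whole inflow and no outflow, at time [T] the reverse; this is
    how the squared traces enter the balance. *)
Lemma transport_energy : ip (w T) (w T) - ip (w 0) (w 0) =
  int0 (fun s => `|c| * (gi s ^+ 2 - go s ^+ 2) + 2 * ip (r s) (w s)) T.
Proof.
have oI : 0 <= (0 : R) <= T by rewrite lexx.
have TI : 0 <= T <= T by rewrite T0 lexx.
have [C C0 rC] := curve_bounded (source_sqint H) (source_continuous H).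
have rwI : mu.-integrable `[0, T] (EFin \o (fun t => ip (r t) (w t))).
  apply: ip_curve_integrable.
  - exact: source_sqint H.
  - exact: transport_sqint H.
  - exact: source_continuous H.
  - exact: transport_continuous H.
have rho_integrable phi : test_function phi ->
    mu.-integrable `[0, T] (EFin \o (fun t => ip (rho t) phi)).
  move=> tphi; have [sphi _] := test_function_sqint tphi.
  have [K K0 sphiK] := test_function_supported tphi.
  have cphi := test_function_continuous tphi.
  have I3 : mu.-integrable `[0, T] (EFin \o (fun s => ip (r s) (translate (c * s) phi))).
    apply: ip_curve_integrable.
    - exact: source_sqint H.
    - exact: sqint_translate_curve (ltW K0) cphi sphiK.
    - exact: source_continuous H.
    - exact: continuous_translate_curve (ltW K0) cphi sphiK.
  apply: eq_integrable I3 => //.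
  move=> s; rewrite inE/= in_itv/= => sI.
  by rewrite ip_translate_adjoint//; exact: source_sqint H s sI.
have rhoVI : mu.-integrable `[0, T] (EFin \o (fun t => ip (rho t) (V t))).
  apply: eq_integrable rwI => //.
  by move=> s; rewrite inE/= in_itv/= => sI; rewrite rhoV.
have E := @weak_curve_energy R T C V rho T0 C0 V_sqint rho_sqint
  (fun t tI => eq_ind_r (fun x => x <= C) (rC t tI) (nrm_translate _ (source_sqint H tI)))
  rho_integrable V_weak rhoVI.
have gi2I := sqint_restrict_integrable gi2; have go2I := sqint_restrict_integrable go2.
have EI t : 0 <= t <= T -> ip (inflow t) (inflow t) =
    `|c| * (int0 (fun s => gi s ^+ 2) T - int0 (fun s => gi s ^+ 2) t).
  move=> tI; have /andP[t0 _] := tI.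
  by rewrite /inflow (nrm_affine_restrict p c0 (mitv _) (gi_sqint t0)) (inflow_integral tI gi2I).
have EO t : 0 <= t <= T -> ip (outflow t) (outflow t) = `|c| * int0 (fun s => go s ^+ 2) t.
  move=> tI; have /andP[_ tT] := tI.
  by rewrite /outflow (nrm_affine_restrict q c0 (mitv _) (go_sqint tT)) (outflow_integral tI go2I).
have mT := mitv `[0, T].
have -> : int0 (fun s => `|c| * (gi s ^+ 2 - go s ^+ 2) + 2 * ip (r s) (w s)) T =
    `|c| * (int0 (fun s => gi s ^+ 2) T - int0 (fun s => go s ^+ 2) T) +
    int0 (fun t => 2 * ip (rho t) (V t)) T.
  have I12 := integrableB mT gi2I go2I.
  rewrite (_ : int0 (fun t => 2 * _) T = int0 (fun t => 2 * ip (r t) (w t)) T); last first.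
    by apply: eq_Rintegral => s; rewrite inE/= in_itv/= => sI; rewrite rhoV.
  rewrite /int0 -(RintegralB mT gi2I go2I) -(RintegralZl _ mT I12) -RintegralD//.
    exact: (integrableZl mT _ I12).
  exact: (integrableZl mT _ rwI).
rewrite -E (V_square TI) (V_square oI) (EI T TI) (EI 0 oI) (EO T TI) (EO 0 oI) !int00; ring.
Qed.

End glue.
End transport_energy.

(** * Difference of two damped waves *)

Section conversions.
Variable R : realType.
Notation mu := (@lebesgue_measure R).
Implicit Types (D : domain R) (T s t e : R) (phi f g : R -> R).

Lemma L2_sqint (A : set R) f : L2 A f <-> sqint (f \_ A).
Proof. exact: Lfun2P. Qed.

Lemma L2normE (A : set R) f : sqint (f \_ A) -> L2norm A f = (nrm (f \_ A))%:E.
Proof. exact: LnormE. Qed.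

Lemma restrictB (A : set R) f g : (f \- g) \_ A = (f \_ A) \- (g \_ A).
Proof. by apply/funext => y; rewrite /= !patchE; case: ifPn => // _; rewrite subr0. Qed.

Lemma restrictZ (A : set R) a f : (fun y => a * f y) \_ A = (fun y => a * (f \_ A) y).
Proof. by apply/funext => y; rewrite /= !patchE; case: ifPn => // _; rewrite mulr0. Qed.

Lemma ip_restrict (A : set R) f phi : \int[mu]_(y in A) (f y * phi y) = ip (f \_ A) phi.
Proof.
rewrite Rintegral_mkcond; apply: eq_Rintegral => y _.
by rewrite !patchE; case: ifPn => // _; rewrite mul0r.
Qed.

Lemma L2_continuous_curve (A : set R) (h : R -> R -> R) T : L2_continuous A h ->
  sqint_curve T (fun t => h t \_ A) /\ continuous_curve T (fun t => h t \_ A).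
Proof.
move=> [hA hc]; have sA t : 0 <= t -> sqint (h t \_ A) by move=> /hA /L2_sqint.
split; first by move=> t /andP[t0 _]; exact: sA.
move=> t /andP[t0 _] e e0.
have /fine_cvgP[_ /cvgrPdist_lt /(_ e e0)] := hc t t0.
move=> /nbhs_ballP[d /= d0 dP]; exists d => // s /andP[s0 _] st.
have := dP s; rewrite /ball /= distrC => /(_ st s0).
rewrite sub0r normrN => /(le_lt_trans (ler_norm _)).
by rewrite L2normE restrictB//; apply: sqintB; exact: sA.
Qed.

(* The traces, which are meaningless on the whole line, are replaced there by 0,
   so that both kinds of domains are treated alike. *)
Definition trace D f s := match D with WholeLine => 0 | BoundedInterval _ => f s end.

Definition left_end D := match D with WholeLine => 0 | BoundedInterval b => ymin b end.

Definition right_end D := match D with WholeLine => 0 | BoundedInterval b => ymax b end.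

Definition balance_rate D (p : R -> R -> R) (pl pr : R -> R) (r : R -> R -> R) phi s :=
  trace D pr s * phi (right_end D) - trace D pl s * phi (left_end D)
  - ip (p s \_ (Omega D)) (phi^`())%classic + ip (r s \_ (Omega D)) phi.

Lemma weak_balanceE D q p pl pr r phi t : weak_balance D q p pl pr r ->
  test_function phi -> 0 <= t ->
  ip (q t \_ (Omega D)) phi - ip (q 0 \_ (Omega D)) phi = int0 (balance_rate D p pl pr r phi) t.
Proof.
move=> wb tphi t0; rewrite -!ip_restrict (wb phi tphi t t0).
apply: eq_Rintegral => s _; rewrite /balance_rate !ip_restrict; congr (_ - _ + _).
by case: (D) => //=; rewrite !mul0r subrr.
Qed.

(** [f] is square integrable on space-time only, so its slices are reached through Fubini's theorem,
    applied to the product of [F] with the square-integrable function [g], which is [phi] cut off in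
    time. The horizon [T + 1] puts the end point [T] inside the open time interval. *)
Lemma spacetime_pairing_integrable D (f : R -> R -> R) phi T : 0 < T ->
  L2_spacetime (T + 1) (Omega D) f -> test_function phi ->
  mu.-integrable `[0, T] (EFin \o (fun s => ip (f s \_ (Omega D)) phi)).
Proof.
move=> T0 fL2 tphi; have [sphi _] := test_function_sqint tphi.
have [mphi _] := sphi; have phiI := sqint_integrableM sphi sphi.
pose F := (fun p : R * R => f p.1 p.2) \_ (`]0, T + 1[ `*` Omega D).
have F2 := Lfun2_integrable_sqr fL2.
have mF : measurable_fun setT F.
  by move: fL2; rewrite /L2_spacetime inE => /andP[]; rewrite inE.
pose g (p : R * R) := \1_`]0, T + 1[ p.1 * phi p.2.
have mg : measurable_fun setT g.
  apply: measurable_funM; first by apply: measurableT_comp.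
  exact: measurableT_comp.
have g2 : ((mu \x mu)%E).-integrable setT (EFin \o (fun p => g p ^+ 2)).
  apply/integrable12ltyP; first by apply/measurable_EFinP; exact: measurable_funX.
  have inner (x : R) : (\int[mu]_y `|(g (x, y) ^+ 2)%R%:E| =
      (ip phi phi)%:E * (\1_(`]0, T + 1[%classic) x)%R%:E)%E.
    rewrite [RHS]muleC -[ip phi phi]/(fine _) fineK; last first.
      exact: (integrable_fin_num measurableT phiI).
    rewrite -(integralZl measurableT phiI).
    apply: eq_integral => y _ /=; rewrite /g /=.
    rewrite ger0_norm ?sqr_ge0// exprMn -EFinM; congr (_ * _)%:E.
    by rewrite indicE; case: (_ \in _); rewrite ?expr1n ?expr0n.
  rewrite /=; under eq_integral do rewrite inner.
  apply: integrable_lty => //; apply: integrableZl => //.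
  exact: (integrable_indic_itv 0 (T + 1) false true).
have Fg : ((mu \x mu)%E).-integrable setT (EFin \o (fun p => F p * g p)).
  apply: le_integrable (integrableD measurableT F2 g2) => //.
    by apply/measurable_EFinP; exact: measurable_funM.
  move=> x _ /=; rewrite lee_fin.
  apply: le_trans (ler_norm _); rewrite normrM.
  rewrite -[leRHS]/(F x ^+ 2 + g x ^+ 2) -(real_normK (num_real (F x)))
    -(real_normK (num_real (g x))).
  move: (`|F x|) (`|g x|) (normr_ge0 (F x)) (normr_ge0 (g x)) => a b a0 b0.
  by have := sqr_ge0 (a - b); have := mulr_ge0 a0 b0; rewrite sqrrB; lra.
have XI := integrable_fubini_F Fg.
set X := fubini_F _ _ in XI.
have XE s : 0 < s <= T -> ip (f s \_ (Omega D)) phi = fine (X s).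
  move=> /andP[s0 sT]; rewrite /ip /Rintegral /X /fubini_F; congr fine.
  apply: eq_integral => y _; rewrite /= /F /g !patchE /=.
  have sI : `]0, T + 1[%classic s by rewrite /= in_itv/= s0; lra.
  rewrite indicE (mem_set sI) mul1r; congr (_ * _)%:E.
  case: ifPn => yO; first by rewrite ifT// inE; split => //; exact: set_mem yO.
  by rewrite ifF//; apply/negbTE; apply: contra yO; rewrite !inE => -[].
apply: integrable_itv_obnd_cbnd.
have mI : measurable (`]0, T]%classic : set (measurableTypeR R)) by exact: measurable_itv.
have XI' := integrableS measurableT mI (@subsetT _ _) XI.
have fXI : mu.-integrable `]0, T] (EFin \o (fun s => fine (X s))).
  have [mX _] := integrableP _ _ _ XI'.
  apply: le_integrable XI' => //.
    by apply/measurable_EFinP; apply: measurableT_comp mX; exact: fine_measurable.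
  by move=> s _ /=; case: (X s) => //=; rewrite leey.
apply: eq_integrable fXI => // s; rewrite inE/= in_itv/= => sI.
by rewrite XE.
Qed.

End conversions.

(** * Balances and energy identity for the difference of two solutions *)

Section difference_of_solutions.
Variable R : realType.
Notation mu := (@lebesgue_measure R).

Lemma trace_mul (D : domain R) (G : R) (f : R -> R) s :
  trace D (fun t => G * f t) s = G * trace D f s.
Proof. by case: D => //=; rewrite mulr0. Qed.

Lemma sqint_restrict_integrable1 (f : R -> R) (T : R) : sqint (f \_ `]0, T]) ->
  mu.-integrable `[0, T] (EFin \o f).
Proof.
move=> sf; apply: integrable_itv_obnd_cbnd.
apply/integrable_mkcond; first exact: measurable_itv.
apply: eq_integrable (sqint_integrableM sf (sqint_indic_itv 0 T)) => // x _ /=.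
rewrite !patchE; case: ifPn => [|_]; last by rewrite mul0r.
rewrite inE/= in_itv/= => /andP[x0 xT].
by rewrite indicE mem_set ?mulr1//= in_itv/= xT ltW.
Qed.

Lemma sqint_restrict_integrableM (g h : R -> R) (T : R) :
  sqint (g \_ `]0, T]) -> sqint (h \_ `]0, T]) ->
  mu.-integrable `[0, T] (EFin \o (fun s => g s * h s)).
Proof.
move=> sg sh; apply: integrable_itv_obnd_cbnd.
apply/integrable_mkcond; first exact: measurable_itv.
apply: eq_integrable (sqint_integrableM sg sh) => // x _ /=.
by rewrite !patchE; case: ifPn => // _; rewrite mul0r.
Qed.

Lemma traces_sqint (D : domain R) (w : wave R) (T : R) : 0 < T ->
  boundary_conditions D w ->
  [/\ sqint (trace D (vel_l w) \_ `]0, T]), sqint (trace D (str_l w) \_ `]0, T]),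
      sqint (trace D (vel_r w) \_ `]0, T]) & sqint (trace D (str_r w) \_ `]0, T])].
Proof.
move=> T0; case: D => [_|b [bc _]].
  rewrite (_ : trace WholeLine (vel_l w) \_ _ = fun=> 0); first by split; exact: sqint0.
  by apply/funext => y; rewrite patchE; case: ifPn.
(* [boundary_conditions] speaks of open time intervals; the longer one contains the end point
   [T]. *)
have T1 : 0 < T + 1 by rewrite addr_gt0.
have [/L2_sqint h1 /L2_sqint h2 /L2_sqint h3 /L2_sqint h4] := bc _ T1.
have sub (f : R -> R) : sqint (f \_ `]0, T + 1[) -> sqint (f \_ `]0, T]).
  move=> sf; rewrite (_ : _ \_ _ = (f \_ `]0, T + 1[) \_ `]0, T]).
    by apply: sqint_restrict sf; exact: measurable_itv.
  apply/funext => y; rewrite !patchE; case: ifPn => //; rewrite inE/= in_itv/= => /andP[y0 yT].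
  by rewrite ifT// inE/= in_itv/= y0; lra.
by split; exact: sub.
Qed.

Lemma int0D (h k : R -> R) (t : R) : mu.-integrable `[0, t] (EFin \o h) ->
  mu.-integrable `[0, t] (EFin \o k) -> int0 (fun s => h s + k s) t = int0 h t + int0 k t.
Proof. by move=> hI kI; rewrite /int0 RintegralD. Qed.

Lemma int0B (h k : R -> R) (t : R) : mu.-integrable `[0, t] (EFin \o h) ->
  mu.-integrable `[0, t] (EFin \o k) -> int0 (fun s => h s - k s) t = int0 h t - int0 k t.
Proof. by move=> hI kI; rewrite /int0 RintegralB. Qed.

Lemma int0Z (h : R -> R) (a t : R) : mu.-integrable `[0, t] (EFin \o h) ->
  int0 (fun s => a * h s) t = a * int0 h t.
Proof. by move=> hI; rewrite /int0 RintegralZl. Qed.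

Variables (G : R) (D : domain R) (u0 tau0 : R -> R) (f : R -> R -> R) (xi1 xi2 : R).
Variables (w1 w2 : wave R).
Hypothesis G_gt0 : 0 < G.
Hypothesis D_adm : admissible G D.
Hypothesis f_L2 : forall T, 0 < T -> L2_spacetime T (Omega D) f.
Hypothesis w1_sol : damped_wave_solution G xi1 D u0 tau0 f w1.
Hypothesis w2_sol : damped_wave_solution G xi2 D u0 tau0 f w2.

Local Notation Om := (Omega D).
Definition dvel t : R -> R := (vel w1 t \_ Om) \- (vel w2 t \_ Om).
Definition dstr t : R -> R := (str w1 t \_ Om) \- (str w2 t \_ Om).
Definition dvel_l s : R := trace D (vel_l w1) s - trace D (vel_l w2) s.
Definition dvel_r s : R := trace D (vel_r w1) s - trace D (vel_r w2) s.
Definition dstr_l s : R := trace D (str_l w1) s - trace D (str_l w2) s.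
Definition dstr_r s : R := trace D (str_r w1) s - trace D (str_r w2) s.
Definition drelax t : R -> R :=
  (fun y => - xi1 * (str w1 t \_ Om) y) \- (fun y => - xi2 * (str w2 t \_ Om) y).
(* For [a = +/- sqrt G], the difference of the two [w^+] or of the two [w^-]. *)
Definition characteristic (a : R) t : R -> R := dstr t \+ (fun y => a * dvel t y).

Lemma continuous_curveB T u v : sqint_curve T u -> continuous_curve T u ->
  sqint_curve T v -> continuous_curve T v ->
  sqint_curve T (fun t => u t \- v t) /\ continuous_curve T (fun t : R => u t \- v t : R -> R).
Proof.
move=> su cu sv cv; split; first by move=> t tI; apply: sqintB; [exact: su|exact: sv].
move=> t tI e e0; have e2 : 0 < e / 2 by lra.
have [d1 d10 H1] := cu t tI _ e2; have [d2 d20 H2] := cv t tI _ e2.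
exists (Num.min d1 d2); first by rewrite lt_min d10.
move=> s sI; rewrite lt_min => /andP[st1 st2].
rewrite (_ : _ \- _ = (u s \- u t) \- (v s \- v t)); last by apply/funext => y /=; ring.
have sus := su s sI; have sut := su t tI; have svs := sv s sI; have svt := sv t tI.
apply: (le_lt_trans (nrmB (sqintB sus sut) (sqintB svs svt))).
by rewrite [e]splitr ltrD ?H1 ?H2.
Qed.

Lemma continuous_curveZ T a u : sqint_curve T u -> continuous_curve T u ->
  sqint_curve T (fun t y => a * u t y) /\ continuous_curve T (fun t y : R => a * u t y).
Proof.
move=> su cu; split; first by move=> t tI; apply: sqintZ; exact: su.
move=> t tI e e0; have a1 : 0 < `|a| + 1 by rewrite ltr_wpDl.
have [d d0 H] := cu t tI _ (divr_gt0 e0 a1).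
exists d => // s sI st; have := H s sI st; rewrite ltr_pdivlMr// => {}H.
rewrite (_ : _ \- _ = fun y => a * (u s \- u t) y); last by apply/funext => y /=; ring.
have sus := su s sI; have sut := su t tI.
rewrite nrmZ; last exact: sqintB.
by apply: le_lt_trans H; rewrite mulrC ler_wpM2l ?nrm_ge0// lerDl.
Qed.

Lemma balance_rate_integrable (p : R -> R -> R) (pl pr : R -> R) (r : R -> R -> R) phi T :
  test_function phi ->
  mu.-integrable `[0, T] (EFin \o trace D pl) -> mu.-integrable `[0, T] (EFin \o trace D pr) ->
  sqint_curve T (fun t => p t \_ Om) -> continuous_curve T (fun t => p t \_ Om) ->
  mu.-integrable `[0, T] (EFin \o (fun s => ip (r s \_ Om) phi)) ->
  mu.-integrable `[0, T] (EFin \o balance_rate D p pl pr r phi).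
Proof.
move=> tphi plI prI sp cp rI; have [sphi sphi'] := test_function_sqint tphi.
have mI : measurable (`[0, T]%classic : set (measurableTypeR R)) by exact: measurable_itv.
have cst a (g : R -> R) : mu.-integrable `[0, T] (EFin \o g) ->
    mu.-integrable `[0, T] (EFin \o (fun s => g s * a)).
  by move=> gI; apply: integrable_mul_continuous gI _ => x; exact: cvg_cst.
have I3 := ip_curve_integrable sp (fun t _ => sphi') cp (continuous_curve_cst (phi^`())%classic).
exact: (integrableD mI (integrableB mI (integrableB mI (cst _ _ prI) (cst _ _ plI)) I3) rI).
Qed.

Let vel_curve w xi : damped_wave_solution G xi D u0 tau0 f w -> forall T,
  sqint_curve T (fun t => vel w t \_ Om) /\ continuous_curve T (fun t => vel w t \_ Om).
Proof. by move=> [[h _] _ _ _ _] T; exact: L2_continuous_curve. Qed.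

Let str_curve w xi : damped_wave_solution G xi D u0 tau0 f w -> forall T,
  sqint_curve T (fun t => str w t \_ Om) /\ continuous_curve T (fun t => str w t \_ Om).
Proof. by move=> [[_ h] _ _ _ _] T; exact: L2_continuous_curve. Qed.

Let dvel_curve T : sqint_curve T dvel /\ continuous_curve T dvel.
Proof.
have [s1 c1] := vel_curve w1_sol T; have [s2 c2] := vel_curve w2_sol T.
exact: continuous_curveB.
Qed.

Let dstr_curve T : sqint_curve T dstr /\ continuous_curve T dstr.
Proof.
have [s1 c1] := str_curve w1_sol T; have [s2 c2] := str_curve w2_sol T.
exact: continuous_curveB.
Qed.

Let drelax_curve T : sqint_curve T drelax /\ continuous_curve T drelax.
Proof.
have [s1 c1] := str_curve w1_sol T; have [s2 c2] := str_curve w2_sol T.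
have [s1' c1'] := continuous_curveZ (- xi1) s1 c1.
have [s2' c2'] := continuous_curveZ (- xi2) s2 c2.
exact: continuous_curveB.
Qed.

Let traces_integrable w xi T : 0 < T -> damped_wave_solution G xi D u0 tau0 f w ->
  [/\ mu.-integrable `[0, T] (EFin \o trace D (vel_l w)),
      mu.-integrable `[0, T] (EFin \o trace D (str_l w)),
      mu.-integrable `[0, T] (EFin \o trace D (vel_r w)) &
      mu.-integrable `[0, T] (EFin \o trace D (str_r w))].
Proof.
move=> T0 [_ _ _ _ bc]; have [h1 h2 h3 h4] := traces_sqint T0 bc.
by split; exact: sqint_restrict_integrable1.
Qed.

Let vel_rate_integrable w xi phi T : 0 < T -> damped_wave_solution G xi D u0 tau0 f w ->
  test_function phi ->
  mu.-integrable `[0, T] (EFin \o balance_rate D (str w) (str_l w) (str_r w) f phi).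
Proof.
move=> T0 sol tphi; have [i1 i2 i3 i4] := traces_integrable T0 sol.
have [s c] := str_curve sol T.
apply: balance_rate_integrable => //.
by apply: spacetime_pairing_integrable => //; apply: f_L2; rewrite addr_gt0.
Qed.

Let str_rate_integrable w xi phi T : 0 < T -> damped_wave_solution G xi D u0 tau0 f w ->
  test_function phi ->
  mu.-integrable `[0, T] (EFin \o balance_rate D (fun t y => G * vel w t y)
        (fun t => G * vel_l w t) (fun t => G * vel_r w t)
        (fun t y => - xi * str w t y) phi).
Proof.
move=> T0 sol tphi; have [i1 i2 i3 i4] := traces_integrable T0 sol.
have [s c] := vel_curve sol T; have [s' c'] := continuous_curveZ G s c.
have [ss cs] := str_curve sol T; have [ss' cs'] := continuous_curveZ (- xi) ss cs.
have [sphi _] := test_function_sqint tphi.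
have mI : measurable (`[0, T]%classic : set (measurableTypeR R)) by exact: measurable_itv.
apply: balance_rate_integrable => //.
- by rewrite (_ : trace D _ = fun s => G * trace D (vel_l w) s);
    [exact: (integrableZl mI G i1)|apply/funext => x; exact: trace_mul].
- by rewrite (_ : trace D _ = fun s => G * trace D (vel_r w) s);
    [exact: (integrableZl mI G i3)|apply/funext => x; exact: trace_mul].
- by move=> t tI; rewrite restrictZ; exact: s'.
- by rewrite (_ : (fun t => _) = (fun t y => G * (vel w t \_ Om) y))//;
    apply/funext => t; exact: restrictZ.
- rewrite (_ : (fun s => _) = fun s => ip (fun y => - xi * (str w s \_ Om) y) phi).
    exact: ip_curve_integrable ss' (fun t _ => sphi) cs' (continuous_curve_cst phi).
  by apply/funext => x; rewrite restrictZ.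
Qed.

(** The source [f] cancels under the integral sign; merging the two time integrals requires each
    rate to be integrable. *)
Let dvel_balance phi t : test_function phi -> 0 < t ->
  ip (dvel t) phi - ip (dvel 0) phi =
  int0 (fun s => dstr_r s * phi (right_end D) - dstr_l s * phi (left_end D)
    - ip (dstr s) (phi^`())%classic) t.
Proof.
move=> tphi t0; have [sphi sphi'] := test_function_sqint tphi.
have [_ _ wb1 _ _] := w1_sol; have [_ _ wb2 _ _] := w2_sol.
have E1 := weak_balanceE wb1 tphi (ltW t0); have E2 := weak_balanceE wb2 tphi (ltW t0).
have I1 := vel_rate_integrable t0 w1_sol tphi; have I2 := vel_rate_integrable t0 w2_sol tphi.
have tI : 0 <= t <= t by rewrite ltW//=. have oI : 0 <= (0 : R) <= t by rewrite lexx ltW.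
have [s1 _] := vel_curve w1_sol t; have [s2 _] := vel_curve w2_sol t.
rewrite (ipBl (s1 _ tI) (s2 _ tI) sphi) (ipBl (s1 _ oI) (s2 _ oI) sphi).
have -> : ip (vel w1 t \_ Om) phi - ip (vel w2 t \_ Om) phi -
    (ip (vel w1 0 \_ Om) phi - ip (vel w2 0 \_ Om) phi) =
    (ip (vel w1 t \_ Om) phi - ip (vel w1 0 \_ Om) phi) -
    (ip (vel w2 t \_ Om) phi - ip (vel w2 0 \_ Om) phi) by ring.
rewrite E1 E2 -(int0B I1 I2); apply: eq_Rintegral => s; rewrite inE/= in_itv/= => sI.
have [c1 _] := str_curve w1_sol t; have [c2 _] := str_curve w2_sol t.
by rewrite /balance_rate (ipBl (c1 _ sI) (c2 _ sI) sphi') /dstr_r /dstr_l; ring.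
Qed.

Let dstr_balance phi t : test_function phi -> 0 < t ->
  ip (dstr t) phi - ip (dstr 0) phi =
  int0 (fun s => G * (dvel_r s * phi (right_end D) - dvel_l s * phi (left_end D))
    - G * ip (dvel s) (phi^`())%classic + ip (drelax s) phi) t.
Proof.
move=> tphi t0; have [sphi sphi'] := test_function_sqint tphi.
have [_ _ _ wb1 _] := w1_sol; have [_ _ _ wb2 _] := w2_sol.
have E1 := weak_balanceE wb1 tphi (ltW t0); have E2 := weak_balanceE wb2 tphi (ltW t0).
have I1 := str_rate_integrable t0 w1_sol tphi; have I2 := str_rate_integrable t0 w2_sol tphi.
have tI : 0 <= t <= t by rewrite ltW//=. have oI : 0 <= (0 : R) <= t by rewrite lexx ltW.
have [s1 _] := str_curve w1_sol t; have [s2 _] := str_curve w2_sol t.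
rewrite (ipBl (s1 _ tI) (s2 _ tI) sphi) (ipBl (s1 _ oI) (s2 _ oI) sphi).
have -> : ip (str w1 t \_ Om) phi - ip (str w2 t \_ Om) phi -
    (ip (str w1 0 \_ Om) phi - ip (str w2 0 \_ Om) phi) =
    (ip (str w1 t \_ Om) phi - ip (str w1 0 \_ Om) phi) -
    (ip (str w2 t \_ Om) phi - ip (str w2 0 \_ Om) phi) by ring.
rewrite E1 E2 -(int0B I1 I2); apply: eq_Rintegral => s; rewrite inE/= in_itv/= => sI.
have [c1 _] := vel_curve w1_sol t; have [c2 _] := vel_curve w2_sol t.
have c1s := c1 _ sI; have c2s := c2 _ sI; have d1s := s1 _ sI; have d2s := s2 _ sI.
rewrite /balance_rate !restrictZ !trace_mul (ipZl G c1s sphi') (ipZl G c2s sphi').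
rewrite (ipBl c1s c2s sphi') (ipBl (sqintZ (- xi1) d1s) (sqintZ (- xi2) d2s) sphi).
by rewrite /dvel_r /dvel_l; ring.
Qed.

Let characteristic_curve a T :
  sqint_curve T (characteristic a) /\ continuous_curve T (characteristic a).
Proof.
have [s1 c1] := dvel_curve T; have [s2 c2] := dstr_curve T.
have [s1' c1'] := continuous_curveZ (- a) s1 c1.
have [h1 h2] := continuous_curveB s2 c2 s1' c1'.
rewrite (_ : characteristic a = fun t : R => dstr t \- (fun y => - a * dvel t y)); first by [].
by apply/funext => t; apply/funext => y; rewrite /characteristic /=; ring.
Qed.

Let diff_traces_integrable T : 0 < T ->
  [/\ mu.-integrable `[0, T] (EFin \o dvel_l), mu.-integrable `[0, T] (EFin \o dstr_l),
      mu.-integrable `[0, T] (EFin \o dvel_r) & mu.-integrable `[0, T] (EFin \o dstr_r)].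
Proof.
move=> T0; have [a1 a2 a3 a4] := traces_integrable T0 w1_sol.
have [b1 b2 b3 b4] := traces_integrable T0 w2_sol.
have mI : measurable (`[0, T]%classic : set (measurableTypeR R)) by exact: measurable_itv.
split; [exact: (integrableB mI a1 b1)|exact: (integrableB mI a2 b2)
  |exact: (integrableB mI a3 b3)|exact: (integrableB mI a4 b4)].
Qed.

Lemma diff_traces_sqint T : 0 < T ->
  [/\ sqint (dvel_l \_ `]0, T]), sqint (dstr_l \_ `]0, T]), sqint (dvel_r \_ `]0, T]) &
      sqint (dstr_r \_ `]0, T])].
Proof.
move=> T0; have [_ _ _ _ bc1] := w1_sol; have [_ _ _ _ bc2] := w2_sol.
have [a1 a2 a3 a4] := traces_sqint T0 bc1; have [b1 b2 b3 b4] := traces_sqint T0 bc2.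
have E (g h : R -> R) : (fun s => g s - h s) \_ `]0, T] =
    (g \_ `]0, T]) \- (h \_ `]0, T]) by exact: restrictB.
by split; rewrite E; apply: sqintB.
Qed.

(** The condition [a ^+ 2 = G] makes the flux [G u + a tau] equal to [a (tau + a u)], so the two
    balances merge into one transport equation with velocity [- a]. *)
Let characteristic_balance a phi t : a ^+ 2 = G -> test_function phi -> 0 <= t ->
  ip (characteristic a t) phi - ip (characteristic a 0) phi =
  int0 (fun s => a * ((dstr_r s + a * dvel_r s) * phi (right_end D)
                      - (dstr_l s + a * dvel_l s) * phi (left_end D))
    + - a * ip (characteristic a s) (phi^`())%classic + ip (drelax s) phi) t.
Proof.
move=> aG tphi; rewrite le_eqVlt => /orP[/eqP <-|t0]; first by rewrite int00 subrr.
have [sphi sphi'] := test_function_sqint tphi.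
have tI : 0 <= t <= t by rewrite ltW//=. have oI : 0 <= (0 : R) <= t by rewrite lexx ltW.
have [sU cU] := dvel_curve t; have [sS cS] := dstr_curve t; have [sx cx] := drelax_curve t.
have mI : measurable (`[0, t]%classic : set (measurableTypeR R)) by exact: measurable_itv.
have [i1 i2 i3 i4] := diff_traces_integrable t0.
have cst b (g : R -> R) : mu.-integrable `[0, t] (EFin \o g) ->
    mu.-integrable `[0, t] (EFin \o (fun s => g s * b)).
  by move=> gI; apply: integrable_mul_continuous gI _ => x; exact: cvg_cst.
have J1 := ip_curve_integrable sU (fun t _ => sphi') cU (continuous_curve_cst (phi^`())%classic).
have J2 := ip_curve_integrable sS (fun t _ => sphi') cS (continuous_curve_cst (phi^`())%classic).
have J3 := ip_curve_integrable sx (fun t _ => sphi) cx (continuous_curve_cst phi).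
have IU : mu.-integrable `[0, t] (EFin \o (fun s =>
    dstr_r s * phi (right_end D) - dstr_l s * phi (left_end D)
    - ip (dstr s) (phi^`())%classic)).
  exact: (integrableB mI (integrableB mI (cst _ _ i4) (cst _ _ i2)) J2).
have IS : mu.-integrable `[0, t] (EFin \o (fun s =>
    G * (dvel_r s * phi (right_end D) - dvel_l s * phi (left_end D))
    - G * ip (dvel s) (phi^`())%classic + ip (drelax s) phi)).
  exact: (integrableD mI (integrableB mI (integrableZl mI G
    (integrableB mI (cst _ _ i3) (cst _ _ i1)))
    (integrableZl mI G J1)) J3).
rewrite /characteristic (ipDl (sS _ tI) (sqintZ a (sU _ tI)) sphi)
  (ipDl (sS _ oI) (sqintZ a (sU _ oI)) sphi).
rewrite (ipZl a (sU _ tI) sphi) (ipZl a (sU _ oI) sphi).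
have -> : ip (dstr t) phi + a * ip (dvel t) phi - (ip (dstr 0) phi + a * ip (dvel 0) phi) =
  (ip (dstr t) phi - ip (dstr 0) phi) + a * (ip (dvel t) phi - ip (dvel 0) phi) by ring.
rewrite (dstr_balance tphi t0) (dvel_balance tphi t0) -(int0Z a IU)
  -(int0D IS (integrableZl mI a IU)).
apply: eq_Rintegral => s; rewrite inE/= in_itv/= => sI.
rewrite (ipDl (sS _ sI) (sqintZ a (sU _ sI)) sphi') (ipZl a (sU _ sI) sphi') -aG; ring.
Qed.

(** The initial data agree only almost everywhere, hence a statement about the norm. *)
Let initial_zero a : ip (characteristic a 0) (characteristic a 0) = 0.
Proof.
have [_ i1 _ _ _] := w1_sol; have [_ i2 _ _ _] := w2_sol.
have [sW _] := characteristic_curve a 0.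
have sW0 : sqint (characteristic a 0) by apply: sW; rewrite lexx.
rewrite /ip /Rintegral (ae_eq_integral (cst 0%E)) ?integral0//.
  exact: (measurable_int mu (sqint_integrableM sW0 sW0)).
move: i1 i2; apply: filterS2; first exact: (ae_filter_ringOfSetsType mu).
move=> y h1 h2 _ /=.
suff -> : characteristic a 0 y = 0 by rewrite mul0r.
rewrite /characteristic /dstr /dvel /= !patchE; case: ifPn => [|_]; last by ring.
rewrite inE => yO; have [-> ->] := h1 yO; have [-> ->] := h2 yO; ring.
Qed.

(** The velocity is [- a]: for positive [a] the wave enters at the right end and leaves at the left
    end, for negative [a] the reverse. In both cases the fluxes combine into the same formula. *)
Lemma characteristic_energy a T : a ^+ 2 = G -> 0 < T ->
  ip (characteristic a T) (characteristic a T) =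
  int0 (fun s => a * ((dstr_r s + a * dvel_r s) ^+ 2 - (dstr_l s + a * dvel_l s) ^+ 2)
                 + 2 * ip (drelax s) (characteristic a s)) T.
Proof.
move=> aG T0; have a0 : a != 0 by apply: contraTneq G_gt0 => a0; rewrite -aG a0 expr0n ltxx.
have [i1 i2 i3 i4] := diff_traces_integrable T0.
have [q1 q2 q3 q4] := diff_traces_sqint T0.
have mI : measurable (`[0, T]%classic : set (measurableTypeR R)) by exact: measurable_itv.
have [sW cW] := characteristic_curve a T; have [sx cx] := drelax_curve T.
pose gr s := dstr_r s + a * dvel_r s; pose gl s := dstr_l s + a * dvel_l s.
have grI : mu.-integrable `[0, T] (EFin \o gr) by exact: (integrableD mI i4 (integrableZl mI a i3)).
have glI : mu.-integrable `[0, T] (EFin \o gl) by exact: (integrableD mI i2 (integrableZl mI a i1)).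
have E (g h : R -> R) : (fun s => g s + a * h s) \_ `]0, T] =
    (g \_ `]0, T]) \+ (fun s => a * (h \_ `]0, T]) s).
  by apply/funext => y; rewrite /= !patchE; case: ifPn => // _; rewrite mulr0 addr0.
have grS : sqint (gr \_ `]0, T]) by rewrite /gr E; apply: sqintD => //; exact: sqintZ.
have glS : sqint (gl \_ `]0, T]) by rewrite /gl E; apply: sqintD => //; exact: sqintZ.
have characteristic_supp t y : ~ Om y -> characteristic a t y = 0.
  by move=> yO; rewrite /characteristic /dstr /dvel /= !patchE;
    case: ifPn => [/set_mem /yO []|_]; ring.
have x_supp t y : ~ Om y -> drelax t y = 0.
  by move=> yO; rewrite /drelax /= !patchE; case: ifPn => [/set_mem /yO []|_]; rewrite !mulr0 subrr.
(* On the whole line both traces are zero; on an interval, the order of the end points places the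
   stored data where the gluing conditions require them. *)
have geo : (forall s, gr s = 0 /\ gl s = 0) \/
    (left_end D < right_end D /\ forall y, Om y -> left_end D < y < right_end D).
  rewrite /gr /gl /dstr_r /dstr_l /dvel_r /dvel_l; move: D_adm.
  case: (D) => [_|b /= [lr _ _ _]].
    by left=> s /=; split; ring.
  by right; split => // y; rewrite in_itv.
have [ap|aN] := ltP 0 a.
  have H : weak_transport T (- a) `|- a| (right_end D) (left_end D) (characteristic a) drelax gr gl.
    split => // phi tphi t /andP[t0 _]; rewrite (characteristic_balance aG tphi t0).
    by apply: eq_Rintegral => s _; rewrite normrN (gtr0_norm ap).
  have aN0 : - a != 0 by rewrite oppr_eq0.
  have E1 s t : t < s -> Om (right_end D - - a * (s - t)) -> gr s = 0.
    move=> ts; case: geo => [z _|[lr O] /O /andP[_ h]]; first by have [] := z s.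
    have ts0 : 0 < s - t by rewrite subr_gt0.
    by have := mulr_gt0 ap ts0; lra.
  have E2 s t : s < t -> Om (left_end D + - a * (t - s)) -> gl s = 0.
    move=> ts; case: geo => [z _|[lr O] /O /andP[h _]]; first by have [] := z s.
    have ts0 : 0 < t - s by rewrite subr_gt0.
    by have := mulr_gt0 ap ts0; lra.
  have E3 s s' : s' < s -> right_end D - - a * s = left_end D - - a * s' -> gr s * gl s' = 0.
    move=> ts; case: geo => [z _|[lr O] h]; first by have [-> _] := z s; rewrite mul0r.
    have ts0 : 0 < s - s' by rewrite subr_gt0.
    by have := mulr_gt0 ap ts0; lra.
  have := transport_energy (ltW T0) aN0 H grS glS characteristic_supp x_supp E1 E2 E3.
  by rewrite initial_zero subr0 normrN (gtr0_norm ap).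
have {}aN : a < 0 by rewrite lt_neqAle a0.
have H : weak_transport T (- a) `|- a| (left_end D) (right_end D) (characteristic a) drelax gl gr.
  split => // phi tphi t /andP[t0 _]; rewrite (characteristic_balance aG tphi t0).
  by apply: eq_Rintegral => s _; rewrite normrN (ltr0_norm aN) /gl /gr; ring.
have aN0 : - a != 0 by rewrite oppr_eq0.
have ap : 0 < - a by rewrite oppr_gt0.
have E1 s t : t < s -> Om (left_end D - - a * (s - t)) -> gl s = 0.
  move=> ts; case: geo => [z _|[lr O] /O /andP[h _]]; first by have [] := z s.
  have ts0 : 0 < s - t by rewrite subr_gt0.
  by have := mulr_gt0 ap ts0; lra.
have E2 s t : s < t -> Om (right_end D + - a * (t - s)) -> gr s = 0.
  move=> ts; case: geo => [z _|[lr O] /O /andP[_ h]]; first by have [] := z s.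
  have ts0 : 0 < t - s by rewrite subr_gt0.
  by have := mulr_gt0 ap ts0; lra.
have E3 s s' : s' < s -> left_end D - - a * s = right_end D - - a * s' -> gl s * gr s' = 0.
  move=> ts; case: geo => [z _|[lr O] h]; first by have [_ ->] := z s; rewrite mul0r.
  have ts0 : 0 < s - s' by rewrite subr_gt0.
  by have := mulr_gt0 ap ts0; lra.
have := transport_energy (ltW T0) aN0 H glS grS characteristic_supp x_supp E1 E2 E3.
rewrite initial_zero subr0 normrN (ltr0_norm aN) => ->.
by apply: eq_Rintegral => s _; rewrite /gl /gr; ring.
Qed.

(** The half-sum over [a = +/- sqrt G] of the rates in [characteristic_energy]: the squared traces
    cancel and leave the products [2 G u tau]. *)
Definition energy_rate s : R :=
  2 * G * (dvel_r s * dstr_r s - dvel_l s * dstr_l s) + 2 * ip (drelax s) (dstr s).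

Lemma energy_rate_integrable T : 0 < T -> mu.-integrable `[0, T] (EFin \o energy_rate).
Proof.
move=> T0; have [q1 q2 q3 q4] := diff_traces_sqint T0.
have mI : measurable (`[0, T]%classic : set (measurableTypeR R)) by exact: measurable_itv.
have [sS cS] := dstr_curve T; have [sx cx] := drelax_curve T.
exact: (integrableD mI (integrableZl mI (2 * G)
    (integrableB mI (sqint_restrict_integrableM q3 q4) (sqint_restrict_integrableM q1 q2)))
  (integrableZl mI 2 (ip_curve_integrable sx sS cx cS))).
Qed.

Let characteristic_rate_integrable a T : 0 < T -> mu.-integrable `[0, T]
  (EFin \o (fun s => a * ((dstr_r s + a * dvel_r s) ^+ 2 - (dstr_l s + a * dvel_l s) ^+ 2)
                 + 2 * ip (drelax s) (characteristic a s))).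
Proof.
move=> T0; have [q1 q2 q3 q4] := diff_traces_sqint T0.
have E (g h : R -> R) : (fun s => g s + a * h s) \_ `]0, T] =
    (g \_ `]0, T]) \+ (fun s => a * (h \_ `]0, T]) s).
  by apply/funext => y; rewrite /= !patchE; case: ifPn => // _; rewrite mulr0 addr0.
have sq (g h : R -> R) : sqint (g \_ `]0, T]) -> sqint (h \_ `]0, T]) ->
    mu.-integrable `[0, T] (EFin \o (fun s => (g s + a * h s) ^+ 2)).
  by move=> sg sh; apply: sqint_restrict_integrable; rewrite E; apply: sqintD => //; exact: sqintZ.
have mI : measurable (`[0, T]%classic : set (measurableTypeR R)) by exact: measurable_itv.
have [sW cW] := characteristic_curve a T; have [sx cx] := drelax_curve T.
exact: (integrableD mI (integrableZl mI a (integrableB mI (sq _ _ q4 q3) (sq _ _ q2 q1)))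
  (integrableZl mI 2 (ip_curve_integrable sx sW cx cW))).
Qed.

(** Adding the two characteristic energies removes the cross term in [ip (dstr T) (dvel T)]. *)
Lemma energy_identity T : 0 <= T ->
  ip (dstr T) (dstr T) + G * ip (dvel T) (dvel T) = int0 energy_rate T.
Proof.
move=> T0; pose a := Num.sqrt G.
have a2 : a ^+ 2 = G by rewrite sqr_sqrtr// ltW.
have a2' : (- a) ^+ 2 = G by rewrite sqrrN.
have TI : 0 <= T <= T by rewrite T0/=.
have [sU _] := dvel_curve T; have [sS _] := dstr_curve T.
have sUT := sU _ TI; have sST := sS _ TI.
have WW b : ip (characteristic b T) (characteristic b T) =
    ip (dstr T) (dstr T) + 2 * b * ip (dstr T) (dvel T) + b ^+ 2 * ip (dvel T) (dvel T).
  have sbU := sqintZ b sUT.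
  rewrite /characteristic (ipDl sST sbU (sqintD sST sbU)) (ipDr sST sbU sST) (ipDr sST sbU sbU).
  by rewrite (ipZl b sUT sST) (ipZl b sUT sbU) !(ipZr b sUT) // (ipC (dvel T) (dstr T)); ring.
have -> : ip (dstr T) (dstr T) + G * ip (dvel T) (dvel T) =
    2^-1 * (ip (characteristic a T) (characteristic a T)
            + ip (characteristic (- a) T) (characteristic (- a) T)).
  by rewrite !WW a2 a2'; field.
move: T0; rewrite le_eqVlt => /orP[/eqP T0|T0].
  by rewrite -T0 !initial_zero int00 addr0 mulr0.
rewrite (characteristic_energy a2 T0) (characteristic_energy a2' T0).
rewrite -(int0D (characteristic_rate_integrable a T0) (characteristic_rate_integrable (- a) T0)).
have mI : measurable (`[0, T]%classic : set (measurableTypeR R)) by exact: measurable_itv.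
have I := integrableD mI (characteristic_rate_integrable a T0)
  (characteristic_rate_integrable (- a) T0).
rewrite -(int0Z 2^-1 I); apply: eq_Rintegral => s; rewrite inE/= in_itv/= => sI.
have [sx _] := drelax_curve T; have sUs := sU _ sI; have sSs := sS _ sI; have sxs := sx _ sI.
rewrite /energy_rate /characteristic !(ipDr sSs (sqintZ _ sUs) sxs) !(ipZr _ sUs sxs) -a2.
by field.
Qed.

Lemma str_sqint t : 0 <= t -> sqint (str w1 t \_ Om) /\ sqint (str w2 t \_ Om).
Proof.
move=> t0; have tI : 0 <= t <= t by rewrite t0/=.
by split; [exact: (str_curve w1_sol t).1|exact: (str_curve w2_sol t).1].
Qed.

Lemma difference_sqint t : 0 <= t -> sqint (dvel t) /\ sqint (dstr t).
Proof.
move=> t0; have tI : 0 <= t <= t by rewrite t0/=.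
by split; [exact: (dvel_curve t).1|exact: (dstr_curve t).1].
Qed.

(** Symmetrisation: [xi1 tau1 - xi2 tau2] is the half-sum of [(xi1 + xi2) (tau1 - tau2)] and
    [(xi1 - xi2) (tau1 + tau2)]; paired with [tau1 - tau2], the second part becomes a difference of
    squares. *)
Lemma relaxation_work t : 0 <= t -> 2 * ip (drelax t) (dstr t) =
  (xi1 - xi2) * (ip (str w2 t \_ Om) (str w2 t \_ Om) - ip (str w1 t \_ Om) (str w1 t \_ Om))
  - (xi1 + xi2) * ip (dstr t) (dstr t).
Proof.
move=> t0; have [s1 s2] := str_sqint t0; have sS := sqintB s1 s2.
have z1 := sqintZ (- xi1) s1; have z2 := sqintZ (- xi2) s2.
rewrite /drelax /dstr (ipBl z1 z2 sS) (ipZl _ s1 sS) (ipZl _ s2 sS) (ipBl s1 s2 sS).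
rewrite (ipBr s1 s2 s1) (ipBr s1 s2 s2) (ipC (str w2 t \_ Om) (str w1 t \_ Om)); ring.
Qed.

Lemma str_square_integrable T : mu.-integrable `[0, T]
  (EFin \o (fun t => ip (str w2 t \_ Om) (str w2 t \_ Om))).
Proof. by have [s c] := str_curve w2_sol T; exact: ip_curve_integrable. Qed.

End difference_of_solutions.

(** * Derivative of the energy and boundary dissipation *)

Section conclusions.
Variable R : realType.
Notation mu := (@lebesgue_measure R).

(** Lebesgue differentiation up to each time [n + 1], then a countable union of null sets.
    Truncating [h] makes it integrable on the whole line, without changing its integral near a
    positive [t] below [n + 1]. *)
Lemma int0_ae_derivable (h : R -> R) :
  (forall T : R, 0 < T -> mu.-integrable `[0, T] (EFin \o h)) ->
  {ae mu, forall t : R, 0 < t -> derivable (int0 h) t 1 /\ ((int0 h)^`())%classic t = h t}.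
Proof.
move=> hI.
have step (n : nat) : {ae mu, forall t : R, 0 < t -> t < n.+1%:R ->
    derivable (int0 h) t 1 /\ ((int0 h)^`())%classic t = h t}.
  have n0 : (0 : R) < n.+1%:R by rewrite ltr0n.
  pose hn := h \_ `[0, n.+1%:R].
  have mI : measurable (`[0, n.+1%:R]%classic : set (measurableTypeR R)) by exact: measurable_itv.
  have loc := integrable_locally mI (hI _ n0).
  have hnI : mu.-integrable setT (EFin \o hn).
    by rewrite -restrict_EFin; apply/(integrable_mkcond _ mI); exact: hI.
  have hnIy (y : R) : mu.-integrable [set` Interval (BLeft 0) (BRight y)] (EFin \o hn).
    by apply: integrableS hnI.
  have := FTC1 hnIy loc; apply: filterS; first exact: (ae_filter_ringOfSetsType mu).
  move=> t ht t0 tn.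
  have [|d dE] := ht _; first by rewrite /= lte_fin.
  have nearE : \forall x \near t,
      (fun x => \int[mu]_(s in [set` Interval (BLeft 0) (BRight x)]) hn s) x = int0 h x.
    have : \forall x \near t, x < n.+1%:R by exact: lt_nbhsl.
    apply: filterS => x xn; apply: eq_Rintegral => s; rewrite inE/= in_itv/= => /andP[s0 sx].
    by rewrite /hn patchE ifT// inE/= in_itv/= s0 (le_trans sx)// ltW.
  split; first exact: near_eq_derivable nearE d.
  rewrite -[h t](_ : hn t = _).
    by rewrite -dE !derive1E; apply: near_eq_derive; apply: filterS nearE => x ->.
  by rewrite /hn patchE ifT// inE/= in_itv/= !ltW.
have /ae_foralln := step.
by apply: filterS => t H t0; exact: (H _ t0 (truncnS_gt t)).
Qed.

(** [e] is known only at nonnegative times, so its derivative is identified at positive times, near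
    which the two functions coincide. *)
Lemma locally_absolutely_continuous_int0 (e h : R -> R) :
  (forall T : R, 0 < T -> mu.-integrable `[0, T] (EFin \o h)) ->
  (forall t, 0 <= t -> e t = int0 h t) ->
  locally_absolutely_continuous e /\
  {ae mu, forall t, 0 < t -> (e^`())%classic t = h t}.
Proof.
move=> hI eE.
have nearE (t : R) : 0 < t -> \forall x \near t, int0 h x = e x.
  move=> t0; have : \forall x \near t, 0 < x by exact: lt_nbhsr.
  by apply: filterS => x x0; rewrite eE// ltW.
have D := int0_ae_derivable hI.
split; first split.
- move: D; apply: filterS; first exact: (ae_filter_ringOfSetsType mu).
  move=> t H t0; have [d _] := H t0.
  exact: near_eq_derivable (nearE t t0) d.
- exists h; split => // t t0; rewrite (eE 0)// int00 add0r; exact: eE.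
- move: D; apply: filterS; first exact: (ae_filter_ringOfSetsType mu).
  move=> t H t0; have [_ <-] := H t0.
  by rewrite !derive1E; apply: near_eq_derive; apply: filterS (nearE t t0) => x ->.
Qed.

Lemma ae_le_int0 (f g : R -> R) (T : R) : 0 <= T ->
  mu.-integrable `[0, T] (EFin \o f) -> mu.-integrable `[0, T] (EFin \o g) ->
  {ae mu, forall t, 0 < t -> f t <= g t} -> int0 f T <= int0 g T.
Proof.
move=> T0 fI gI fg.
have sub : `]0, T]%classic `<=` `[0, T] by apply: subset_itv; rewrite bnd_simp.
have mI : measurable (`]0, T]%classic : set (measurableTypeR R)) by exact: measurable_itv.
have mI0 : measurable (`[0, T]%classic : set (measurableTypeR R)) by exact: measurable_itv.
have fI' := integrableS mI0 mI sub fI.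
have gI' := integrableS mI0 mI sub gI.
rewrite /int0 -(Rintegral_itv_obnd_cbnd fI') -(Rintegral_itv_obnd_cbnd gI').
rewrite -subr_ge0 -(RintegralB mI gI' fI').
have md := measurable_int mu (integrableB mI gI' fI').
(* Almost everywhere the difference equals its positive part, which is nonnegative at every
   point. *)
have -> : \int[mu]_(x in `]0, T]) (g x - f x) = \int[mu]_(x in `]0, T]) Num.max 0 (g x - f x).
  congr fine; apply: ae_eq_integral => //.
    apply/measurable_EFinP/measurable_maxr; first exact: measurable_cst.
    exact/measurable_EFinP.
  move: fg; apply: filterS; first exact: (ae_filter_ringOfSetsType mu).
  move=> x H; rewrite /= in_itv/= => /andP[x0 _].
  by rewrite max_r// subr_ge0 H.
by apply: Rintegral_ge0 => x _; rewrite le_max lexx.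
Qed.

(** The squared norm is at most linear in [x - a]. No sign is known for [K], whence [|K| + 1] in the
    radius. *)
Lemma cvg_to_zero (F : R -> \bar R) (n : R -> R) (a K : R) :
  (forall x, a <= x -> [/\ F x = (n x)%:E, 0 <= n x & n x ^+ 2 <= (x - a) * K]) ->
  F x @[x --> within [set x | a <= x] (nbhs a)] --> 0%E.
Proof.
move=> H.
apply: (@cvg_trans _ ((EFin \o n) x @[x --> within [set x | a <= x] (nbhs a)])).
  apply: near_eq_cvg; apply: filterS (withinT [set x | a <= x] (nbhs_filter a)) => x /= ax.
  by have [-> _ _] := H x ax.
apply: cvg_EFin; first by apply: nearW.
apply/cvgrPdist_lt => e e0; apply/nbhs_ballP => /=.
have K1 : 0 < `|K| + 1 by rewrite ltr_wpDl.
exists (e ^+ 2 / (`|K| + 1)); first by rewrite /= divr_gt0// exprn_gt0.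
move=> x; rewrite /ball /= distrC ltr_pdivlMr// => xa ax.
have [_ n0 n2] := H x ax.
rewrite sub0r normrN ger0_norm// -(@ltr_pXn2r _ 2)// ?nnegrE ?(ltW e0)//.
apply: le_lt_trans n2 _; apply: le_lt_trans xa.
have x0 : 0 <= x - a by rewrite subr_ge0.
rewrite (ger0_norm x0) ler_wpM2l// (le_trans (ler_norm K))// lerDl//.
Qed.

(** Under a homogeneous boundary condition the two traces are proportional, so [- (u * s)] is a
    positive multiple of the square of each and controls both. *)
Lemma dissipation_identity (c1 c2 u s : R) : 0 < c1 * c2 -> c1 * u + c2 * s = 0 ->
  [/\ 0 < c1 / c2, 0 < c2 / c1, c1 / c2 * u ^+ 2 = - (u * s) & c2 / c1 * s ^+ 2 = - (u * s)].
Proof.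
move=> cc E.
have c1n : c1 != 0 by apply: contraTneq cc => ->; rewrite mul0r ltxx.
have c2n : c2 != 0 by apply: contraTneq cc => ->; rewrite mulr0 ltxx.
have p1 : 0 < c1 / c2.
  have -> : c1 / c2 = c1 * c2 * c2^-1 ^+ 2 by field.
  by rewrite mulr_gt0// exprn_even_gt0//= invr_eq0.
have p2 : 0 < c2 / c1 by rewrite -[c2 / c1]invrK invf_div invr_gt0.
have Es : s = - (c1 / c2 * u).
  by apply: (mulfI c2n); move/eqP: E; rewrite addrC addr_eq0 => /eqP ->; field.
split => //; rewrite Es; field; by rewrite ?c1n ?c2n.
Qed.

(** As [(c1 u - c2 t)^2 = (c1 u + c2 t)^2 - 4 c1 c2 u t], the homogeneous condition leaves only the
    product, and the coefficient [G / (2 c1 c2)] turns it into [2 G u t] up to sign. *)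
Lemma boundary_dissipationE (G : R) (b : interval_problem R) (w1 w2 : wave R) (s : R) :
  let u1 := vel_l w1 s - vel_l w2 s in let s1 := str_l w1 s - str_l w2 s in
  let u2 := vel_r w1 s - vel_r w2 s in let s2 := str_r w1 s - str_r w2 s in
  cul b * ctaul b != 0 -> cur b * ctaur b != 0 ->
  cul b * u1 + ctaul b * s1 = 0 -> cur b * u2 + ctaur b * s2 = 0 ->
  boundary_dissipation G (BoundedInterval b) w1 w2 s = 2 * G * (u1 * s1 - u2 * s2).
Proof.
move=> u1 s1 u2 s2 cl cr El Er; rewrite /boundary_dissipation !real_normK ?num_real//.
have sq (c1 c2 u t : R) : c1 * u + c2 * t = 0 ->
    (c1 * u - c2 * t) ^+ 2 = - (4 * (c1 * c2) * (u * t)).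
  move=> E; have -> : (c1 * u - c2 * t) ^+ 2 =
      (c1 * u + c2 * t) ^+ 2 - 4 * (c1 * c2) * (u * t) by ring.
  by rewrite E expr0n sub0r.
have -> : zplus_l b w1 s - zplus_l b w2 s = cul b * u1 - ctaul b * s1.
  by rewrite /zplus_l /u1 /s1; ring.
have -> : zminus_r b w1 s - zminus_r b w2 s = cur b * u2 - ctaur b * s2.
  by rewrite /zminus_r /u2 /s2; ring.
rewrite (sq _ _ _ _ El) (sq _ _ _ _ Er) -!mulrA.
clearbody u1 s1 u2 s2; field.
by move: cl cr; rewrite !mulf_eq0 !negb_or => /andP[-> ->] /andP[-> ->].
Qed.

(* The smallest of the ratios, given by the homogeneous boundary conditions,
   between an energy flux and the square of a trace. *)
Definition trace_rate (G : R) (b : interval_problem R) : R :=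
  2 * G * Num.min (Num.min (cul b / - ctaul b) (- ctaul b / cul b))
                  (Num.min (cur b / ctaur b) (ctaur b / cur b)).

(** * Estimates of the difference in terms of the second solution *)

Section two_solutions.
Variables (G : R) (D : domain R) (u0 tau0 : R -> R) (f : R -> R -> R) (xi1 xi2 : R).
Variables (w1 w2 : wave R).
Hypothesis G_gt0 : 0 < G.
Hypothesis D_adm : admissible G D.
Hypothesis f_L2 : forall T, 0 < T -> L2_spacetime T (Omega D) f.
Hypothesis w1_sol : damped_wave_solution G xi1 D u0 tau0 f w1.
Hypothesis w2_sol : damped_wave_solution G xi2 D u0 tau0 f w2.
Hypothesis xi12 : xi2 <= xi1.
Hypothesis xi2_ge0 : 0 <= xi2.

Local Notation Om := (Omega D).
Local Notation rate := (energy_rate G D xi1 xi2 w1 w2).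
Local Notation damping s := ((xi1 - xi2) * ip (str w2 s \_ Om) (str w2 s \_ Om)).

(** On the whole line the quantifier over [b] is vacuous, which gives one statement for both kinds
    of domains. *)
Lemma boundary_conditions_difference : {ae mu, forall s, 0 < s ->
  forall b, D = BoundedInterval b ->
    cul b * dvel_l D w1 w2 s + ctaul b * dstr_l D w1 w2 s = 0 /\
    cur b * dvel_r D w1 w2 s + ctaur b * dstr_r D w1 w2 s = 0}.
Proof.
have [_ _ _ _] := w1_sol; have [_ _ _ _] := w2_sol.
rewrite /dvel_l /dvel_r /dstr_l /dstr_r.
case: D => [_ _|b [_ bc2] [_ bc1]]; first by apply: aeW.
move: bc1 bc2; apply: filterS2; first exact: (ae_filter_ringOfSetsType mu).
move=> s h1 h2 s0 _ [<-] /=; have [l1 r1] := h1 s0; have [l2 r2] := h2 s0.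
by split;
  [rewrite -[RHS](subrr (gl b s)) -{1}l1 -l2|rewrite -[RHS](subrr (gr b s)) -{1}r1 -r2]; ring.
Qed.

Lemma energy_rateE : {ae mu, forall s, 0 < s ->
  rate s = - boundary_dissipation G D w1 w2 s
    + (xi1 - xi2) * (ip (str w2 s \_ Om) (str w2 s \_ Om) - ip (str w1 s \_ Om) (str w1 s \_ Om))
    - (xi1 + xi2) * ip (dstr D w1 w2 s) (dstr D w1 w2 s)}.
Proof.
move: boundary_conditions_difference; apply: filterS; first exact: (ae_filter_ringOfSetsType mu).
move=> s H s0; rewrite /energy_rate (relaxation_work w1_sol w2_sol (ltW s0)) addrA.
congr (_ + _ - _).
rewrite /dvel_l /dvel_r /dstr_l /dstr_r; move: H D_adm.
case: D => [_ _|b H [_ [cl _] [cr _] _]]; first by rewrite /=; ring.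
have [l r] := H s0 b erefl.
have cl0 : cul b * ctaul b != 0 by rewrite lt_eqF.
have cr0 : cur b * ctaur b != 0 by rewrite gt_eqF.
by rewrite (boundary_dissipationE G cl0 cr0 l r) /trace; ring.
Qed.

(** One estimate for all the convergences: [lam = 0] gives the interior norms,
    [lam = trace_rate G b] with a trace for [x] gives the boundary norms. The nonnegative terms in
    [xi1 + xi2] and in [str w1] are dropped, so that, apart from the factor [xi1 - xi2], the bound
    depends on [w2] alone. *)
Lemma energy_bound (lam T : R) (x : R -> R) : 0 <= T -> 0 <= lam ->
  mu.-integrable `[0, T] (EFin \o (fun s => x s ^+ 2)) ->
  {ae mu, forall s, 0 < s -> lam * x s ^+ 2 <= boundary_dissipation G D w1 w2 s} ->
  ip (dstr D w1 w2 T) (dstr D w1 w2 T) + G * ip (dvel D w1 w2 T) (dvel D w1 w2 T)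
    + lam * int0 (fun s => x s ^+ 2) T <=
  (xi1 - xi2) * int0 (fun s => ip (str w2 s \_ Om) (str w2 s \_ Om)) T.
Proof.
move=> T0 lam0 xI dis; rewrite (energy_identity G_gt0 D_adm f_L2 w1_sol w2_sol T0).
move: T0; rewrite le_eqVlt => /orP[/eqP <-|T0]; first by rewrite !int00 !mulr0 addr0.
have mI : measurable (`[0, T]%classic : set (measurableTypeR R)) by exact: measurable_itv.
have rI := energy_rate_integrable w1_sol w2_sol T0.
have sI := str_square_integrable w2_sol T.
have lI := integrableZl mI lam xI; have dI := integrableZl mI (xi1 - xi2) sI.
rewrite -(int0Z lam xI) -(int0Z (xi1 - xi2) sI) -(int0D rI lI).
apply: (ae_le_int0 (ltW T0) (integrableD mI rI lI) dI).
move: dis energy_rateE; apply: filterS2; first exact: (ae_filter_ringOfSetsType mu).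
move=> s h1 h2 s0; rewrite (h2 s0); have := h1 s0.
have x12 : 0 <= xi1 - xi2 by rewrite subr_ge0.
have x12' : 0 <= xi1 + xi2 by rewrite addr_ge0// (le_trans xi2_ge0).
have := mulr_ge0 x12 (ip_ge0 (str w1 s \_ Om)).
have := mulr_ge0 x12' (ip_ge0 (dstr D w1 w2 s)).
rewrite mulrBr; lra.
Qed.

Lemma boundary_dissipation_ge0 :
  {ae mu, forall s, 0 < s -> 0 <= boundary_dissipation G D w1 w2 s}.
Proof.
apply: aeW => s _; move: D_adm; case: D => [//|b [_ [cl _] [cr _] _]].
rewrite addr_ge0// mulr_ge0 ?exprn_ge0//.
  by rewrite -mulrN -invrN divr_ge0 ?(ltW G_gt0)// -mulrA -mulrN mulr_ge0// oppr_ge0 ltW.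
by rewrite divr_ge0 ?(ltW G_gt0)// -mulrA mulr_ge0// ltW.
Qed.

Lemma interior_bound (T : R) : 0 <= T ->
  nrm (dvel D w1 w2 T) ^+ 2 <=
    (xi1 - xi2) * (G^-1 * int0 (fun s => ip (str w2 s \_ Om) (str w2 s \_ Om)) T) /\
  nrm (dstr D w1 w2 T) ^+ 2 <=
    (xi1 - xi2) * int0 (fun s => ip (str w2 s \_ Om) (str w2 s \_ Om)) T.
Proof.
move=> T0; have x0I : mu.-integrable `[0, T] (EFin \o (fun s : R => (0 : R) ^+ 2)).
  exact: cst_integrable.
have dis : {ae mu, forall s, 0 < s -> 0 * 0 ^+ 2 <= boundary_dissipation G D w1 w2 s}.
  move: boundary_dissipation_ge0; apply: filterS; first exact: (ae_filter_ringOfSetsType mu).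
  by move=> s H s0; rewrite mul0r H.
have := @energy_bound 0 T (fun=> 0) T0 (lexx _) x0I dis; rewrite mul0r addr0 !nrm_sqr => H.
have hS := ip_ge0 (dstr D w1 w2 T); have hU := ip_ge0 (dvel D w1 w2 T).
split; last by have := mulr_ge0 (ltW G_gt0) hU; lra.
by rewrite mulrCA ler_pdivlMl//; lra.
Qed.

(** The energy losses at the two ends are both nonnegative, so each trace is controlled by the loss
    at its own end, and the other loss can be added. *)
Lemma trace_domination b : D = BoundedInterval b -> {ae mu, forall s, 0 < s ->
  [/\ trace_rate G b * dvel_l D w1 w2 s ^+ 2 <= boundary_dissipation G D w1 w2 s,
      trace_rate G b * dstr_l D w1 w2 s ^+ 2 <= boundary_dissipation G D w1 w2 s,
      trace_rate G b * dvel_r D w1 w2 s ^+ 2 <= boundary_dissipation G D w1 w2 s &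
      trace_rate G b * dstr_r D w1 w2 s ^+ 2 <= boundary_dissipation G D w1 w2 s]}.
Proof.
move=> Db; move: boundary_conditions_difference; apply: filterS.
  exact: (ae_filter_ringOfSetsType mu).
move=> s H s0; have [l r] := H s0 b Db.
have [cl cr] : 0 < cul b * - ctaul b /\ 0 < cur b * ctaur b.
  by move: D_adm; rewrite Db => -[_ [cl _] [cr _] _]; rewrite mulrN oppr_gt0.
have cl0 : cul b * ctaul b != 0 by move: cl; rewrite mulrN oppr_gt0 => /lt_eqF ->.
have cr0 : cur b * ctaur b != 0 by rewrite gt_eqF.
(* At the left end the coefficients have a negative product; changing the signs of [ctaul b] and of
   the stress brings it to the form of the right end. *)
have l' : cul b * dvel_l D w1 w2 s + - ctaul b * - dstr_l D w1 w2 s = 0 by rewrite mulrNN.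
have [a1 a2 a3 a4] := dissipation_identity cl l'.
have [b1 b2 b3 b4] := dissipation_identity cr r.
have E : boundary_dissipation G D w1 w2 s = 2 * G * (dvel_l D w1 w2 s * dstr_l D w1 w2 s
    - dvel_r D w1 w2 s * dstr_r D w1 w2 s).
  move: l r; rewrite /dvel_l /dvel_r /dstr_l /dstr_r Db => l r.
  exact: (boundary_dissipationE G cl0 cr0 l r).
have G2 : 0 <= 2 * G by rewrite mulr_ge0// ltW.
rewrite E /trace_rate.
set m := Num.min (Num.min _ _) _.
have [m1 m2 m3 m4] : [/\ m <= cul b / - ctaul b, m <= - ctaul b / cul b,
    m <= cur b / ctaur b & m <= ctaur b / cur b].
  by rewrite /m; split; rewrite !ge_min lexx ?orbT.
have key (q x y z : R) : m <= q -> q * x ^+ 2 = y -> 0 <= z ->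
    2 * G * m * x ^+ 2 <= 2 * G * (y + z).
  move=> mq qx z0; rewrite -mulrA ler_wpM2l// -qx.
  by rewrite (le_trans (ler_wpM2r (sqr_ge0 x) mq))// lerDl.
have yl : 0 <= dvel_l D w1 w2 s * dstr_l D w1 w2 s.
  by move: a3; rewrite mulrN opprK => <-; rewrite mulr_ge0 ?sqr_ge0// ltW.
have yr : 0 <= - (dvel_r D w1 w2 s * dstr_r D w1 w2 s).
  by rewrite -b3 mulr_ge0 ?sqr_ge0// ltW.
rewrite sqrrN mulrN opprK in a4; rewrite mulrN opprK in a3.
split.
- exact: key m1 a3 yr.
- exact: key m2 a4 yr.
- by rewrite addrC; exact: key m3 b3 yl.
- by rewrite addrC; exact: key m4 b4 yl.
Qed.

Lemma trace_rate_gt0 b : D = BoundedInterval b -> 0 < trace_rate G b.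
Proof.
move=> Db.
have [cl cr] : 0 < cul b * - ctaul b /\ 0 < cur b * ctaur b.
  by move: D_adm; rewrite Db => -[_ [cl _] [cr _] _]; rewrite mulrN oppr_gt0.
have pos (c1 c2 : R) : 0 < c1 * c2 -> 0 < c1 / c2 /\ 0 < c2 / c1.
  move=> cc; have c2n : c2 != 0 by apply: contraTneq cc => ->; rewrite mulr0 ltxx.
  have E0 : c1 * c2 + c2 * - c1 = 0 by ring.
  by have [] := dissipation_identity cc E0.
have [l1 l2] := pos _ _ cl; have [r1 r2] := pos _ _ cr.
by rewrite /trace_rate !mulr_gt0// !lt_min l1 l2 r1 r2.
Qed.

Lemma trace_bound b (x : R -> R) (T : R) : D = BoundedInterval b -> 0 < T ->
  sqint (x \_ `]0, T]) ->
  {ae mu, forall s, 0 < s -> trace_rate G b * x s ^+ 2 <= boundary_dissipation G D w1 w2 s} ->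
  sqint (x \_ `]0, T[) /\ nrm (x \_ `]0, T[) ^+ 2 <=
    (xi1 - xi2) * ((trace_rate G b)^-1 * int0 (fun s => ip (str w2 s \_ Om) (str w2 s \_ Om)) T).
Proof.
move=> Db T0 sx dis; have lam0 := trace_rate_gt0 Db.
have xI := sqint_restrict_integrable sx.
have mI : measurable (`[0, T]%classic : set (measurableTypeR R)) by exact: measurable_itv.
have mo : measurable (`]0, T[%classic : set (measurableTypeR R)) by exact: measurable_itv.
have moc : measurable (`]0, T]%classic : set (measurableTypeR R)) by exact: measurable_itv.
have sxo : sqint (x \_ `]0, T[).
  rewrite (_ : _ \_ _ = (x \_ `]0, T]) \_ `]0, T[); first exact: sqint_restrict mo sx.
  apply/funext => s; rewrite !patchE; case: ifPn => //; rewrite inE/= in_itv/= => /andP[s0 sT].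
  by rewrite ifT// inE/= in_itv/= s0 ltW.
split => //.
have -> : nrm (x \_ `]0, T[) ^+ 2 = int0 (fun s => x s ^+ 2) T.
  rewrite nrm_sqr -ip_restrict /int0.
  have sub1 : `]0, T[%classic `<=` `[0, T] by apply: subset_itv; rewrite bnd_simp.
  have sub2 : `]0, T]%classic `<=` `[0, T] by apply: subset_itv; rewrite bnd_simp.
  rewrite -(Rintegral_itv_obnd_cbnd (integrableS mI moc sub2 xI)).
  rewrite -(Rintegral_itv_bndo_bndc (integrableS mI mo sub1 xI)).
  by apply: eq_Rintegral => s sI; rewrite patchE sI expr2.
have := energy_bound (ltW T0) (ltW lam0) xI dis.
have hS := ip_ge0 (dstr D w1 w2 T); have hU := mulr_ge0 (ltW G_gt0) (ip_ge0 (dvel D w1 w2 T)).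
by rewrite mulrCA ler_pdivlMl// => H; lra.
Qed.

End two_solutions.
End conclusions.

Lemma ip_restrict_square (R : realType) (A : set R) (f : R -> R) :
  \int[@lebesgue_measure R]_(y in A) f y ^+ 2 = ip (f \_ A) (f \_ A).
Proof.
rewrite Rintegral_mkcond; apply: eq_Rintegral => y _.
by rewrite !patchE; case: ifPn => // _; rewrite mul0r.
Qed.

(** The cross terms of the two squares cancel and leave [tau ^ 2 + G u ^ 2]. *)
Lemma energyE (R : realType) (G xi1 xi2 : R) (D : domain R) (u0 tau0 : R -> R)
    (f : R -> R -> R) (w1 w2 : wave R) (t : R) : 0 < G -> 0 <= t ->
  damped_wave_solution G xi1 D u0 tau0 f w1 ->
  damped_wave_solution G xi2 D u0 tau0 f w2 ->
  \int[@lebesgue_measure R]_(y in Omega D)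
      (2^-1 * (`|wplus G w1 t y - wplus G w2 t y| ^+ 2
               + `|wminus G w1 t y - wminus G w2 t y| ^+ 2)) =
  ip (dstr D w1 w2 t) (dstr D w1 w2 t) + G * ip (dvel D w1 w2 t) (dvel D w1 w2 t).
Proof.
move=> G0 t0 sol1 sol2; have [sU sS] := difference_sqint sol1 sol2 t0.
have GU := sqintZ G sU.
rewrite -(ipZl G sU sU) /ip
  -(RintegralD measurableT (sqint_integrableM sS sS) (sqint_integrableM GU sU)).
rewrite Rintegral_mkcond; apply: eq_Rintegral => y _.
rewrite patchE /dstr /dvel /= !patchE; case: ifPn => _; last by rewrite subr0 !mulr0 addr0.
rewrite !real_normK ?num_real// /wplus /wminus.
have G2 : Num.sqrt G ^+ 2 = G by rewrite sqr_sqrtr// ltW.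
rewrite -[in RHS]G2; by field.
Qed.

Theorem proposition1 (R : realType) (G : R) (D : domain R)
    (u0 tau0 : R -> R) (f : R -> R -> R) (xi2 : R) (w2 : wave R)
    (G_gt0 : 0 < G) (D_adm : admissible G D)
    (u0_L2 : L2 (Omega D) u0) (tau0_L2 : L2 (Omega D) tau0)
    (f_L2 : forall T, 0 < T -> L2_spacetime T (Omega D) f)
    (xi2_ge0 : 0 <= xi2)
    (w2_sol : damped_wave_solution G xi2 D u0 tau0 f w2) :
  let mu := @lebesgue_measure R in
  (forall (xi1 : R) (w1 : wave R), xi2 <= xi1 ->
    damped_wave_solution G xi1 D u0 tau0 f w1 ->
    let energy t := \int[mu]_(y in Omega D)
      (2^-1 * (`|wplus G w1 t y - wplus G w2 t y| ^+ 2
               + `|wminus G w1 t y - wminus G w2 t y| ^+ 2)) in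
    locally_absolutely_continuous energy /\
    {ae mu, forall t, 0 < t ->
      (energy^`())%classic t + boundary_dissipation G D w1 w2 t
      + (xi1 + xi2) * \int[mu]_(y in Omega D) (str w2 t y - str w1 t y) ^+ 2
      <= (xi1 - xi2) * \int[mu]_(y in Omega D) (str w2 t y) ^+ 2})
  /\
  (forall w1 : R -> wave R,
    (forall xi1, xi2 <= xi1 ->
      damped_wave_solution G xi1 D u0 tau0 f (w1 xi1)) ->
    let limit_xi2 := within [set xi1 | xi2 <= xi1] (nbhs xi2) in
    (forall t, 0 <= t ->
      (L2norm (Omega D) (vel (w1 xi1) t \- vel w2 t)
         @[xi1 --> limit_xi2] --> 0%E) /\
      (L2norm (Omega D) (str (w1 xi1) t \- str w2 t)
         @[xi1 --> limit_xi2] --> 0%E)) /\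
    (forall b, D = BoundedInterval b -> forall T, 0 < T ->
      [/\ L2norm `]0, T[ (vel_l (w1 xi1) \- vel_l w2)
            @[xi1 --> limit_xi2] --> 0%E,
          L2norm `]0, T[ (str_l (w1 xi1) \- str_l w2)
            @[xi1 --> limit_xi2] --> 0%E,
          L2norm `]0, T[ (vel_r (w1 xi1) \- vel_r w2)
            @[xi1 --> limit_xi2] --> 0%E &
          L2norm `]0, T[ (str_r (w1 xi1) \- str_r w2)
            @[xi1 --> limit_xi2] --> 0%E])).
Proof.
move=> mu; split.
  move=> xi1 w1 xi12 w1_sol energy.
  have rateI (T : R) : 0 < T -> mu.-integrable `[0, T] (EFin \o energy_rate G D xi1 xi2 w1 w2).
    by move=> T0; exact: (energy_rate_integrable w1_sol w2_sol T0).
  have eE t : 0 <= t -> energy t = int0 (energy_rate G D xi1 xi2 w1 w2) t.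
    move=> t0; rewrite /energy (energyE G_gt0 t0 w1_sol w2_sol).
    exact: (energy_identity G_gt0 D_adm f_L2 w1_sol w2_sol t0).
  have [lac de] := locally_absolutely_continuous_int0 rateI eE.
  split => //; move: de (energy_rateE D_adm w1_sol w2_sol).
  apply: filterS2; first exact: (ae_filter_ringOfSetsType mu).
  move=> t h1 h2 t0; rewrite (h1 t0) (h2 t0) !ip_restrict_square.
  have -> : ip ((fun y => str w2 t y - str w1 t y) \_ (Omega D))
      ((fun y => str w2 t y - str w1 t y) \_ (Omega D)) = ip (dstr D w1 w2 t) (dstr D w1 w2 t).
    apply: eq_Rintegral => y _; rewrite /dstr /= !patchE.
    by case: ifPn => _; [ring|rewrite subrr !mulr0].
  have x12 : 0 <= xi1 - xi2 by rewrite subr_ge0.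
  (* The only loss in the inequality is [xi1 - xi2] times the squared norm of [str w1 t]. *)
  have := mulr_ge0 x12 (ip_ge0 (str w1 t \_ (Omega D))).
  rewrite mulrBr; lra.
(* Every squared norm is bounded by [xi1 - xi2] times a constant independent of [xi1], the form
   required by [cvg_to_zero]. *)
move=> w1 w1_sol limit_xi2; split.
  move=> t t0; split; apply: cvg_to_zero => xi1 xi12.
    have [sU sS] := difference_sqint (w1_sol xi1 xi12) w2_sol t0.
    rewrite L2normE restrictB//; split; [by []|exact: nrm_ge0|].
    exact: (interior_bound G_gt0 D_adm f_L2 (w1_sol xi1 xi12) w2_sol xi12 xi2_ge0 t0).1.
  have [sU sS] := difference_sqint (w1_sol xi1 xi12) w2_sol t0.
  rewrite L2normE restrictB//; split; [by []|exact: nrm_ge0|].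
  exact: (interior_bound G_gt0 D_adm f_L2 (w1_sol xi1 xi12) w2_sol xi12 xi2_ge0 t0).2.
move=> b Db T T0.
have dom xi1 (xi12 : xi2 <= xi1) := trace_domination G_gt0 D_adm (w1_sol xi1 xi12) w2_sol Db.
have tsq xi1 (xi12 : xi2 <= xi1) := diff_traces_sqint (w1_sol xi1 xi12) w2_sol T0.
have bnd xi1 (xi12 : xi2 <= xi1) x := @trace_bound R G D u0 tau0 f xi1 xi2 (w1 xi1) w2
  G_gt0 D_adm f_L2 (w1_sol xi1 xi12) w2_sol xi12 xi2_ge0 b x T Db T0.
have concl (x : R -> R -> R) :
    (forall xi1, xi2 <= xi1 -> sqint (x xi1 \_ `]0, T]) /\
      {ae mu, forall s, 0 < s ->
        trace_rate G b * x xi1 s ^+ 2 <= boundary_dissipation G D (w1 xi1) w2 s}) ->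
    L2norm `]0, T[ (x xi1) @[xi1 --> limit_xi2] --> 0%E.
  move=> H; apply: cvg_to_zero => xi1 xi12; have [sx dx] := H xi1 xi12.
  have [sxo nx] := bnd xi1 xi12 _ sx dx.
  by rewrite L2normE//; split; [by []|exact: nrm_ge0|exact: nx].
split; apply: concl => xi1 xi12; have [q1 q2 q3 q4] := tsq xi1 xi12; have := dom xi1 xi12;
  move: q1 q2 q3 q4; rewrite /dvel_l /dstr_l /dvel_r /dstr_r Db /= => q1 q2 q3 q4 d.
- by split => //; move: d; apply: filterS; [exact: (ae_filter_ringOfSetsType mu)|
    move=> s H s0; have [] := H s0].
- by split => //; move: d; apply: filterS; [exact: (ae_filter_ringOfSetsType mu)|
    move=> s H s0; have [] := H s0].
- by split => //; move: d; apply: filterS; [exact: (ae_filter_ringOfSetsType mu)|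
    move=> s H s0; have [] := H s0].
- by split => //; move: d; apply: filterS; [exact: (ae_filter_ringOfSetsType mu)|
    move=> s H s0; have [] := H s0].
Qed.
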